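(* Let $\beta>0$ and $\mathrm{bc}\in\{\emptyset,\mathrm{per},\mathrm{Dir}\}$. Then (i) with $\mu\le0$: $$p(\beta,\mu)=\lim_{N\to\infty}\frac1{\beta|\Lambda_N|}\log e^{|\Lambda_N|\bar q^{(\mathrm{bc},\mu)}}=\frac1{\beta(4\pi\beta)^{d/2}}\sum_{k=1}^\infty\frac{e^{\beta\mu k}}{k^{1+d/2}};$$ (ii) with $\mu\le0$ and $a\ge0$: $$p^{\mathrm{CMF}}(\beta,\mu)=\lim_{N\to\infty}\frac1{\beta|\Lambda_N|}\log Z_N^{\mathrm{CMF}}(\beta,\mu)=\frac1{a\beta^2}W_0\big(a\beta\bar q^{(\mu)}\big)\Big(1+\frac12W_0\big(a\beta\bar q^{(\mu)}\big)\Big);$$ (iii) with $\mu\in\mathbb{R}$, $\alpha\le0$ and $a\ge0$: $$p^{\mathrm{PMF}}(\beta,\mu,\alpha)=\lim_{N\to\infty}\frac1{\beta|\Lambda_N|}\log Z_N^{\mathrm{PMF}}(\beta,\mu,\alpha)=\begin{cases}\frac a2{\delta^*}^2+\frac1\beta\sum_{k=1}^\infty q_k^{(0)}\exp\big(\beta k(\mu+\alpha-a\delta^* )\big), & \mu+\alpha\le a\varrho_c,\\[1ex] \frac{(\mu+\alpha)^2}{2a}+\frac1\beta\sum_{k=1}^\infty q_k^{(0)}, & \mu+\alpha\ge a\varrho_c;\end{cases}$$ (iv) with $\mu\in\mathbb{R}$, $\alpha\le0$ and $a>b\ge0$: $$p^{\mathrm{HYL}}(\beta,\mu,\alpha)=\lim_{N\to\infty}\frac1{\beta|\Lambda_N|}\log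 Z_N^{\mathrm{HYL}}(\beta,\mu,\alpha)=p(\beta,0)-\frac1\beta\inf_{x\in\ell_1(\mathbb{R})}\big\{I(x)+\beta H^{\mathrm{HYL}}_{\mu+\alpha,l.s.c.}(x)\big\}.$$
   Context: $d\in\mathbb{N}$ is the dimension, $\Lambda_N=[-N,N]^d$ and $|\Lambda_N|=(2N)^d$. For $\mu\le0$ put $q_k^{(\mu)}=\frac{e^{\beta\mu k}}{(4\pi\beta)^{d/2}k^{1+d/2}}$, $k\in\mathbb{N}$, and $\bar q^{(\mu)}=\sum_{k\ge1}q_k^{(\mu)}$. Let $g_t(x,y)=(4\pi t)^{-d/2}e^{-|x-y|^2/(4t)}$; let $g_t^{(\mathrm{per})}(x,y)=\sum_{z\in\mathbb{Z}^d}g_t(x,y+2Nz)$ (torus of side length $2N$); and let $g_t^{(\mathrm{Dir})}(x,y)$ be the transition density of Brownian motion with generator $\Delta$ restricted to paths staying in $\Lambda_N$. For $\mathrm{bc}=\emptyset$ set $q_k^{(\mathrm{bc},\mu)}=q_k^{(\mu)}$; for $\mathrm{bc}\in\{\mathrm{per},\mathrm{Dir}\}$ set $q_k^{(\mathrm{bc},\mu)}=\frac{e^{\beta\mu k}}{k|\Lambda_N|}\int_{\Lambda_N}g^{(\mathrm{bc})}_{k\beta}(x,x)\,dx$ for $k\le N$ and $0$ for $k>N$. Put $\bar q^{(\mathrm{bc},\mu)}=\sum_kq_k^{(\mathrm{bc},\mu)}$. Let $(\mathcal{N}_k)_{k\in\mathbb{N}}$ be independent Poisson variables with means $|\Lambda_N|q_k^{(\mathrm{bc},\mu)}$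 (numbers of cycles of length $k$), and let $\nu^{(\mathrm{bc})}_{N,\mu}$ be the law of $(\mathcal{N}_k/|\Lambda_N|)_{k}$ on $\ell_1(\mathbb{R}_+)$. For $x\in\ell_1(\mathbb{R}_+)$ let $D(x)=\sum_kkx_k$, $H^{\mathrm{CMF}}(x)=\frac a2\big(\sum_kx_k\big)^2$, $H^{\mathrm{PMF}}_\mu(x)=-\mu D(x)+\frac a2D(x)^2$, $H_\mu^{\mathrm{HYL}}(x)=-\mu D(x)+\frac a2D(x)^2-\frac b2\sum_kk^2x_k^2$, and $H^{\mathrm{HYL}}_{\mu,l.s.c.}(x)=H^{\mathrm{HYL}}_\mu(x)-\frac{(\mu-aD(x))_+^2}{2(a-b)}$ (lower semicontinuous regularisation of $H^{\mathrm{HYL}}_\mu$ on $\ell_1(\mathbb{R}_+)$; it equals $+\infty$ when $D(x)=\infty$). The partition functions are $Z_N^{\mathrm{CMF}}(\beta,\mu)=\mathbb{E}_{\nu^{(\mathrm{bc})}_{N,\mu}}\big[e^{-|\Lambda_N|\beta H^{\mathrm{CMF}}(x)}\big]$, $Z_N^{\mathrm{PMF}}(\beta,\mu,\alpha)=\mathbb{E}_{\nu^{(\mathrm{bc})}_{N,\alpha}}\big[e^{-|\Lambda_N|\beta H^{\mathrm{PMF}}_\mu(x)}\big]$, $Z_N^{\mathrm{HYL}}(\beta,\mu,\alpha)=\mathbb{E}_{\nu^{(\mathrm{bc})}_{N,\alpha}}\big[e^{-|\Lambda_N|\beta H^{\mathrm{HYL}}_\mu(x)}\big]$. $I(x)=\sum_kx_k\big(\log\frac{x_k}{q_k^{(0)}}-1\big)+\bar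 q^{(0)}$ for $x\in\ell_1(\mathbb{R}_+)$ and $I(x)=+\infty$ for other $x\in\ell_1(\mathbb{R})$. $W_0$ is the real branch of the Lambert function on $[-e^{-1},\infty)$ with $W_0(x)e^{W_0(x)}=x$, $W_0\ge-1$. $\varrho_c=(4\pi\beta)^{-d/2}\zeta(d/2)$ for $d\ge3$ and $\varrho_c=+\infty$ for $d=1,2$. $\delta^*=\delta^*(\beta,\mu+\alpha,a)$ is the unique solution of $\delta^*=\sum_{k\ge1}kq_k^{(0)}\exp\big(\beta k(\mu+\alpha-a\delta^* )_-\big)$, where $(t)_-=\min(t,0)$ and $(t)_+=\max(t,0)$.
   Formalization: In (ii)–(iv) Z_N is multiplied by the ideal factor e^{|Λ_N| q̄^(bc)} (at μ, resp. α), since with ν a probability measure the stated limits fail (e.g. Z^CMF ≤ 1); at a=0, (ii) is read as its limit q̄^(μ)/β and (iii) in [-∞,∞] with 0·∞=0, 1/0=∞. *)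

(* Defs.v *)
From HB Require Import structures.
From mathcomp Require Import all_boot all_order all_algebra.
From mathcomp Require Import all_classical all_reals all_analysis.

Set Implicit Arguments.
Unset Strict Implicit.
Unset Printing Implicit Defensive.

Import Order.TTheory GRing.Theory Num.Theory.
Import numFieldNormedType.Exports.

Local Open Scope classical_set_scope.
Local Open Scope ring_scope.

(* Sequences (x_k)_{k >= 1} are represented by functions nat -> R shifted by
   one: the value at k : nat is the coordinate of cycle length k.+1. *)

Inductive boundary := Free | Per | Dir.

Section Euclidean.
Variable R : realType.

(* The Lebesgue integral over R^d of a nonnegative Borel function, as an
   iterated integral (Tonelli); the library has no Lebesgue measure on R^d. *)
Fixpoint integral_Rd (d : nat) : ('rV[R]_d -> \bar R) -> \bar R :=
  match d with
  | 0 => fun f => f 0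
  | d'.+1 => fun f =>
      (\int[lebesgue_measure]_(t in [set: R])
         integral_Rd (fun y : 'rV[R]_d' =>
           f (row_mx (const_mx t : 'rV[R]_1) y : 'rV[R]_(d'.+1))))%E
  end.

Variable d : nat.
Implicit Types (x y : 'rV[R]_d) (t : R) (N : nat).

Definition borel (A : set 'rV[R]_d) : Prop :=
  <<s [set U : set 'rV[R]_d | open U] >> A.

Definition box N : set 'rV[R]_d :=
  [set x | forall i, - N%:R <= x 0 i <= N%:R].

Definition box_vol N : R := (2 * N%:R) ^+ d.

Definition heat_kernel t x y : R :=
  (4 * pi * t) `^ (- (d%:R / 2)) *
  expR (- (\sum_(i < d) (x 0 i - y 0 i) ^+ 2) / (4 * t)).

Definition heat_kernel_per N t x y : \bar R :=
  (\esum_(z in [set: 'rV[int]_d])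
     (heat_kernel t x (y + (2 * N%:R) *: map_mx intr z))%:E)%E.

(* Probability that the Brownian motion with generator Delta that sits at x at
   time s is in A i at the i-th of the times ts. *)
Fixpoint brownian_fdd (s : R) x (ts : seq R) (A : nat -> set 'rV[R]_d)
    : \bar R :=
  match ts with
  | [::] => 1%E
  | t :: ts' =>
      integral_Rd ((fun y => ((heat_kernel (t - s) x y)%:E *
        brownian_fdd t y ts' (fun i => A i.+1))%E) \_ (A 0%N))
  end.

(* Brownian motion with generator Delta (not Delta / 2), started at x. *)
Definition brownian_from disp (Omega : measurableType disp)
    (P : probability Omega R) (B : R -> Omega -> 'rV[R]_d) x : Prop :=
  [/\ forall t A, 0 <= t -> borel A -> measurable (B t @^-1` A),
      forall w, B 0 w = x,
      forall w, {within [set s : R | 0 <= s], continuous (fun s => B s w)} &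
      forall (ts : seq R) (A : nat -> set 'rV[R]_d),
        path <%R 0 ts -> (forall i, borel (A i)) ->
        P [set w | forall i, (i < size ts)%N -> A i (B (nth 0 ts i) w)] =
        brownian_fdd 0 x ts A].

(* g is the transition density at time t of Brownian motion restricted to
   paths staying in the box.  Continuity selects the version whose diagonal
   values are meaningful.  The law of a Brownian motion being unique, it is
   immaterial which one is used. *)
Definition dirichlet_density N t (g : 'rV[R]_d -> 'rV[R]_d -> R) : Prop :=
  [/\ forall x y, box N x -> box N y -> 0 <= g x y,
      {within box N `*` box N,
        continuous (fun u : 'rV[R]_d * 'rV[R]_d => g u.1 u.2)} &
      forall x, box N x ->
        exists (disp : measure_display) (Omega : measurableType disp)
               (P : probability Omega R) (B : R -> Omega -> 'rV[R]_d),
          brownian_from P B x /\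
          forall A, borel A ->
            P [set w | A (B t w) /\ forall s, 0 <= s <= t -> box N (B s w)] =
            integral_Rd ((fun y => (g x y)%:E) \_ (A `&` box N))].

End Euclidean.

Section Weights.
Variables (R : realType) (d : nat).
Implicit Types (beta mu : R) (k N : nat).

Definition q_free beta mu k : R :=
  expR (beta * mu * k.+1%:R) /
  ((4 * pi * beta) `^ (d%:R / 2) * k.+1%:R `^ (1 + d%:R / 2)).

Definition q_kernel (g : R -> 'rV[R]_d -> 'rV[R]_d -> \bar R) N beta mu k : R :=
  if (k.+1 <= N)%N then
    expR (beta * mu * k.+1%:R) / (k.+1%:R * box_vol R d N) *
    fine (integral_Rd ((fun x => g (k.+1%:R * beta) x x) \_ (@box R d N)))
  else 0.

(* gDir N t is the Dirichlet kernel of the box of half-side N; it is only used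
   when the boundary condition is Dir. *)
Definition q_bc (bc : boundary) (gDir : nat -> R -> 'rV[R]_d -> 'rV[R]_d -> R)
    N beta mu : nat -> R :=
  match bc with
  | Free => q_free beta mu
  | Per => q_kernel (@heat_kernel_per R d N) N beta mu
  | Dir => q_kernel (fun t x y => (gDir N t x y)%:E) N beta mu
  end.

Definition mass (x : nat -> R) : \bar R := (\sum_(0 <= k <oo) (x k)%:E)%E.

Definition ideal_pressure beta mu : \bar R :=
  ((beta * (4 * pi * beta) `^ (d%:R / 2))^-1%:E *
   \sum_(0 <= k <oo)
     (expR (beta * mu * k.+1%:R) / k.+1%:R `^ (1 + d%:R / 2))%:E)%E.

Definition zeta (s : R) : \bar R :=
  (\sum_(0 <= k <oo) ((k.+1%:R `^ s)^-1)%:E)%E.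

Definition rho_c beta : \bar R :=
  if (3 <= d)%N then (((4 * pi * beta) `^ (- (d%:R / 2)))%:E * zeta (d%:R / 2))%E
  else +oo%E.

(* The equation of delta^*, here with mu for mu + alpha.  It is read in
   [-oo, +oo] with 0 * oo = 0: for a = 0 <= mu and d <= 2 the only solution
   is +oo. *)
Definition delta_star_eq beta mu a (delta : \bar R) : Prop :=
  delta =
  (\sum_(0 <= k <oo) (k.+1%:R * q_free beta 0 k)%:E *
     expeR ((beta * k.+1%:R)%:E * Order.min (mu%:E - a%:E * delta) 0))%E.

Definition lambertW0 (z : R) : R :=
  xget 0 [set w : R | w * expR w = z /\ -1 <= w].

(* For a = 0 the formula W_0(a beta q) (1 + W_0(a beta q) / 2) / (a beta^2) is
   read as its limit q / beta when a tends to 0. *)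
Definition cmf_pressure beta mu a : \bar R :=
  if a == 0 then (beta^-1%:E * mass (q_free beta mu))%E
  else let w := lambertW0 (a * beta * fine (mass (q_free beta mu))) in
       ((a * beta ^+ 2)^-1 * w * (1 + w / 2))%:E.

End Weights.

Section Cycles.
Variable R : realType.

(* Independent Poisson variables N_k with means m k.  The second argument of
   poisson_prob is a dummy; poisson_prob with rate 0 is the Dirac mass at 0. *)
Record cycle_counts (m : nat -> R) := CycleCounts {
  cc_disp : measure_display;
  cc_space : measurableType cc_disp;
  cc_prob : probability cc_space R;
  cc_count : nat -> {RV cc_prob >-> nat};
  cc_poisson : forall (k : nat) (U : set nat),
    distribution cc_prob (cc_count k) U = poisson_prob (m k) 0%N U;
  cc_indep : forall (J : seq nat) (U : nat -> set nat), uniq J ->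
    cc_prob (\bigcap_(k in [set` J]) (cc_count k @^-1` U k)) =
    (\prod_(k <- J) cc_prob (cc_count k @^-1` U k))%E }.

(* Expectation of F under the law of (N_k / V)_k. *)
Definition expect_density (m : nat -> R) (X : cycle_counts m) (V : R)
    (F : (nat -> R) -> \bar R) : \bar R :=
  (\int[cc_prob X]_(w in [set: cc_space X])
     F (fun k => (cc_count X k w)%:R / V)%R)%E.

(* Partition function relative to the ideal gas: the law of the counts is
   normalised, so the ideal factor exp (V * sum_k q_k) is not included. *)
Definition partition_function (m : nat -> R) (X : cycle_counts m) (V beta : R)
    (H : (nat -> R) -> \bar R) : \bar R :=
  expect_density X V (fun x => expeR (- ((V * beta)%:E * H x)))%E.

End Cycles.

Section Energies.
Variable R : realType.
Implicit Types (x : nat -> R) (beta mu a b : R).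

Definition l1 x : Prop := (\sum_(0 <= k <oo) `|x k|%:E < +oo)%E.

Definition l1_pos x : Prop := l1 x /\ forall k, 0 <= x k.

Definition dens x : \bar R := (\sum_(0 <= k <oo) (k.+1%:R * x k)%:E)%E.

Definition H_cmf a x : \bar R := ((a / 2)%:E * mass x ^+ 2)%E.

(* H_pmf and H_hyl get the value +oo when the density is infinite; for a cycle
   configuration this is an event of probability zero.  In H_hyl the sum under
   fine is at most D ^+ 2 when x is nonnegative, hence finite. *)
Definition H_pmf mu a x : \bar R :=
  match dens x with
  | D%:E => (- mu * D + a / 2 * D ^+ 2)%:E
  | _ => +oo
  end%E.

Definition H_hyl mu a b x : \bar R :=
  match dens x with
  | D%:E => (- mu * D + a / 2 * D ^+ 2 - b / 2 *
      fine (\sum_(0 <= k <oo) (k.+1%:R ^+ 2 * x k ^+ 2)%:E)%E)%:E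
  | _ => +oo
  end%E.

Definition H_hyl_lsc mu a b x : \bar R :=
  (H_hyl mu a b x -
   ((Num.max (mu - a * fine (dens x)) 0) ^+ 2 / (2 * (a - b)))%:E)%E.

(* ln 0 = 0 in the library, so 0 log 0 = 0. *)
Definition rate_I (d : nat) beta x : \bar R :=
  if `[< l1_pos x >] then
    (\sum_(0 <= k <oo) (x k * (ln (x k / q_free d beta 0 k) - 1))%:E +
     mass (q_free d beta 0%R))%E
  else +oo%E.

End Energies.

(* Main.v *)
(* The cycle counts are independent Poisson variables, so that for the ideal gas
   a configuration of densities x has weight exp(-|Lambda_N| I(x)) up to
   subexponential factors, and the pressures come out of the Laplace principle.

   Weights.  q_k^(bc) tends to q_k for every k, and q_k^(bc) <= (1 + e) q_k for
   all k once N is large.  On the torus the sum over images is dominated by a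
   product of geometric series.  The Dirichlet kernel lies below g_t, and at
   distance l from the boundary it misses at most the mass of the paths that
   exit and come back, which vanishes as l grows.

   Lower bounds.  The single configuration floor(|Lambda_N| x_k), k < K, is
   estimated by Stirling's formula.  For PMF and HYL a further block of cycles
   of one length L, of density c / L, carries an additional particle density c
   at an entropic cost that vanishes as L grows: it is the condensate.

   Upper bounds.  For CMF and PMF, a/2 D^2 >= a s D - a/2 s^2 turns the
   interaction into a tilt of the Poisson parameters, with s the minimiser.  For
   HYL the counts of the cycles shorter than K are summed over finitely many
   configurations, whose number is polynomial in |Lambda_N|, while the contribution
   of the longer cycles to the energy is at least -(mu + alpha - a D)_+^2 / (2 (a - b)),
   the correction of the lower semicontinuous regularisation. *)

Require Import Defs.
From HB Require Import structures.
From mathcomp Require Import all_boot all_order all_algebra.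
From mathcomp Require Import all_classical all_reals all_analysis.
From mathcomp Require Import measurable_realfun ring lra.

Set Implicit Arguments.
Unset Strict Implicit.
Unset Printing Implicit Defensive.

Import Order.TTheory GRing.Theory Num.Theory.
Import numFieldNormedType.Exports.

Local Open Scope classical_set_scope.
Local Open Scope ring_scope.

(** Each upper bound dominates the Boltzmann weight, configuration by configuration, by products
    over the first [M] counts, for all [M] beyond a threshold that may depend on the configuration.
    Fatou's lemma then does the work of an almost sure finiteness statement for the number of
    cycles. The ideal factor exp(V qbar) cancels the factors exp(- m k) of the Poisson laws, so that
    both sides compare products of terms m^n / n!. Lower bounds fix finitely many lengths, the
    condensate included, before the volume grows, and use only pointwise convergence of the weights.
    This convergence has no uniform relative lower bound on the torus or in the Dirichlet box, where
    lengths beyond N have weight 0. Upper bounds sum over all lengths and need the uniform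
    comparison from above. For HYL, density c that escapes to a single long length still gains b c^2
    / 2, so the energy is not determined by the limiting densities of the fixed lengths. Both bounds
    therefore meet in [hyl_value], a functional of the [K] shortest lengths with the condensate
    optimised out, which is finally matched with the infimum over l1. *)

Section ExtendedReals.
Variable R : realType.

(** Treats finite and infinite limits at once: at +oo the second family of bounds is vacuous, at -oo
    the first. Each pressure thus splits into a lower and an upper bound by real constants. *)
Lemma cvge_between (u : nat -> \bar R) (l : \bar R) :
  (forall c : R, (c%:E < l)%E -> \forall n \near \oo, (c%:E <= u n)%E) ->
  (forall c : R, (l < c%:E)%E -> \forall n \near \oo, (u n <= c%:E)%E) ->
  u n @[n --> \oo] --> l.
Proof.
case: l => [r| |] lo hi.
- apply/fine_cvgP; split.
    have h1 := lo (r - 1) ltac:(rewrite lte_fin; lra).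
    have h2 := hi (r + 1) ltac:(rewrite lte_fin; lra).
    near=> n.
    have : ((r - 1)%:E <= u n <= (r + 1)%:E)%E.
      by apply/andP; split; near: n.
    by case: (u n) => //= /andP[].
  apply/cvgrPdist_le => e e0.
  have h1 := lo (r - e) ltac:(rewrite lte_fin; lra).
  have h2 := hi (r + e) ltac:(rewrite lte_fin; lra).
  near=> n.
  have : ((r - e)%:E <= u n <= (r + e)%:E)%E.
    by apply/andP; split; near: n.
  rewrite ler_distlC /=.
  by case: (u n) => [s| |]; rewrite ?leye_eq ?leeNy_eq ?andbF//= !lee_fin.
- by apply/cvgeyPge => c; apply: lo; rewrite ltry.
- by apply/cvgeNyPle => c; apply: hi; rewrite ltNyr.
Unshelve. all: by end_near. Qed.

End ExtendedReals.

Section Integral.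
Context disp (T : measurableType disp) (R : realType).
Variable mu : {measure set T -> \bar R}.
Local Open Scope ereal_scope.

Import HBNNSimple.

(* The integral of a nonnegative function is a supremum over simple functions,
   so neither monotonicity nor homogeneity needs measurability. *)
Lemma ge0_le_integralT (f g : T -> \bar R) :
  (forall x, 0 <= f x) -> (forall x, f x <= g x) ->
  \int[mu]_(x in [set: T]) f x <= \int[mu]_(x in [set: T]) g x.
Proof.
move=> f0 fg; have g0 x : 0 <= g x by apply: le_trans (fg x).
rewrite !ge0_integralTE//; apply: le_ereal_sup => _ [h hf <-].
by exists h => // x; apply: le_trans (fg x).
Qed.

Lemma ge0_integralTZl_le (c : R) (f : T -> \bar R) :
  (forall x, 0 <= f x) -> (0 <= c)%R ->
  \int[mu]_(x in [set: T]) (c%:E * f x) <= c%:E * \int[mu]_(x in [set: T]) f x.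
Proof.
move=> f0; rewrite le_eqVlt => /predU1P[<-|c0].
  by rewrite mul0e; under eq_integral do rewrite mul0e; rewrite integral0.
have cf0 x : 0 <= c%:E * f x by rewrite mule_ge0// lee_fin ltW.
rewrite ge0_integralTE//; apply: ge_ereal_sup => _ [h hf <-].
have ci : (0 <= c^-1)%R by rewrite invr_ge0 ltW.
rewrite -lee_pdivrMl// ge0_integralTE//.
rewrite -sintegralrM (_ : (_ \* _)%R = scale_nnsfun h ci)//.
apply: ereal_sup_ubound; exists (scale_nnsfun h ci) => //= x.
by rewrite EFinM lee_pdivrMl//; exact: hf.
Qed.

End Integral.

(** * Iterated Lebesgue integrals over R^d *)

Lemma row_cons0 (T : Type) d (t : T) (y : 'rV[T]_d) :
  ((row_mx (const_mx t : 'rV[T]_1) y : 'rV[T]_d.+1) 0 ord0 = t)%R.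
Proof.
transitivity ((const_mx t : 'rV[T]_1) 0%R ord0); last by rewrite mxE.
rewrite -(row_mxEl (const_mx t : 'rV[T]_1) y).
by congr (row_mx _ _ _ _); exact/val_inj.
Qed.

Lemma row_consS (T : Type) d (t : T) (y : 'rV[T]_d) i :
  ((row_mx (const_mx t : 'rV[T]_1) y : 'rV[T]_d.+1) 0 (lift ord0 i) = y 0 i)%R.
Proof.
rewrite -(row_mxEr (const_mx t : 'rV[T]_1) y 0%R i).
by congr (row_mx _ _ _ _); exact/val_inj.
Qed.

Section IntegralRd.
Variable R : realType.
Local Open Scope ereal_scope.

Lemma integral_Rd_ge0 d (f : 'rV[R]_d -> \bar R) :
  (forall x, 0 <= f x) -> 0 <= integral_Rd f.
Proof.
elim: d f => [|d IHd] f f0 /=; first exact: f0.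
by apply: integral_ge0 => t _; apply: IHd.
Qed.

Lemma le_integral_Rd d (f g : 'rV[R]_d -> \bar R) :
  (forall x, 0 <= f x) -> (forall x, f x <= g x) ->
  integral_Rd f <= integral_Rd g.
Proof.
elim: d f g => [|d IHd] f g f0 fg /=; first exact: fg.
by apply: ge0_le_integralT => t; [apply: integral_Rd_ge0|apply: IHd].
Qed.

Lemma integral_RdZ_le d (c : R) (f : 'rV[R]_d -> \bar R) :
  (forall x, 0 <= f x) -> (0 <= c)%R ->
  integral_Rd (fun x => c%:E * f x) <= c%:E * integral_Rd f.
Proof.
move=> f0 c0; elim: d f f0 => [|d IHd] f f0 //=.
apply: le_trans (ge0_integralTZl_le _ _ c0); last first.
  by move=> t; apply: integral_Rd_ge0.
apply: ge0_le_integralT => t; last exact: IHd.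
by apply: integral_Rd_ge0 => x; rewrite mule_ge0// lee_fin.
Qed.

Definition cube d (lo hi : 'I_d -> R) : set 'rV[R]_d :=
  [set x | forall i, (lo i <= x ord0 i <= hi i)%R].

(** The one integral over R^d that is evaluated; all others are compared with it by monotonicity. *)
Lemma integral_Rd_cube d (c : R) (lo hi : 'I_d -> R) :
  (0 <= c)%R -> (forall i, (lo i <= hi i)%R) ->
  integral_Rd ((fun=> c%:E) \_ (cube lo hi)) =
  (c * \prod_(i < d) (hi i - lo i))%:E.
Proof.
move=> c0; elim: d lo hi => [|d IHd] lo hi lohi /=.
  rewrite big_ord0 mulr1 patchT// inE; by case.
set c' := (c * \prod_(i < d) (hi (lift ord0 i) - lo (lift ord0 i)))%R.
transitivity (\int[lebesgue_measure]_(t in [set: R])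
    (c'%:E * (\1_(`[lo ord0, hi ord0]%classic) t)%:E)).
  apply: eq_integral => t _.
  have E y : cube lo hi (row_mx (const_mx t : 'rV[R]_1) y : 'rV[R]_d.+1) <->
      (lo ord0 <= t <= hi ord0)%R /\
      cube (fun i => lo (lift ord0 i)) (fun i => hi (lift ord0 i)) y.
    split=> [h|[h1 h2] i].
      by split=> [|i]; [have := h ord0|have := h (lift ord0 i)];
        rewrite ?row_cons0 ?row_consS.
    by case: (unliftP ord0 i) => [j|] ->; rewrite ?row_cons0 ?row_consS.
  have [tI|tI] := boolP (lo ord0 <= t <= hi ord0)%R.
    rewrite indicE mem_set/= ?in_itv//= mule1 /c' -IHd//.
    congr integral_Rd; apply/funext => y.
    rewrite /patch; case: ifPn => [/set_mem/E[_ ?]|/negP h]; first by rewrite mem_set.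
    rewrite memNset// => h'; apply: h; apply: mem_set; exact/E.
  rewrite indicE memNset/= ?in_itv//=; last exact/negP.
  rewrite mule0 [X in integral_Rd X](_ : _ = (fun=> 0%:E)).
    by elim: (d) => [//|n IHn] /=; rewrite IHn integral0.
  apply/funext => y; rewrite /patch memNset// => /E[] ; by rewrite (negPf tI).
transitivity (c'%:E * \int[@lebesgue_measure R]_(t in [set: R])
    (\1_(`[lo ord0, hi ord0]%classic) t)%:E).
  apply: (@ge0_integralZl_EFin _ _ R lebesgue_measure setT measurableT
    (fun t => (\1_(`[lo ord0, hi ord0]%classic) t)%:E)).
  - by move=> t _; rewrite lee_fin.
  - by apply/measurable_EFinP; exact: measurable_indic.
  - by rewrite mulr_ge0// prodr_ge0// => i _; rewrite subr_ge0.
rewrite integral_indic// setIT.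
rewrite [X in c'%:E * X](_ : _ = lebesgue_measure (`[lo ord0, hi ord0]%classic : set R))//.
rewrite lebesgue_measure_itv/= lte_fin big_ord_recl /c'.
rewrite (mulrC (hi ord0 - lo ord0)%R) mulrA.
case: ltP => [//|h]; rewrite mule0; congr EFin.
by rewrite (_ : hi ord0 = lo ord0) ?subrr ?mulr0//; apply/eqP; rewrite eq_le h lohi.
Qed.

End IntegralRd.

(** * Poisson expectations *)

Section Poisson.
Variable R : realType.

Definition poisson_weight (m : R) (n : nat) : R := m ^+ n / n`!%:R * expR (- m).

Lemma poisson_weight_ge0 m n : 0 <= m -> 0 <= poisson_weight m n.
Proof. by move=> m0; rewrite mulr_ge0 ?expR_ge0// divr_ge0// exprn_ge0. Qed.

Lemma nneseries_exp (x : R) : 0 <= x ->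
  (\sum_(0 <= n <oo) (x ^+ n / n`!%:R)%:E = (expR x)%:E)%E.
Proof.
move=> x0; rewrite /expR -EFin_lim; last exact: is_cvg_series_exp_coeff.
by apply/congr_lim/funext => n /=; rewrite /series/= sumEFin.
Qed.

Lemma poisson_expR (m s : R) : 0 <= m ->
  (\sum_(0 <= n <oo) (expR (s * n%:R) * poisson_weight m n)%:E =
   (expR (m * (expR s - 1)))%:E)%E.
Proof.
move=> m0.
have -> : m * (expR s - 1) = - m + m * expR s by ring.
rewrite expRD EFinM -(nneseries_exp (x := m * expR s)) ?mulr_ge0 ?expR_ge0//.
rewrite -nneseriesZl; last first.
  by move=> i _; rewrite lee_fin divr_ge0// exprn_ge0// mulr_ge0 ?expR_ge0.
apply: eq_eseriesr => n _; rewrite -EFinM expRM_natr exprMn /poisson_weight.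
by congr EFin; ring.
Qed.

Lemma poisson_indic (m : R) (n0 : nat) : 0 <= m ->
  (\sum_(0 <= n <oo) ((n == n0)%:R * poisson_weight m n)%:E =
   (poisson_weight m n0)%:E)%E.
Proof.
move=> m0.
rewrite (nneseriesD1 (n := n0))//; last first.
  move=> n _; case: eqP => [->|_]; last by rewrite mul0r.
  by rewrite mul1r lee_fin poisson_weight_ge0.
rewrite eqxx mul1r eseries0 ?adde0// => n _ /= /negPf ->.
by rewrite mul0r.
Qed.

Lemma limn_einf_ge (u : nat -> \bar R) (a : \bar R) :
  (\forall n \near \oo, (a <= u n)%E) -> (a <= limn_einf u)%E.
Proof.
move=> [n0 _ h]; rewrite limn_einf_lim (cvg_lim _ (@cvg_einfs_sup R u))//.
apply: (@le_trans _ _ (einfs u n0)); last by apply: ereal_sup_ubound; exists n0.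
by apply: le_ereal_inf_tmp => _ [n /= n0n <-]; exact: h.
Qed.

Lemma limn_einf_le (u : nat -> \bar R) (a : \bar R) :
  (\forall n \near \oo, (u n <= a)%E) -> (limn_einf u <= a)%E.
Proof.
move=> [n0 _ h]; rewrite limn_einf_lim (cvg_lim _ (@cvg_einfs_sup R u))//.
apply: ge_ereal_sup => _ [n _ <-].
apply: (@le_trans _ _ (u (maxn n n0))); last by apply: h => /=; exact: leq_maxr.
by apply: ereal_inf_lbound; exists (maxn n n0) => //=; exact: leq_maxl.
Qed.

Section CycleCounts.
Variables (m : nat -> R) (X : cycle_counts m).
Hypothesis m0 : forall k, 0 <= m k.
Local Notation P := (cc_prob X).
Local Notation N := (cc_count X).

Lemma cc_atom k n : P (N k @^-1` [set n]) = (poisson_weight (m k) n)%:E.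
Proof.
have -> : P (N k @^-1` [set n]) = distribution P (N k) [set n] by [].
rewrite cc_poisson /poisson_prob; case: ifPn => [mk|].
  by rewrite esum_set1 ?lee_fin ?poisson_pmf_ge0// /poisson_pmf mk.
(* At rate 0 [poisson_prob] is the Dirac mass at 0; the weight agrees with it because 0 ^+ 0 = 1. *)
rewrite -leNgt => mk; have -> : m k = 0 by apply/eqP; rewrite eq_le mk m0.
rewrite diracE /poisson_weight oppr0 expR0 mulr1.
case: n => [|n]; first by rewrite mem_set//= expr0 fact0 divr1.
by rewrite memNset//= expr0n/= mul0r.
Qed.

Lemma measurable_cc_preimage k (U : set nat) : measurable (N k @^-1` U).
Proof. by rewrite -[_ @^-1` _]setTI; exact: (@measurable_funPT _ _ _ _ (N k)). Qed.

Lemma measurable_bigcap_cc (J : seq nat) (U : nat -> set nat) :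
  measurable (\bigcap_(k in [set` J]) (N k @^-1` U k)).
Proof.
by apply: fin_bigcap_measurable => // k _; exact: measurable_cc_preimage.
Qed.

Lemma measurable_cc_prod (J : seq nat) (f : nat -> nat -> R) D : measurable D ->
  measurable_fun D (fun w => (\prod_(k <- J) f k (N k w))%:E).
Proof.
move=> mD; apply/measurable_EFinP; apply: measurable_prod => k _.
by apply: measurableT_comp => //; apply: measurable_funTS.
Qed.

(** Independence is given for events only. The induction peels a factor off [J] by splitting along
    the values of its count, which moves the coordinate into the list [J'] of prescribed events;
    carrying these events along is what closes the induction. *)
Lemma integral_cc_prod (J J' : seq nat) (f : nat -> nat -> R) (e : nat -> R)
    (U : nat -> set nat) :
  uniq (J ++ J') -> (forall k n, 0 <= f k n) ->
  (forall k, k \in J ->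
    \sum_(0 <= n <oo) (f k n * poisson_weight (m k) n)%:E = (e k)%:E)%E ->
  (\int[P]_(w in \bigcap_(k in [set` J']) (N k @^-1` U k))
     (\prod_(k <- J) f k (N k w))%:E =
   (\prod_(k <- J) e k)%:E * \prod_(k <- J') P (N k @^-1` U k))%E.
Proof.
move=> uJ f0; elim: J J' U uJ => [|k J IHJ] J' U /=.
  move=> uJ _; rewrite big_nil mul1e -cc_indep//.
  under eq_integral do rewrite big_nil.
  by rewrite integral_cst ?mul1e//; exact: measurable_bigcap_cc.
move=> /andP[kJ uJ] he.
have e0 : 0 <= e k.
  rewrite -lee_fin -he ?mem_head//; apply: nneseries_ge0 => n _ _.
  by rewrite lee_fin mulr_ge0// poisson_weight_ge0.
pose U' n i := if i == k then [set n] else U i.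
pose F n := \bigcap_(i in [set` k :: J']) (N i @^-1` U' n i).
have kJ' : k \notin J' by move: kJ; rewrite mem_cat negb_or => /andP[].
have FE n w : F n w <->
    (\bigcap_(i in [set` J']) (N i @^-1` U i)) w /\ N k w = n.
  split=> [h|[h1 h2] i /=].
    split=> [i /= iJ|]; last by have := h k; rewrite /U' /= mem_head eqxx; apply.
    have := h i; rewrite /U' /= inE iJ orbT.
    by case: eqP => [ik|_]; [move: kJ'; rewrite -ik iJ|apply].
  rewrite inE /U' => /orP[/eqP ->|iJ]; first by rewrite eqxx.
  by case: eqP => [ik|_]; [move: kJ'; rewrite -ik iJ|exact: h1].
have DE : \bigcap_(i in [set` J']) (N i @^-1` U i) = \bigcup_n F n.
  apply/seteqP; split=> w; first by move=> h; exists (N k w) => //; apply/FE.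
  by move=> [n _ /FE[]].
have mF n : measurable (F n) by exact: measurable_bigcap_cc.
rewrite DE ge0_integral_bigcup//; last 3 first.
- by apply: measurable_cc_prod; exact: bigcup_measurable.
- by move=> w _; rewrite lee_fin prodr_ge0.
- by apply/trivIsetP => i j _ _ ij; apply/seteqP; split=> // w [/FE[_ wi] /FE[_ wj]];
    rewrite -wi wj eqxx in ij.
set C := ((\prod_(i <- J) e i)%:E * \prod_(i <- J') P (N i @^-1` U i))%E.
have Cfin : C \is a fin_num.
  rewrite fin_numM//; elim: (J') => [|i s IHs]; rewrite ?big_nil// big_cons.
  by rewrite fin_numM// fin_num_measure//; exact: measurable_cc_preimage.
transitivity (\sum_(0 <= n <oo) (fine C)%:E * (f k n * poisson_weight (m k) n)%:E)%E.
  apply: eq_eseriesr => n _.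
  transitivity (\int[P]_(w in F n) ((f k n)%:E * (\prod_(i <- J) f i (N i w))%:E))%E.
    apply: eq_integral => w /set_mem/FE[_ wn].
    by rewrite big_cons wn EFinM.
  rewrite ge0_integralZl_EFin//; last 2 first.
  - by move=> w _; rewrite lee_fin prodr_ge0.
  - exact: measurable_cc_prod.
  rewrite IHJ; last 2 first.
  - by rewrite -(cat1s k) uniq_catCA /= kJ uJ.
  - by move=> i iJ; apply: he; rewrite inE iJ orbT.
  rewrite big_cons /U' eqxx cc_atom.
  rewrite (eq_big_seq (fun i => P (N i @^-1` U i))); last first.
    by move=> i iJ; case: eqP => // ik; move: kJ'; rewrite -ik iJ.
  rewrite fineK// /C (EFinM (f k n)) [RHS]muleC -(muleA (f k n)%:E)%E.
  by congr (_ * _)%E; rewrite muleCA.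
rewrite nneseriesZl; last by move=> n _; rewrite lee_fin mulr_ge0// poisson_weight_ge0.
rewrite he ?mem_head// fineK// /C big_cons EFinM.
by rewrite muleC muleA.
Qed.

(** The threshold for [M] may depend on [w]: the eventual bound controls a lower limit, and Fatou's
    lemma passes it through the integral, so no infinite product appears. The finite sum over [I]
    serves decompositions into finitely many cases. *)
Lemma integral_le_sum_prod (I : finType) (F : cc_space X -> \bar R)
    (f : I -> nat -> nat -> R) (e : I -> nat -> R) (C : I -> R) (B : R) :
  (forall w, 0 <= F w)%E -> (forall i k n, 0 <= f i k n) -> (forall i, 0 <= C i) ->
  (forall i k,
    \sum_(0 <= n <oo) (f i k n * poisson_weight (m k) n)%:E = (e i k)%:E)%E ->
  (forall w, \forall M \near \oo,
    (F w <= (\sum_i C i * \prod_(0 <= k < M) f i k (N k w))%:E)%E) ->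
  (\forall M \near \oo, \sum_i C i * \prod_(0 <= k < M) e i k <= B) ->
  (\int[P]_(w in [set: _]) F w <= B%:E)%E.
Proof.
move=> F0 f0 C0 he hF hB.
pose G M w := (\sum_i (C i)%:E * (\prod_(0 <= k < M) f i k (N k w))%:E)%E.
have prod0 M w i : (0 <= (\prod_(0 <= k < M) f i k (N k w))%:E)%E.
  by rewrite lee_fin prodr_ge0.
have CG0 M w i : (0 <= (C i)%:E * (\prod_(0 <= k < M) f i k (N k w))%:E)%E.
  by rewrite mule_ge0// lee_fin.
have mG M i : measurable_fun [set: cc_space X]
    (fun w => (C i)%:E * (\prod_(0 <= k < M) f i k (N k w))%:E)%E.
  by apply: measurable_funeM; exact: measurable_cc_prod.
apply: (@le_trans _ _ (\int[P]_(w in [set: _]) limn_einf (G ^~ w))%E).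
  apply: ge0_le_integralT => // w; apply: limn_einf_ge.
  apply: filterS (hF w) => M /le_trans; apply.
  by rewrite -sumEFin /G lee_sum.
apply: le_trans (fatou _ _ _ _) _ => //.
- by move=> M; apply: emeasurable_sum => i; exact: mG.
- by move=> M w _; apply: sume_ge0 => i _; exact: CG0.
apply: limn_einf_le; near=> M.
rewrite ge0_integral_sum//.
rewrite (eq_bigr (fun i => (C i * \prod_(0 <= k < M) e i k)%:E)).
  by rewrite sumEFin lee_fin; near: M.
move=> i _; rewrite ge0_integralZl_EFin//; last exact: measurable_cc_prod.
have := @integral_cc_prod (index_iota 0 M) [::] (f i) (e i) (fun=> setT).
rewrite cats0 iota_uniq => /(_ isT (f0 i) (fun k _ => he i k)).
by rewrite set_nil bigcap_set0 big_nil mule1 => ->.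
Unshelve. all: by end_near. Qed.

(** Prescribing all counts is a decreasing limit of conditions on the first [M] of them; the zeros
    beyond [K] contribute only factors exp(- m k), which [S] collects. *)
Lemma cc_configuration_ge (K : nat) (n : nat -> nat) (S : R) :
  (forall k, (K <= k)%N -> n k = 0%N) ->
  (forall M, \sum_(0 <= k < M) m k <= S) ->
  ((\prod_(0 <= k < K) (m k ^+ n k / (n k)`!%:R) * expR (- S))%:E <=
   P [set w | forall k, N k w = n k])%E.
Proof.
move=> n0 hS.
pose E M := \bigcap_(k in [set` index_iota 0 M]) (N k @^-1` [set n k]).
have -> : [set w | forall k, N k w = n k] = \bigcap_M E M.
  apply/seteqP; split=> w /= h; first by move=> M _ k _; exact: h.
  by move=> k; apply: (h k.+1 I k); rewrite /= mem_index_iota ltnSn.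
have mE M : measurable (E M) by exact: measurable_bigcap_cc.
have cE : P (E M) @[M --> \oo] --> P (\bigcap_M E M).
  apply: nonincreasing_cvg_mu => //.
  - by rewrite (le_lt_trans (probability_le1 _ _))// ltry.
  - exact: bigcapT_measurable.
  - move=> i j ij; apply/subsetPset => w h k /= ki; apply: h => /=.
    by move: ki; rewrite !mem_index_iota => /andP[_ ki]; exact: leq_trans ij.
rewrite -(cvg_lim _ cE)//; apply: lime_ge; first by apply/cvg_ex; eexists; exact: cE.
exists K => // M /= KM.
rewrite /E cc_indep ?iota_uniq// (eq_bigr _ (fun k _ => cc_atom k (n k))).
rewrite prodEFin lee_fin /poisson_weight [leRHS]big_split /=.
have -> : \prod_(0 <= i < M) expR (- m i) = expR (- \sum_(0 <= i < M) m i).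
  by rewrite -sumrN expR_sum.
apply: ler_pM; rewrite ?expR_ge0 ?ler_expR ?lerN2//.
  by apply: prodr_ge0 => k _; rewrite divr_ge0// exprn_ge0.
rewrite [leRHS](@big_cat_nat _ _ _ K)//=.
rewrite [X in _ <= _ * X](_ : _ = 1) ?mulr1//.
rewrite big_nat big1 // => k /andP[Kk _].
by rewrite n0// expr0 fact0 divr1.
Qed.

End CycleCounts.
End Poisson.

(** * Brownian paths leaving a box *)

Section Brownian.
Variables (R : realType) (d : nat).
Implicit Types (x y z : 'rV[R]_d) (s t : R).

Lemma closed_cube (lo hi : 'I_d -> R) : closed (cube lo hi).
Proof.
have -> : cube lo hi = \bigcap_(i in [set: 'I_d])
    ((fun x : 'rV[R]_d => x ord0 i) @^-1` [set r | lo i <= r <= hi i]).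
  by apply/seteqP; split=> x /= h i; [move=> _; exact: h|exact: h].
apply: closed_bigI => i _; apply: preimage_closed.
  by move=> x _; exact: coord_continuous.
rewrite (_ : [set r | _] = `[lo i, hi i]%classic); first exact: interval_closed.
by apply/seteqP; split=> r; rewrite /= in_itv.
Qed.

Lemma box_cube N : box N = cube (fun=> - N%:R) (fun=> N%:R) :> set 'rV[R]_d.
Proof. by []. Qed.

Lemma borelC (A : set 'rV[R]_d) : borel A -> borel (~` A).
Proof.
move=> bA G [[G0 GC GU] hG]; rewrite -setTD.
exact: (GC _ (bA G (conj (And3 G0 GC GU) hG))).
Qed.

Lemma borel_cube (lo hi : 'I_d -> R) : borel (cube lo hi).
Proof.
rewrite -[cube _ _]setCK; apply: borelC => G [_]; apply => /=.
by apply: closed_openC; exact: closed_cube.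
Qed.

Lemma heat_kernel_ge0 t x y : 0 <= heat_kernel t x y.
Proof. by rewrite mulr_ge0 ?powR_ge0 ?expR_ge0. Qed.

Lemma brownian_fdd_ge0 s x ts A : (0 <= brownian_fdd s x ts A)%E.
Proof.
elim: ts s x A => [//|t ts IHts] s x A /=; apply: integral_Rd_ge0 => y.
by rewrite /patch; case: ifP => // _; rewrite mule_ge0// lee_fin heat_kernel_ge0.
Qed.

(** The Markov property read off the nested integrals: a bound on the innermost one, uniform over
    the set visited at time [u], comes out as a constant factor. *)
Lemma brownian_fdd_rcons_le (c : R) u t ts s x (A : nat -> set 'rV[R]_d) : 0 <= c ->
  (forall z, A (size ts) z -> integral_Rd
     ((fun y => (heat_kernel (t - u) z y)%:E) \_ (A (size ts).+1)) <= c%:E)%E ->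
  (brownian_fdd s x (ts ++ [:: u; t]) A <=
   c%:E * brownian_fdd s x (ts ++ [:: u]) A)%E.
Proof.
move=> c0; elim: ts s x A => [|v ts IHts] s x A hA.
  rewrite /=; apply: le_trans (integral_RdZ_le _ c0); last first.
    move=> y; rewrite /patch; case: ifP => // _.
    by rewrite mule_ge0// lee_fin heat_kernel_ge0.
  apply: le_integral_Rd => y.
    rewrite /patch; case: ifP => // _; apply: mule_ge0; rewrite ?lee_fin ?heat_kernel_ge0//.
    apply: integral_Rd_ge0 => z; case: ifP => // _.
    by rewrite mule1 lee_fin heat_kernel_ge0.
  rewrite /patch; case: ifPn => [/set_mem yA|_]; last by rewrite mule0.
  rewrite mule1 muleC; apply: lee_wpmul2r; first by rewrite lee_fin heat_kernel_ge0.
  apply: le_trans (hA y yA); apply: le_integral_Rd => z.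
    by case: ifP => // _; rewrite mule1 lee_fin heat_kernel_ge0.
  by rewrite /patch; case: ifP => // _; rewrite mule1.
rewrite /=; apply: le_trans (integral_RdZ_le _ c0); last first.
  move=> y; rewrite /patch; case: ifP => // _.
  by rewrite mule_ge0 ?brownian_fdd_ge0// lee_fin heat_kernel_ge0.
apply: le_integral_Rd => y.
  rewrite /patch; case: ifP => // _.
  by rewrite mule_ge0 ?brownian_fdd_ge0// lee_fin heat_kernel_ge0.
rewrite /patch; case: ifPn => [_|_]; last by rewrite mule0.
rewrite muleCA; apply: lee_wpmul2l; first by rewrite lee_fin heat_kernel_ge0.
exact: IHts.
Qed.

Section Exit.
Context disp (Omega : measurableType disp) (P : probability Omega R).
Variables (B : R -> Omega -> 'rV[R]_d) (x : 'rV[R]_d).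
Hypothesis BM : brownian_from P B x.
Variables (N : nat) (t : R).
Hypothesis t0 : 0 < t.

Let dyadic n j : R := t * (j%:R / 2 ^+ n).

Definition stay : set Omega := [set w | forall s, 0 <= s <= t -> box N (B s w)].

Let stay_dyadic n : set Omega :=
  [set w | forall j, (j <= 2 ^ n)%N -> box N (B (dyadic n j) w)].

Lemma measurable_brownian s (A : set 'rV[R]_d) : 0 <= s -> borel A ->
  measurable (B s @^-1` A).
Proof. by case: BM => mB _ _ _; exact: mB. Qed.

Let dyadic_ge0 n j : 0 <= dyadic n j.
Proof. by rewrite mulr_ge0 ?(ltW t0)// divr_ge0// exprn_ge0. Qed.

Let measurable_stay_dyadic n : measurable (stay_dyadic n).
Proof.
rewrite (_ : stay_dyadic n = \bigcap_(j in [set j | (j <= 2 ^ n)%N])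
   (B (dyadic n j) @^-1` (box N))).
  apply: bigcap_measurableType => j _; apply: measurable_brownian => //.
  by rewrite box_cube; exact: borel_cube.
by apply/seteqP; split.
Qed.

(** The complement of the box is open, so a continuous path that is outside at time s is outside at
    all nearby times, in particular at s rounded down to a fine dyadic grid. *)
Let stayE : stay = \bigcap_n stay_dyadic n.
Proof.
apply/seteqP; split=> w /= h.
  move=> n _ j jn; apply: h; rewrite dyadic_ge0/= ler_piMr ?(ltW t0)//.
  by rewrite ler_pdivrMr ?mul1r// -natrX ler_nat.
move=> s /andP[s0 st]; apply: contrapT => ns.
case: BM => _ _ cB _.
have /subspace_continuousP/(_ s s0) := cB w.
move/(_ (~` box N)) => hc.
have /hc : nbhs (B s w) (~` box N).
  by apply: open_nbhs_nbhs; split=> //; rewrite box_cube; exact/closed_openC/closed_cube.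
rewrite /nbhs/= /within/= => /nbhs_ballP[e /= e0 he].
have [n hn] : exists n, t / 2 ^+ n < e.
  have : (2^-1 ^+ n @[n --> \oo] --> (0:R)).
    by apply: cvg_expr; rewrite ger0_norm ?invr_ge0// invf_lt1// ltr1n.
  move=> /cvgrPdist_lt/(_ (e / t)); rewrite divr_gt0// => /(_ isT)[n _ /(_ n (leqnn n))].
  rewrite sub0r normrN ger0_norm ?exprn_ge0 ?invr_ge0// => hn; exists n.
  by rewrite mulrC -ltr_pdivlMr// -exprVn.
pose j := Num.truncn (s / t * 2 ^+ n).
have st0 : 0 <= s / t * 2 ^+ n by rewrite mulr_ge0// divr_ge0// ltW.
have /andP[j1 j2] := truncn_itv st0.
have jn : (j <= 2 ^ n)%N.
  rewrite -(ler_nat R) natrX; apply: le_trans j1 _.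
  by rewrite ler_piMl// ler_pdivrMr// mul1r.
apply: (he (dyadic n j)) => //=; last exact: (h n I).
have a0 : 0 < 2 ^+ n :> R by rewrite exprn_gt0.
have sj1 : t * (j%:R / 2 ^+ n) <= s.
  rewrite mulrA ler_pdivrMr// mulrC -ler_pdivlMr//.
  by rewrite mulrAC.
have sj2 : s < t * (j%:R / 2 ^+ n) + t / 2 ^+ n.
  rewrite mulrA -mulrDl ltr_pdivlMr// -[X in _ + X]mulr1 -mulrDr natr1 mulrC.
  by rewrite -ltr_pdivrMl// mulrA mulrAC (mulrC t^-1).
rewrite /ball/= ger0_norm ?subr_ge0//; apply: lt_trans hn.
by rewrite ltrBlDl.
Qed.

Lemma measurable_stay : measurable stay.
Proof. by rewrite stayE; exact: bigcapT_measurable. Qed.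

(** The shift to [j.+1] skips time 0, where the path sits at [x] and which the strictly increasing
    times of [brownian_from] exclude. *)
Let first_exit n j : set Omega :=
  [set w | (forall i, (i < j)%N -> box N (B (dyadic n i.+1) w)) /\
           ~ box N (B (dyadic n j.+1) w)].

Let exit_times n j := mkseq (fun i => dyadic n i.+1) j ++ [:: dyadic n j.+1].

(** Entry [j.+1] is the set at the final time [t]. A list of times that stops at the exit never
    reads it, so one sequence describes the law with and without the final position. *)
Let exit_sets (A : set 'rV[R]_d) j i :=
  if (i < j)%N then box N else if (i == j)%N then ~` box N else A.

Let borel_exit_sets A j i : borel A -> borel (exit_sets A j i).
Proof.
rewrite /exit_sets => bA; case: ifP => _; first by rewrite box_cube; exact: borel_cube.
by case: ifP => // _; apply: borelC; rewrite box_cube; exact: borel_cube.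
Qed.

Let dyadic_lt n i j : (i < j)%N -> dyadic n i < dyadic n j.
Proof.
by move=> ij; rewrite /dyadic ltr_pM2l// ltr_pM2r ?invr_gt0 ?exprn_gt0// ltr_nat.
Qed.

Let dyadic_lt_t n j : (j < 2 ^ n)%N -> dyadic n j < t.
Proof.
move=> jn; rewrite /dyadic -[ltRHS]mulr1 ltr_pM2l// ltr_pdivrMr ?exprn_gt0// mul1r.
by rewrite -natrX ltr_nat.
Qed.

Let nth_exit_times n j i (s : seq R) : (i < j.+1)%N ->
  nth 0 (mkseq (fun i => dyadic n i.+1) j ++ (dyadic n j.+1 :: s)) i = dyadic n i.+1.
Proof.
rewrite ltnS leq_eqVlt nth_cat size_mkseq => /predU1P[->|ij].
  by rewrite ltnn subnn.
by rewrite ij nth_mkseq.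
Qed.

Let first_exitE n j A : borel A ->
  P (first_exit n j) = brownian_fdd 0 x (exit_times n j) (exit_sets A j).
Proof.
move=> bA; case: BM => _ _ _ <-; last by move=> i; exact: borel_exit_sets.
  congr (P _); apply/seteqP; split=> w.
    move=> [h1 h2] i; rewrite /exit_times size_cat size_mkseq addn1 => ij.
    rewrite nth_exit_times// /exit_sets; case: ltnP => [|ji]; first exact: h1.
    by rewrite (_ : i = j) ?eqxx//; apply/eqP; rewrite eqn_leq ji -ltnS ij.
  rewrite /exit_times size_cat size_mkseq addn1 => h; split=> [i ij|].
    have := h i (leqW ij); rewrite nth_exit_times ?ltnS 1?ltnW//.
    by rewrite /exit_sets ij.
  by have := h j (ltnSn _); rewrite nth_exit_times// /exit_sets ltnn eqxx.
apply/(pathP 0) => i; rewrite /exit_times size_cat size_mkseq addn1 => ij.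
rewrite [ltRHS]nth_exit_times//; case: i ij => [|i] ij /=.
  by rewrite -(_ : dyadic n 0 = 0) ?dyadic_lt// /dyadic mul0r mulr0.
by rewrite nth_exit_times ?dyadic_lt// (ltn_trans _ ij).
Qed.

Let first_exit_endE n j A : (j.+1 < 2 ^ n)%N -> borel A ->
  P ((B t @^-1` A) `&` first_exit n j) =
  brownian_fdd 0 x (mkseq (fun i => dyadic n i.+1) j ++ [:: dyadic n j.+1; t])
    (exit_sets A j).
Proof.
move=> jn bA; case: BM => _ _ _ <-; last by move=> i; exact: borel_exit_sets.
  congr (P _); apply/seteqP; split=> w.
    move=> [h0 [h1 h2]] i; rewrite size_cat size_mkseq addn2.
    rewrite ltnS leq_eqVlt => /predU1P[->|ij].
      rewrite nth_cat size_mkseq ltnNge leqnSn subSnn /=.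
      by rewrite /exit_sets ltnNge leqnSn gtn_eqF.
    rewrite nth_exit_times// /exit_sets; case: ltnP => [|ji]; first exact: h1.
    by rewrite (_ : i = j) ?eqxx//; apply/eqP; rewrite eqn_leq ji -ltnS ij.
  rewrite size_cat size_mkseq addn2 => h; split.
    have := h j.+1 (ltnSn _); rewrite nth_cat size_mkseq ltnNge leqnSn subSnn /=.
    by rewrite /exit_sets ltnNge leqnSn gtn_eqF.
  split=> [i ij|].
    have := h i (leqW (leqW ij)); rewrite nth_exit_times ?ltnS 1?ltnW//.
    by rewrite /exit_sets ij.
  by have := h j (leqW (ltnSn _)); rewrite nth_exit_times// /exit_sets ltnn eqxx.
apply/(pathP 0) => i; rewrite size_cat size_mkseq addn2.
have h0 k : (k < j.+2)%N -> nth 0 (0 :: mkseq (fun i => dyadic n i.+1) j ++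
    [:: dyadic n j.+1; t]) k = dyadic n k.
  case: k => [|k] kj /=; first by rewrite /dyadic mul0r mulr0.
  by rewrite nth_exit_times.
rewrite ltnS leq_eqVlt => /predU1P[->|ij].
  by rewrite h0// nth_cat size_mkseq ltnNge leqnSn subSnn /=; exact: dyadic_lt_t.
by rewrite h0 ?nth_exit_times ?dyadic_lt// leqW.
Qed.

Let measurable_first_exit n j : measurable (first_exit n j).
Proof.
have bb : borel (@box R d N) by rewrite box_cube; exact: borel_cube.
rewrite (_ : first_exit n j =
  (\bigcap_(i in [set i | (i < j)%N]) (B (dyadic n i.+1) @^-1` (box N))) `&`
  (B (dyadic n j.+1) @^-1` (~` box N))).
  apply: measurableI; last by apply: measurable_brownian => //; exact: borelC.
  by apply: bigcap_measurableType => i _; exact: measurable_brownian.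
by apply/seteqP; split.
Qed.

(* The Markov property is only needed at the first exit along the dyadic times
   of level [n], i.e. for finite-dimensional laws; then [n] tends to infinity
   and the continuity of the paths gives the exit in continuous time. *)
Lemma exit_before_le (A : set 'rV[R]_d) (c : R) : borel A -> A `<=` box N ->
  box N x -> 0 <= c ->
  (forall z u, ~ box N z -> 0 < u < t ->
     (integral_Rd ((fun y => (heat_kernel (t - u) z y)%:E) \_ A) <= c%:E)%E) ->
  (P (B t @^-1` A) <= P (B t @^-1` A `&` stay) + c%:E)%E.
Proof.
move=> bA AN xN c0 hc.
have mA : measurable (B t @^-1` A) by apply: measurable_brownian => //; exact: ltW.
have key n : (P (B t @^-1` A) <= P (B t @^-1` A `&` stay_dyadic n) + c%:E)%E.
  (* The first exit has an index between 1 and 2^n - 1: index 0 is the starting point, and index 2^n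
     is time [t], where the path is in [A] and hence in the box. *)
  pose M := (2 ^ n).-1.
  have ME : (M.+1 = 2 ^ n)%N by rewrite prednK// expn_gt0.
  have tFE : trivIset setT (first_exit n).
    apply/trivIsetP => i j _ _; wlog ij : i j / (i < j)%N.
      move=> h ij; case: (ltngtP i j) ij => // [ij _|ji _].
        by apply: h => //; rewrite ltn_eqF.
      by rewrite setIC; apply: h => //; rewrite ltn_eqF.
    by move=> _; apply/seteqP; split=> // w [[_ h1] [h2 _]]; apply: h1; exact: h2.
  have sumFE : (\sum_(j < M) P (first_exit n j) <= 1)%E.
    rewrite -(big_mkord xpredT (fun j => P (first_exit n j))) big_mkord.
    rewrite -measure_bigsetU// ?probability_le1//.
    by apply: bigsetU_measurable.
  pose G j := if j is j'.+1 then B t @^-1` A `&` first_exit n j'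
              else B t @^-1` A `&` stay_dyadic n.
  have mG j : measurable (G j) by case: j => [|j]; exact: measurableI.
  have cover : B t @^-1` A `<=` \big[setU/set0]_(j < M.+1) G j.
    move=> w Aw; rewrite -bigcup_mkord.
    have [sw|] := pselect (stay_dyadic n w); first by exists 0%N.
    move=> /existsNP[j0 /not_implyP[j0n nj0]].
    have ex : exists j, ~~ `[< box N (B (dyadic n j) w) >] by exists j0; apply/asboolPn.
    case: (ex_minnP ex) => j /asboolPn nj jmin.
    case: j nj jmin => [|j] nj jmin.
      exfalso; apply: nj; rewrite /dyadic mul0r mulr0.
      by case: BM => _ -> _ _.
    have jj0 : (j.+1 <= j0)%N by apply: jmin; apply/asboolPn.
    have jn : (j.+1 < 2 ^ n)%N.
      rewrite ltn_neqAle (leq_trans jj0 j0n) andbT; apply/eqP => jE; apply: nj.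
      by rewrite jE /dyadic natrX divff ?expf_neq0// mulr1; exact: AN.
    exists j.+1; first by rewrite /= ltnS -ltnS ME.
    split=> //; split=> // i ij; apply: contrapT => /asboolPn /jmin.
    by rewrite ltnS leqNgt ij.
  have := @content_subadditive _ _ _ P _ G M.+1 (fun k _ => mG k) mA cover.
  move=> /le_trans; apply; rewrite big_ord_recl /=; apply: leeD => //.
  apply: (@le_trans _ _ (\sum_(j < M) c%:E * P (first_exit n j))%E).
    apply: lee_sum => j _.
    have jM : (j.+1 < 2 ^ n)%N by rewrite -ME ltnS; exact: ltn_ord.
    rewrite first_exit_endE//.
    rewrite (first_exitE _ _ bA); apply: brownian_fdd_rcons_le => // z.
    rewrite size_mkseq /exit_sets ltnn eqxx ltnNge leqnSn /= gtn_eqF// => nz.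
    apply: hc => //; rewrite dyadic_lt_t// andbT.
    by rewrite -(_ : dyadic n 0 = 0) ?dyadic_lt// /dyadic mul0r mulr0.
  rewrite -ge0_sume_distrr; last by move=> j _; exact: measure_ge0.
  rewrite -[leRHS]mule1; apply: lee_wpmul2l; [by rewrite lee_fin|exact: sumFE].
have cF : P (B t @^-1` A `&` stay_dyadic n) @[n --> \oo] -->
    P (\bigcap_n (B t @^-1` A `&` stay_dyadic n)).
  apply: nonincreasing_cvg_mu => //.
  - by rewrite (le_lt_trans (probability_le1 _ _))// ?ltry//; exact: measurableI.
  - by move=> n; exact: measurableI.
  - by apply: bigcapT_measurable => n; exact: measurableI.
  - apply/nonincreasing_seqP => n; apply/subsetPset => w [Aw sw]; split=> // j jn.
    rewrite (_ : dyadic n j = dyadic n.+1 j.*2); last first.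
      rewrite /dyadic exprSr -muln2 natrM; congr (_ * _).
      by rewrite invfM mulrACA divff// mulr1.
    by apply: sw; rewrite expnSr muln2 leq_double.
have -> : B t @^-1` A `&` stay = \bigcap_n (B t @^-1` A `&` stay_dyadic n).
  rewrite stayE; apply/seteqP; split=> w /= h.
    by move=> n _; split=> [|j]; move: h; case=> // _ h; exact: h.
  by split=> [|n _]; have [] := h 0%N I => // _ _; have [] := h n I.
rewrite -leeBlDr//; apply: cvge_ge cF.
by apply: nearW => n; rewrite leeBlDr.
Qed.

End Exit.

End Brownian.

(** * The Dirichlet kernel on the diagonal *)

Section Dirichlet.
Variables (R : realType) (d : nat).
Implicit Types (x y z : 'rV[R]_d) (s t : R).

Definition heat_diag t : R := (4 * pi * t) `^ (- (d%:R / 2)).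

(** Bounds the kernel at distance at least [L] for all times s with 0 < s <= t. With u = L^2 / (4
    s), the inequality exp(- u) <= d! / u^d absorbs the singular prefactor (4 s)^(- d/2) and leaves
    an expression increasing in s; the power of pi is dropped. *)
Definition heat_tail t (L : R) : R := d`!%:R * (4 * t) `^ (d%:R / 2) / L ^+ (2 * d).

Lemma heat_diag_gt0 t : 0 < t -> 0 < heat_diag t.
Proof. by move=> t0; rewrite powR_gt0// !mulr_gt0// pi_gt0. Qed.

Lemma heat_tail_ge0 t L : 0 <= t -> 0 <= L -> 0 <= heat_tail t L.
Proof. by move=> t0 L0; rewrite divr_ge0 ?exprn_ge0// mulr_ge0 ?powR_ge0. Qed.

Lemma heat_kernel_le_diag t x y : 0 < t -> heat_kernel t x y <= heat_diag t.
Proof.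
move=> t0; rewrite ler_piMr ?powR_ge0// expR_le1 mulNr oppr_le0 divr_ge0//.
  by apply: sumr_ge0 => i _; exact: sqr_ge0.
by rewrite mulr_ge0// ltW.
Qed.

Lemma heat_kernel_ge_diag t (r : R) x y : 0 < t ->
  (forall i, `|y ord0 i - x ord0 i| <= r) ->
  heat_diag t * (1 - d%:R * r ^+ 2 / (4 * t)) <= heat_kernel t x y.
Proof.
move=> t0 hr; rewrite ler_wpM2l ?powR_ge0//.
apply: le_trans (expR_ge1Dx _); rewrite lerD2l mulNr lerN2 ler_pM2r; last first.
  by rewrite invr_gt0 mulr_gt0.
rewrite mulr_natl -[X in _ *+ X]card_ord -sumr_const ler_sum// => i _.
rewrite -[leLHS]ger0_norm ?sqr_ge0// normrX distrC lerXn2r ?nnegrE//.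
by rewrite (le_trans _ (hr i)).
Qed.

Lemma heat_kernel_le_tail s t (L : R) z y i : 0 < s -> s <= t -> 0 < L ->
  L <= `|z ord0 i - y ord0 i| -> heat_kernel s z y <= heat_tail t L.
Proof.
move=> s0 st L0 hL; have t0 : 0 < t by exact: lt_le_trans st.
have s4 : 0 < 4 * s by rewrite mulr_gt0.
set u := L ^+ 2 / (4 * s); have u0 : 0 < u by rewrite divr_gt0 ?exprn_gt0.
have hu : expR (- (\sum_(i < d) (z ord0 i - y ord0 i) ^+ 2) / (4 * s)) <= expR (- u).
  rewrite ler_expR mulNr lerN2 ler_pM2r ?invr_gt0//.
  rewrite (bigD1 i)//= -[leLHS]addr0 lerD//; last first.
    by apply: sumr_ge0 => j _; exact: sqr_ge0.
  by rewrite -[leRHS]ger0_norm ?sqr_ge0// normrX lerXn2r ?nnegrE ?(ltW L0).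
have hfact : expR (- u) <= d`!%:R / u ^+ d.
  rewrite expRN -[leRHS]invrK lef_pV2 ?posrE ?expR_gt0 ?invr_gt0 ?divr_gt0 ?ltr0n ?fact_gt0 ?exprn_gt0//.
  rewrite invf_div; case: (d) => [|d'].
    by rewrite expr0 fact0 divr1; apply: ltW; rewrite expR_gt1.
  by apply: le_trans (expR_ge1Dxn d' (ltW u0)); rewrite lerDr.
have hp : (4 * pi * s) `^ (- (d%:R / 2)) <= (4 * s) `^ (- (d%:R / 2)).
  rewrite !powRN lef_pV2 ?posrE ?powR_gt0// ?mulr_gt0 ?pi_gt0//.
  have pi2 := @pi_ge2 R.
  have s4pi : 4 * s <= 4 * pi * s by rewrite ler_pM2r//; lra.
  apply: ge0_ler_powR; rewrite ?nnegrE ?divr_ge0 ?(ltW s4)//.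
  exact: le_trans (ltW s4) s4pi.
apply: (@le_trans _ _ ((4 * s) `^ (- (d%:R / 2)) * (d`!%:R / u ^+ d))).
  by apply: ler_pM; rewrite ?powR_ge0 ?expR_ge0 ?(le_trans hu).
have -> : (4 * s) `^ (- (d%:R / 2)) * (d`!%:R / u ^+ d) =
    d`!%:R * (4 * s) `^ (d%:R / 2) / L ^+ (2 * d).
  have e : (4 * s) ^+ d = (4 * s) `^ (d%:R / 2) * (4 * s) `^ (d%:R / 2).
    rewrite -powRD; last by rewrite (gt_eqF s4) implybT.
    by rewrite -splitr powR_mulrn// ltW.
  rewrite /u expr_div_n invf_div e powRN exprM.
  have h1 : (4 * s) `^ (d%:R / 2) != 0 by rewrite gt_eqF// powR_gt0.
  have h2 : (L ^+ 2) ^+ d != 0 by rewrite !expf_neq0// gt_eqF.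
  by field; rewrite h1 h2.
rewrite /heat_tail ler_pM2r ?invr_gt0 ?exprn_gt0// ler_pM2l ?ltr0n ?fact_gt0//.
by apply: ge0_ler_powR; rewrite ?nnegrE ?divr_ge0//; lra.
Qed.

Lemma integral_Rd_cube_le (f : 'rV[R]_d -> \bar R) (c : R) (lo hi : 'I_d -> R) :
  0 <= c -> (forall i, lo i <= hi i) ->
  (forall y, cube lo hi y -> 0 <= f y <= c%:E)%E ->
  (integral_Rd (f \_ (cube lo hi)) <= (c * \prod_(i < d) (hi i - lo i))%:E)%E.
Proof.
move=> c0 lohi fc; rewrite -integral_Rd_cube//; apply: le_integral_Rd => y.
  by rewrite /patch; case: ifPn => // /set_mem /fc /andP[].
by rewrite /patch; case: ifPn => // /set_mem /fc /andP[].
Qed.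

Lemma integral_Rd_cube_ge (f : 'rV[R]_d -> \bar R) (c : R) (lo hi : 'I_d -> R) :
  0 <= c -> (forall i, lo i <= hi i) -> (forall y, cube lo hi y -> c%:E <= f y)%E ->
  ((c * \prod_(i < d) (hi i - lo i))%:E <= integral_Rd (f \_ (cube lo hi)))%E.
Proof.
move=> c0 lohi fc; rewrite -integral_Rd_cube//; apply: le_integral_Rd => y.
  by rewrite /patch; case: ifP => // _; rewrite lee_fin.
by rewrite /patch; case: ifPn => // /set_mem; exact: fc.
Qed.

Variables (N : nat) (t : R) (g : 'rV[R]_d -> 'rV[R]_d -> R).
Hypotheses (N0 : (0 < N)%N) (t0 : 0 < t) (Dg : dirichlet_density N t g).

Lemma dirichlet_near x (e : R) : box N x -> 0 < e ->
  exists2 r : R, 0 < r & forall y, box N y ->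
    (forall i, `|y ord0 i - x ord0 i| <= r) -> `|g x y - g x x| <= e.
Proof.
move=> xN e0; case: Dg => _ cg _.
have /subspace_continuousP/(_ (x, x)) := cg.
have xx : (box N `*` box N) (x, x) by [].
move=> /(_ xx) /cvgrPdist_le/(_ e e0).
rewrite /nbhs/= /within/= => -[[A1 A2] /= [xA1 xA2] hA].
move/nbhs_ballP: xA2 => [r /= r0 hr].
exists (r / 2); first by rewrite divr_gt0.
move=> y yN hy; rewrite distrC.
apply: (hA (x, y)) => //=; split; first exact: nbhs_singleton.
apply: hr; split=> // i j; rewrite (ord1 i) /ball /= distrC.
by rewrite (le_lt_trans (hy j))// ltr_pdivrMr// ltr_pMr// ltr1n.
Qed.

Lemma dirichlet_probability x : box N x ->
  exists (disp : measure_display) (Omega : measurableType disp)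
    (P : probability Omega R) (B : R -> Omega -> 'rV[R]_d),
    brownian_from P B x /\
    forall lo hi, cube lo hi `<=` box N ->
      P (B t @^-1` (cube lo hi) `&` stay B N t) =
        integral_Rd ((fun y => (g x y)%:E) \_ (cube lo hi)) /\
      P (B t @^-1` (cube lo hi)) =
        integral_Rd ((fun y => (heat_kernel t x y)%:E) \_ (cube lo hi)).
Proof.
move=> xN; case: Dg => _ _ /(_ x xN) [disp [T [P [B [BM hB]]]]].
exists disp, T, P, B; split=> // lo hi cN.
split.
  have := hB _ (borel_cube lo hi); rewrite (setIidl cN) => <-.
  by congr (measure_function.Measure.sort P _); apply/seteqP; split.
case: BM => _ _ _ /(_ [:: t] (fun _ => cube lo hi)) /=.
rewrite t0 => /(_ isT (fun _ => borel_cube lo hi)).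
rewrite (_ : [set w | _] = B t @^-1` cube lo hi); last first.
  by apply/seteqP; split=> w /= h; [exact: (h 0%N)|case].
move=> ->; congr integral_Rd; apply/funext => y; rewrite /patch; case: ifP => // _.
by rewrite mule1 subr0.
Qed.

(** Paths that stay form a subset of all paths, which compares integrals over cubes; continuity of
    [g] on a small cube turns this into a comparison at the point [x]. *)
Lemma dirichlet_diag_le x : box N x -> g x x <= heat_diag t.
Proof.
move=> xN; rewrite leNgt; apply/negP => hlt.
pose e := (g x x - heat_diag t) / 2.
have e0 : 0 < e by rewrite divr_gt0// subr_gt0.
have [r0 r00 hr] := dirichlet_near xN e0.
have NR : 0 < N%:R :> R by rewrite ltr0n.
(* The point [x] may lie on the boundary, so the cube is clipped to the box; its sides stay positive
   because N > 0. *)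
pose lo i := Num.max (x ord0 i - r0) (- N%:R).
pose hi i := Num.min (x ord0 i + r0) N%:R.
have lohi i : lo i < hi i.
  have /andP[h1 h2] := xN i; rewrite /lo /hi lt_min !gt_max; lra.
have cN : cube lo hi `<=` box N.
  move=> y hy i; have := hy i; rewrite /lo /hi ge_max le_min; lra.
have [disp [T [P [B [BM hP]]]]] := dirichlet_probability xN.
have [Pg Ph] := hP _ _ cN.
set vol := \prod_(i < d) (hi i - lo i).
have vol0 : 0 < vol by apply: prodr_gt0 => i _; rewrite subr_gt0.
have p0 := heat_diag_gt0 t0.
have h1 : (((heat_diag t + e) * vol)%:E <= P (B t @^-1` cube lo hi `&` stay B N t))%E.
  rewrite Pg; apply: integral_Rd_cube_ge => [|i|y hy]; [lra|exact: ltW|].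
  have hyr i : `|y ord0 i - x ord0 i| <= r0.
    have := hy i; rewrite /lo /hi ge_max le_min ler_norml; lra.
  by have := hr y (cN _ hy) hyr; rewrite ler_norml lee_fin /e; lra.
have h2 : (P (B t @^-1` cube lo hi) <= (heat_diag t * vol)%:E)%E.
  rewrite Ph; apply: integral_Rd_cube_le => [|i|y hy]; [exact: ltW|exact: ltW|].
  by rewrite !lee_fin heat_kernel_ge0 heat_kernel_le_diag.
have mBt : measurable (B t @^-1` cube lo hi).
  by apply: (measurable_brownian BM) (ltW t0) (borel_cube _ _).
have : (P (B t @^-1` cube lo hi `&` stay B N t) <= P (B t @^-1` cube lo hi))%E.
  apply: le_measure; rewrite ?inE//; apply: measurableI => //.
  exact: (measurable_stay BM).
move=> h3; have := le_trans h1 (le_trans h3 h2).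
by rewrite lee_fin ler_pM2r// gerDl leNgt e0.
Qed.

(** A path that has left the box must return to a cube of radius at most L / 2 about [x], hence
    cover a distance of at least L / 2. The density of such a return is at most [heat_tail],
    whatever the point and the time of the exit. *)
Lemma dirichlet_diag_ge x (L : R) : 0 < L ->
  (forall i, - N%:R + L <= x ord0 i <= N%:R - L) ->
  heat_diag t - heat_tail t (L / 2) <= g x x.
Proof.
move=> L0 hx; rewrite leNgt; apply/negP => hlt.
have xN : box N x by move=> i; have := hx i; rewrite -[0]/(ord0 : 'I_1); lra.
set ep := heat_tail t (L / 2) in hlt *.
have ep0 : 0 <= ep by rewrite heat_tail_ge0// ?ltW// divr_gt0.
have gxx0 : 0 <= g x x by case: Dg => + _ _; apply.
(* Two errors [e] occur, one from the continuity of [g] and one from that of the heat kernel;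
   together they stay below the supposed gap 3 e. *)
pose e := (heat_diag t - ep - g x x) / 3.
have e0 : 0 < e by rewrite divr_gt0// subr_gt0.
have [r0 r00 hr] := dirichlet_near xN e0.
have p0 := heat_diag_gt0 t0.
have [r1 r10 hr1] : exists2 r1 : R, 0 < r1 &
    heat_diag t * (d%:R * r1 ^+ 2 / (4 * t)) <= e.
  pose K := heat_diag t * (d%:R / (4 * t)).
  have K0 : 0 <= K by rewrite mulr_ge0 ?divr_ge0 ?mulr_ge0// ltW.
  have eK0 : 0 < e / (K + 1) by rewrite divr_gt0// ltr_wpDl.
  exists (Num.min 1 (e / (K + 1))); first by rewrite lt_min ltr01.
  set r1 := Num.min _ _.
  have r10 : 0 < r1 by rewrite lt_min ltr01.
  have r11 : r1 <= 1 by rewrite ge_min lexx.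
  have r1e : (K + 1) * r1 <= e by rewrite -ler_pdivlMl 1?mulrC ?ge_min ?lexx ?orbT// ltr_wpDl.
  have -> : heat_diag t * (d%:R * r1 ^+ 2 / (4 * t)) = K * r1 ^+ 2 by rewrite /K; ring.
  by nra.
pose r := Num.min (Num.min r0 r1) (L / 2).
have r_gt0 : 0 < r by rewrite !lt_min r00 r10 divr_gt0.
have rr0 : r <= r0 by rewrite !ge_min lexx.
have rr1 : r <= r1 by rewrite !ge_min lexx orbT.
have rL : r <= L / 2 by rewrite ge_min lexx orbT.
pose lo i := x ord0 i - r.
pose hi i := x ord0 i + r.
have lohi i : lo i <= hi i by rewrite /lo /hi; lra.
have cN : cube lo hi `<=` box N.
  by move=> y hy i; have := hy i; have := hx i; rewrite /lo /hi -[0]/(ord0 : 'I_1); lra.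
have [disp [T [P [B [BM hP]]]]] := dirichlet_probability xN.
have [Pg Ph] := hP _ _ cN.
set vol := \prod_(i < d) (hi i - lo i).
have vol0 : 0 < vol by apply: prodr_gt0 => i _; rewrite /hi /lo; lra.
have hyr y i : cube lo hi y -> `|y ord0 i - x ord0 i| <= r.
  by move=> /(_ i); rewrite /lo /hi ler_norml; lra.
have h1 : (P (B t @^-1` cube lo hi `&` stay B N t) <= ((g x x + e) * vol)%:E)%E.
  rewrite Pg; apply: integral_Rd_cube_le => [|//|y hy]; first lra.
  rewrite !lee_fin; apply/andP; split.
    by have yN := cN _ hy; case: Dg => + _ _; apply.
  by have := hr y (cN _ hy) (fun i => le_trans (hyr y i hy) rr0);
    rewrite ler_norml; lra.
have h2 : (((heat_diag t - e) * vol)%:E <= P (B t @^-1` cube lo hi))%E.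
  rewrite Ph; apply: integral_Rd_cube_ge => [|//|y hy].
    by rewrite /e; lra.
  rewrite lee_fin; apply: le_trans (heat_kernel_ge_diag t0 (fun i => le_trans (hyr y i hy) rr1)).
  by rewrite mulrBr mulr1; lra.
have h3 : (P (B t @^-1` cube lo hi) <=
    P (B t @^-1` cube lo hi `&` stay B N t) + (ep * vol)%:E)%E.
  apply: (exit_before_le BM t0) => //.
  - exact: borel_cube.
  - by rewrite mulr_ge0// ltW.
  move=> z u zN /andP[u0 ut]; apply: integral_Rd_cube_le => // y hy.
  rewrite !lee_fin heat_kernel_ge0 /=.
  have /existsNP[i /negP zi] := zN.
  apply: (@heat_kernel_le_tail _ _ _ _ _ i); [lra|lra|by rewrite divr_gt0|].
  have := hyr y i hy; have := hx i; move: zi.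
  rewrite -[0]/(ord0 : 'I_1) negb_and -!ltNge => /orP[zi|zi];
    rewrite ler_norml => h4 h5; rewrite ler_normr; apply/orP; [right|left]; lra.
have := le_trans h2 (le_trans h3 (leeD2r (ep * vol)%:E h1)).
rewrite -EFinD lee_fin -mulrDl ler_pM2r//.
by rewrite /e; lra.
Qed.

End Dirichlet.

(** * Weights of the cycles *)

Section LatticeSums.
Variable R : realType.

Lemma esum_int_geometric_le (c r : R) : 0 <= c -> 0 < r < 1 ->
  (\esum_(n in [set: int]) (c * r ^+ `|n|)%:E <= (c * ((1 + r) / (1 - r)))%:E)%E.
Proof.
move=> c0 /andP[r0 r1].
have r0' := ltW r0.
have cr0 n : (0 <= (c * r ^+ n)%:E)%E by rewrite lee_fin mulr_ge0// exprn_ge0.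
have geo (c' : R) : 0 <= c' ->
    (\esum_(n in [set: nat]) (c' * r ^+ n)%:E = (c' / (1 - r))%:E)%E.
  move=> c'0; rewrite -nneseries_esumT; last first.
    by move=> n; rewrite lee_fin mulr_ge0// exprn_ge0.
  apply/cvg_lim => //; rewrite (_ : (fun _ => _) = EFin \o series (geometric c' r)).
    apply: cvg_EFin; first exact: nearW.
    by apply: cvg_geometric_series; rewrite ger0_norm.
  by apply/funext => n /=; rewrite /series/= sumEFin.
rewrite (esumID (range Posz)); last by move=> n _; exact: cr0.
rewrite !setTI esum_image; last by move=> i j _ _ [].
have -> : ~` range Posz = range Negz.
  apply/seteqP; split=> [[n|n]|_ [n _ <-]] //=; last by case.
  - by move=> h; exfalso; apply: h; exists n.
  - by move=> _; exists n.
rewrite esum_image; last by move=> i j _ _ [].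
(* The absolute value of [Negz n] is n + 1, which produces the additional factor r. *)
under [X in (_ + X)%E]eq_esum do rewrite /= exprS mulrA.
rewrite geo// geo ?mulr_ge0// -EFinD lee_fin.
by rewrite -mulrDl -{1}(mulr1 c) -mulrDr mulrA.
Qed.

Lemma esum_lattice_geometric_le d (c r : R) : 0 <= c -> 0 < r < 1 ->
  (\esum_(z in [set: 'rV[int]_d]) (c * \prod_(i < d) r ^+ `|z ord0 i|)%:E <=
   (c * ((1 + r) / (1 - r)) ^+ d)%:E)%E.
Proof.
move=> + r01; have /andP[r0 r1] := r01.
have G0 : 0 <= (1 + r) / (1 - r) by rewrite divr_ge0; lra.
elim: d c => [|d IHd] c c0.
  rewrite (_ : [set: _] = [set 0]); last first.
    by apply/seteqP; split=> // z _ /=; apply/matrixP => i [].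
  by rewrite esum_set1 big_ord0 ?expr0 mulr1 ?lee_fin.
have bij : set_bij ([set: int] `*`` (fun=> [set: 'rV[int]_d])) [set: 'rV[int]_d.+1]
    (fun u => row_mx (const_mx u.1 : 'rV_1) u.2 : 'rV_d.+1).
  split=> // [[a u] [b v] _ _ /= E|z _].
    have -> : a = b by rewrite -(row_cons0 a u) E row_cons0.
    by congr pair; apply/rowP => i; rewrite -(row_consS a u) E row_consS.
  exists (z ord0 ord0, \row_i z ord0 (lift ord0 i)) => //=.
  apply/rowP => i; rewrite -[0]/(ord0 : 'I_1).
  by case: (unliftP ord0 i) => [j|] ->; rewrite ?row_consS ?row_cons0 ?mxE.
rewrite (@reindex_esum _ _ _ _ _ _ _ bij) -(@esum_esum _ _ _ _ _ (fun n u => (c *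
  \prod_(i < d.+1) r ^+ `|(row_mx (const_mx n : 'rV_1) u : 'rV_d.+1) ord0 i|)%:E))%E;
  last by move=> *; rewrite lee_fin mulr_ge0// prodr_ge0// => i _; rewrite exprn_ge0// ltW.
apply: (@le_trans _ _ (\esum_(n in [set: int])
    (c * ((1 + r) / (1 - r)) ^+ d * r ^+ `|n|)%:E)%E); last first.
  by rewrite exprSr mulrA; apply: esum_int_geometric_le; rewrite ?mulr_ge0// exprn_ge0.
apply: le_esum => n _.
under eq_esum => u _.
  rewrite big_ord_recl row_cons0.
  under eq_bigr do rewrite row_consS.
  rewrite mulrA.
  over.
rewrite mulrAC; apply: IHd; by rewrite mulr_ge0// exprn_ge0// ltW.
Qed.

End LatticeSums.

Section Weights.
Variables (R : realType) (d : nat) (beta : R).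
Hypothesis beta0 : 0 < beta.

(** In this form the free weight compares directly with [q_kernel], which averages a diagonal kernel
    at the same time k beta over the box. *)
Lemma q_freeE mu k : q_free d beta mu k =
  expR (beta * mu * k.+1%:R) * (heat_diag d (k.+1%:R * beta) / k.+1%:R).
Proof.
have k0 : 0 < k.+1%:R :> R by rewrite ltr0n.
rewrite /q_free /heat_diag; congr (_ * _).
rewrite powRD ?pnatr_eq0 ?implybT// powRr1 ?ltW//.
have -> : 4 * pi * (k.+1%:R * beta) = 4 * pi * beta * k.+1%:R by ring.
rewrite !powRN (powRM (x := 4 * pi * beta)) ?mulr_ge0 ?pi_ge0 ?ltW//.
have h1 : (4 * pi * beta) `^ (d%:R / 2) != 0.
  by rewrite gt_eqF// powR_gt0// !mulr_gt0// pi_gt0.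
have h2 : k.+1%:R `^ (d%:R / 2) != 0 :> R by rewrite gt_eqF// powR_gt0.
by field; rewrite h1 h2 nat1r pnatr_eq0.

Qed.

Lemma q_free_gt0 mu k : 0 < q_free d beta mu k.
Proof. by rewrite q_freeE mulr_gt0 ?expR_gt0// divr_gt0// heat_diag_gt0// mulr_gt0. Qed.

Lemma box_vol_gt0 N : (0 < N)%N -> 0 < box_vol R d N.
Proof. by move=> N0; rewrite exprn_gt0// mulr_gt0// ltr0n. Qed.

Variables (bc : boundary) (gDir : nat -> R -> 'rV[R]_d -> 'rV[R]_d -> R).

Lemma q_bc_mu N mu k : q_bc bc gDir N beta mu k =
  expR (beta * mu * k.+1%:R) * q_bc bc gDir N beta 0 k.
Proof.
case: bc => /=; rewrite /q_free /q_kernel mulr0 mul0r expR0 ?mul1r ?div1r//;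
  by case: ifP; rewrite ?mulr0// mulrA.
Qed.

Lemma integral_Rd_box_cst (c : R) N : 0 <= c ->
  integral_Rd ((fun=> c%:E) \_ (@box R d N)) = (c * box_vol R d N)%:E.
Proof.
move=> c0; rewrite box_cube integral_Rd_cube//; last first.
  by move=> _; rewrite lerNl (le_trans _ (ler0n R N))// oppr_le0.
rewrite /box_vol (eq_bigr (fun=> 2 * N%:R)); last by move=> i _; ring.
by rewrite big_const_ord iter_mulr_1.
Qed.

Lemma heat_kernel_perE N (t : R) (x : 'rV[R]_d) : 0 < t ->
  heat_kernel_per N t x x = (\esum_(z in [set: 'rV[int]_d])
    (heat_diag d t * expR (- (N%:R ^+ 2 / t * \sum_(i < d) (z ord0 i)%:~R ^+ 2)))%:E)%E.
Proof.
move=> t0; apply: eq_esum => z _; congr EFin; rewrite /heat_kernel; congr (_ * expR _).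
rewrite mulNr; congr (- _).
rewrite (eq_bigr (fun i => 4 * N%:R ^+ 2 * (z ord0 i)%:~R ^+ 2)); last first.
  by move=> i _; rewrite !mxE; ring.
by rewrite -mulr_sumr; field; rewrite gt_eqF.
Qed.

(** Here the cutoff k <= N of the weights enters: t <= N beta gives N^2 / t >= N / beta, and z^2 >=
    |z| for integers turns the Gaussian into a geometric sequence whose ratio exp(- N / beta) does
    not depend on t. *)
Lemma heat_kernel_per_bounds N (t : R) : (0 < N)%N -> 0 < t <= N%:R * beta ->
  exists2 C : R, (forall x, @heat_kernel_per R d N t x x = C%:E) &
    heat_diag d t <= C <= heat_diag d t *
      ((1 + expR (- (N%:R / beta))) / (1 - expR (- (N%:R / beta)))) ^+ d.
Proof.
move=> N0 /andP[t0 tN].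
have NR : 0 < N%:R :> R by rewrite ltr0n.
set r := expR _.
have r01 : 0 < r < 1 by rewrite expR_gt0 expR_lt1 oppr_lt0 divr_gt0.
set S := (\esum_(z in [set: 'rV[int]_d])
    (heat_diag d t * expR (- (N%:R ^+ 2 / t * \sum_(i < d) (z ord0 i)%:~R ^+ 2)))%:E)%E.
have p0 := heat_diag_gt0 d t0.
have S1 : ((heat_diag d t)%:E <= S)%E.
  apply: esum_ge; exists [set 0]; first by split=> //; exact: finite_set1.
  rewrite fsbig_set1 big1 ?mulr0 ?oppr0 ?expR0 ?mulr1// => i _.
  by rewrite mxE expr0n.
have S2 : (S <= (heat_diag d t * ((1 + r) / (1 - r)) ^+ d)%:E)%E.
  apply: le_trans (esum_lattice_geometric_le _ (ltW p0) r01).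
  apply: le_esum => z _; rewrite lee_fin ler_pM2l//.
  rewrite mulr_sumr -sumrN expR_sum; apply: ler_prod => i _.
  rewrite expR_ge0 /= /r -expRM_natr ler_expR mulNr lerN2.
  rewrite natr_absz; set a := z ord0 i.
  have h1 : `|a|%:~R <= a%:~R ^+ 2 :> R.
    rewrite -rmorphXn /= ler_int.
    rewrite -(@real_normK _ a) ?num_real//.
    have [->|a0] := eqVneq a 0; first by rewrite normr0.
    by rewrite expr2 ler_peMr// -gtz0_ge1 normr_gt0.
  apply: ler_pM => //; rewrite ?divr_ge0 ?ler0z ?(ltW NR) ?(ltW beta0)//.
  rewrite ler_pdivrMr// mulrAC ler_pdivlMr// expr2 -mulrA ler_pM2l//.
have Sfin : S \is a fin_num.
  by rewrite fin_numElt (lt_le_trans _ S1) ?ltNyr// (le_lt_trans S2) ?ltry.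
exists (fine S); first by move=> x; rewrite heat_kernel_perE// fineK.
by rewrite -!lee_fin fineK// S1 S2.
Qed.

End Weights.

Lemma cvg_invn (R : realType) : N%:R^-1 @[N --> \oo] --> (0 : R).
Proof.
have h : \forall N \near \oo, 0 < N%:R :> R by exists 1%N => // N /= N0; rewrite ltr0n.
exact: (gtr0_cvgV0 h).2 cvgr_idn.
Qed.

Lemma cvg_exprn (R : realType) (u : nat -> R) (l : R) n :
  u N @[N --> \oo] --> l -> u N ^+ n @[N --> \oo] --> l ^+ n.
Proof.
move=> ul; elim: n => [|n IHn]; first by under eq_cvg do rewrite expr0; exact: cvg_cst.
by under eq_cvg do rewrite exprS; rewrite exprS; exact: cvgM.
Qed.

Section WeightLimits.
Variables (R : realType) (d : nat) (beta : R).
Hypotheses (d0 : (0 < d)%N) (beta0 : 0 < beta).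
Variables (bc : boundary) (gDir : nat -> R -> 'rV[R]_d -> 'rV[R]_d -> R).
Hypothesis hDir : bc = Dir -> forall (N : nat) (t : R), (0 < N)%N -> 0 < t ->
  dirichlet_density N t (gDir N t).

Local Notation q0 := (q_free d beta 0).

Lemma q_free0E k : q0 k = heat_diag d (k.+1%:R * beta) / k.+1%:R.
Proof. by rewrite q_freeE// mulr0 mul0r expR0 mul1r. Qed.

Let G N : R := ((1 + expR (- (N%:R / beta))) / (1 - expR (- (N%:R / beta)))) ^+ d.

Lemma q_per_bounds N k : (k.+1 <= N)%N ->
  q0 k <= q_bc Per gDir N beta 0 k <= q0 k * G N.
Proof.
move=> kN; have N0 : (0 < N)%N by exact: leq_trans kN.
have t0 : 0 < k.+1%:R * beta by rewrite mulr_gt0.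
have tN : 0 < k.+1%:R * beta <= N%:R * beta by rewrite t0 ler_pM2r// ler_nat.
have [C CE /andP[C1 C2]] := heat_kernel_per_bounds d beta0 N0 tN.
have C0 : 0 <= C by exact: le_trans (ltW (heat_diag_gt0 d t0)) C1.
have -> : q_bc Per gDir N beta 0 k = C / k.+1%:R.
  rewrite /= /q_kernel kN mulr0 mul0r expR0 div1r.
  rewrite [X in X \_ _](_ : _ = fun=> C%:E); last by apply/funext => x; exact: CE.
  rewrite integral_Rd_box_cst//=.
  have v0 := box_vol_gt0 R d N0.
  by field; rewrite (gt_eqF v0) nat1r pnatr_eq0.
by rewrite q_free0E mulrAC !ler_pM2r ?invr_gt0// C1 C2.
Qed.

Lemma q_dir_bounds N k : bc = Dir -> (k.+1 <= N)%N ->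
  0 <= q_bc Dir gDir N beta 0 k <= q0 k.
Proof.
move=> bD kN; have N0 : (0 < N)%N by exact: leq_trans kN.
have t0 : 0 < k.+1%:R * beta by rewrite mulr_gt0.
have Dg := hDir bD N0 t0; set t := k.+1%:R * beta in t0 Dg *.
have NR := ler0n R N.
have p0 := heat_diag_gt0 d t0.
rewrite /= /q_kernel kN mulr0 mul0r expR0 div1r -/t; set J := integral_Rd _.
have J0 : (0 <= J)%E.
  apply: integral_Rd_ge0 => x; rewrite /patch; case: ifPn => // /set_mem xN.
  by rewrite lee_fin; case: Dg => + _ _; apply.
have J1 : (J <= (heat_diag d t * box_vol R d N)%:E)%E.
  rewrite -integral_Rd_box_cst ?(ltW p0)//; apply: le_integral_Rd => x.
    rewrite /patch; case: ifPn => // /set_mem xN.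
    by rewrite lee_fin; case: Dg => + _ _; apply.
  rewrite /patch; case: ifPn => // /set_mem xN.
  by rewrite lee_fin; exact: (dirichlet_diag_le N0 t0 Dg).
have Jfin : J \is a fin_num.
  by rewrite fin_numElt (lt_le_trans _ J0) ?ltNyr// (le_lt_trans J1) ?ltry.
have v0 := box_vol_gt0 R d N0.
rewrite mulr_ge0 ?invr_ge0 ?mulr_ge0 ?fine_ge0 ?(ltW v0)//= q_free0E -/t.
rewrite invfM -mulrA mulrC ler_pM2r ?invr_gt0// mulrC ler_pdivrMr//.
by rewrite -lee_fin fineK.
Qed.

(** The layer of width L along the boundary is discarded; (1 - L / N)^d is the volume fraction of
    the inner box, where the diagonal estimate holds. *)
Lemma q_dir_ge N k (L : R) : bc = Dir -> (k.+1 <= N)%N -> 0 < L < N%:R ->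
  let t := k.+1%:R * beta in heat_tail d t (L / 2) <= heat_diag d t ->
  (heat_diag d t - heat_tail d t (L / 2)) / k.+1%:R * (1 - L / N%:R) ^+ d <=
  q_bc Dir gDir N beta 0 k.
Proof.
move=> bD kN /andP[L0 LN] t hL; have N0 : (0 < N)%N by exact: leq_trans kN.
have t0 : 0 < t by rewrite mulr_gt0.
have Dg := hDir bD N0 t0.
have /andP[_] := q_dir_bounds bD kN.
rewrite /= /q_kernel kN mulr0 mul0r expR0 div1r -/t; set J := integral_Rd _ => hJ.
set c := heat_diag d t - heat_tail d t (L / 2).
have c0 : 0 <= c by rewrite subr_ge0.
have NR : 0 < N%:R :> R by rewrite ltr0n.
have J1 : ((c * (2 * (N%:R - L)) ^+ d)%:E <= J)%E.
  have -> : (2 * (N%:R - L)) ^+ d = \prod_(i < d) ((N%:R - L) - (- N%:R + L)).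
    rewrite (eq_bigr (fun=> 2 * (N%:R - L))); last by move=> i _; ring.
    by rewrite big_const_ord iter_mulr_1.
  rewrite -integral_Rd_cube//; last by move=> _; lra.
  apply: le_integral_Rd => x; first by rewrite /patch; case: ifP => // _; rewrite lee_fin.
  rewrite /patch; case: ifPn => [/set_mem hx|_]; last first.
    case: ifPn => // /set_mem xN.
    by rewrite lee_fin; case: Dg => + _ _; apply.
  rewrite mem_set; last by move=> i; have := hx i; rewrite -[0]/(ord0 : 'I_1); lra.
  by rewrite lee_fin; apply: (dirichlet_diag_ge t0 Dg L0).
have J2 : (J < +oo)%E.
  apply: (@le_lt_trans _ _ (heat_diag d t * box_vol R d N)%:E); last exact: ltry.
  rewrite -integral_Rd_box_cst ?(ltW (heat_diag_gt0 d t0))//; apply: le_integral_Rd => x.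
    rewrite /patch; case: ifPn => // /set_mem xN.
    by rewrite lee_fin; case: Dg => + _ _; apply.
  rewrite /patch; case: ifPn => // /set_mem xN.
  by rewrite lee_fin; exact: (dirichlet_diag_le N0 t0 Dg).
have Jfin : J \is a fin_num by rewrite fin_numElt J2 (lt_le_trans _ J1) ?ltNyr.
have v0 := box_vol_gt0 R d N0.
rewrite [leLHS]mulrAC [leLHS]mulrC invfM -[leRHS]mulrA ler_pM2l ?invr_gt0//.
rewrite [leRHS]mulrC ler_pdivlMr// -mulrA /box_vol -exprMn.
have -> : (1 - L / N%:R) * (2 * N%:R) = 2 * (N%:R - L) by field; rewrite gt_eqF.
by rewrite -lee_fin fineK.
Qed.

Lemma q_bc_ge0 N k : 0 <= q_bc bc gDir N beta 0 k.
Proof.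
have := q_dir_bounds (N := N) (k := k).
case: (bc) => h; rewrite ?(ltW (q_free_gt0 _ _ _ _))//.
- have [kN|kN] := leqP k.+1 N; last by rewrite /= /q_kernel leqNgt kN.
  by have /andP[+ _] := q_per_bounds kN; apply: le_trans; rewrite ltW// q_free_gt0.
- have [kN|kN] := leqP k.+1 N; last by rewrite /= /q_kernel leqNgt kN.
  by have /andP[] := h erefl kN.
Qed.

Let G_cvg : G N @[N --> \oo] --> (1 : R).
Proof.
have rc : expR (- (N%:R / beta)) @[N --> \oo] --> (0 : R).
  have -> : (fun N : nat => expR (- (N%:R / beta))) = (fun N => expR (- beta^-1) ^+ N).
    by apply/funext => N; rewrite -expRM_natr mulNr mulrC.
  by apply: cvg_expr; rewrite ger0_norm ?expR_ge0// expR_lt1 oppr_lt0 invr_gt0.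
suff : (1 + expR (- (N%:R / beta))) / (1 - expR (- (N%:R / beta))) @[N --> \oo] --> (1 : R).
  by move/(@cvg_exprn _ _ _ d); rewrite expr1n.
have := cvgM (cvgD (cvg_cst (1 : R)) rc) (cvgV _ (cvgB (cvg_cst (1 : R)) rc)).
by rewrite addr0 subr0 divr1; apply; exact: oner_neq0.
Qed.

Lemma q_bc_le_near (e : R) : 0 < e ->
  \forall N \near \oo, forall k, q_bc bc gDir N beta 0 k <= (1 + e) * q0 k.
Proof.
move=> e0.
have qe k : q0 k <= (1 + e) * q0 k by rewrite ler_peMl ?lerDl ?ltW// q_free_gt0.
have qe0 k : 0 <= (1 + e) * q0 k by apply: le_trans (qe k); rewrite ltW// q_free_gt0.
have hd := q_dir_bounds.
move: hd; case: bc => hd.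
- by apply: nearW => N k; exact: qe.
- near=> N; move=> k.
  have [kN|kN] := leqP k.+1 N; last by rewrite /= /q_kernel leqNgt kN.
  have /andP[_ /le_trans] := q_per_bounds kN; apply.
  rewrite mulrC ler_pM2r ?q_free_gt0//; near: N.
  move/cvgrPdist_le : G_cvg => /(_ e e0); apply: filterS => N.
  by rewrite ler_norml => /andP[+ _]; rewrite lerNl opprB lerBlDl.
- apply: nearW => N k.
  have [kN|kN] := leqP k.+1 N; last by rewrite /= /q_kernel leqNgt kN.
  by have /andP[_ /le_trans] := hd N k erefl kN; apply.
Unshelve. all: by end_near. Qed.

Lemma q_bc_cvg k : q_bc bc gDir N beta 0 k @[N --> \oo] --> q0 k.
Proof.
have hd1 := q_dir_bounds; have hd2 := q_dir_ge.
move: hd1 hd2; case: bc => hd1 hd2.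
- exact: cvg_cst.
- apply: (@squeeze_cvgr _ _ _ _ (fun=> q0 k) (fun N => q0 k * G N)).
  + by near=> N; apply: q_per_bounds; near: N; exists k.+1.
  + exact: cvg_cst.
  + by rewrite -[X in _ --> X](mulr1 (q0 k)); apply: cvgM => //; exact: cvg_cst.
pose t := k.+1%:R * beta.
have t0 : 0 < t by rewrite mulr_gt0.
have p0 := heat_diag_gt0 d t0.
have k0 : 0 < k.+1%:R :> R by rewrite ltr0n.
apply/cvgrPdist_le => e e0.
have [L L0 hL] : exists2 L : R, 0 < L &
    heat_tail d t (L / 2) <= Num.min (heat_diag d t) (e / 2 * k.+1%:R).
  set m := Num.min _ _.
  have m0 : 0 < m by rewrite lt_min p0 mulr_gt0// divr_gt0.
  set C := d`!%:R * (4 * t) `^ (d%:R / 2).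
  have C0 : 0 <= C by rewrite mulr_ge0 ?powR_ge0.
  (* for [1 <= L / 2] and [0 < d] the power of [L / 2] is at least [L / 2] *)
  exists (2 * (1 + C / m)); first by rewrite mulr_gt0// ltr_wpDr// divr_ge0// ltW.
  have -> : 2 * (1 + C / m) / 2 = 1 + C / m by field; rewrite gt_eqF.
  have u1 : 1 <= 1 + C / m by rewrite lerDl divr_ge0// ltW.
  rewrite /heat_tail -/C ler_pdivrMr ?exprn_gt0 ?(lt_le_trans ltr01)//.
  apply: (@le_trans _ _ (m * (1 + C / m))); last first.
    by rewrite ler_pM2l// -[leLHS]expr1 ler_weXn2l// muln_gt0.
  by rewrite mulrDr mulr1 mulrCA divff ?gt_eqF// mulr1 lerDr ltW.
move: hL; rewrite le_min => /andP[hL1 hL2].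
pose c := (heat_diag d t - heat_tail d t (L / 2)) / k.+1%:R.
have cc : c * (1 - L / N%:R) ^+ d @[N --> \oo] --> c.
  have h : 1 - L / N%:R @[N --> \oo] --> (1 : R).
    rewrite -[X in _ --> X](subr0 1); apply: cvgB; first exact: cvg_cst.
    rewrite -[X in _ --> X](mulr0 L); apply: cvgM; first exact: cvg_cst.
    exact: cvg_invn.
  have := cvgM (cvg_cst c) (@cvg_exprn _ _ _ d h).
  by rewrite expr1n mulr1; apply.
move/cvgrPdist_le : cc => /(_ (e / 2)); rewrite divr_gt0// => /(_ isT) cc.
near=> N.
have kN : (k.+1 <= N)%N by near: N; exists k.+1.
have LN : 0 < L < N%:R by rewrite L0; near: N; exact: nbhs_infty_gtr.
have /andP[h1 h2] := hd1 N k erefl kN.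
have h3 := hd2 N k L erefl kN LN hL1.
have h4 : `|c - c * (1 - L / N%:R) ^+ d| <= e / 2 by near: N.
rewrite ger0_norm ?subr_ge0//.
have h5 : q0 k - c <= e / 2.
  by rewrite q_free0E -/t /c -mulrBl opprB addrC subrK ler_pdivrMr.
move: h4; rewrite ler_norml -/t -/c in h3 *.
lra.
Unshelve. all: by end_near. Qed.

End WeightLimits.

(** * Lower bounds from a single configuration *)

Section RealLemmas.
Variable R : realType.
Implicit Types (u v : nat -> R).

Lemma cvg_sum_nat (K : nat) (f : nat -> nat -> R) (g : nat -> R) :
  (forall k, (k < K)%N -> f k N @[N --> \oo] --> g k) ->
  \sum_(0 <= k < K) f k N @[N --> \oo] --> \sum_(0 <= k < K) g k.
Proof.
elim: K => [|K IHK] h.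
  by under eq_cvg do rewrite big_geq//; rewrite big_geq//; exact: cvg_cst.
under eq_cvg do rewrite big_nat_recr//=.
rewrite big_nat_recr//=; apply: cvgD; last exact: h.
by apply: IHK => k kK; apply: h; rewrite ltnS ltnW.
Qed.

Lemma near_all_nat (K : nat) (Q : nat -> nat -> Prop) :
  (forall k, (k < K)%N -> \forall N \near \oo, Q k N) ->
  \forall N \near \oo, forall k, (k < K)%N -> Q k N.
Proof.
elim: K => [|K IHK] h; first by apply: nearW.
have h1 := IHK (fun k kK => h k (leqW kK)); have h2 := h K (ltnSn _).
near=> N; move=> k; rewrite ltnS leq_eqVlt => /predU1P[->|]; first by near: N.
by move: k; near: N.
Unshelve. all: by end_near. Qed.

(** One half of Stirling's formula, by induction from ln (1 - 1/n) <= - 1/n. The excess 1 + ln n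
    disappears after division by the volume. *)
Lemma ln_fact_le (n : nat) : (0 < n)%N ->
  ln (n`!%:R : R) <= n%:R * ln n%:R - n%:R + 1 + ln n%:R.
Proof.
case: n => // n _; elim: n => [|n IHn]; first by rewrite (_ : 1`! = 1)%N// ln1; lra.
rewrite factS natrM lnM ?posrE ?ltr0n ?fact_gt0//.
have n1 : 0 < n.+1%:R :> R by rewrite ltr0n.
have n2 : 0 < n.+2%:R :> R by rewrite ltr0n.
have e : n.+2%:R = n.+1%:R + 1 :> R by rewrite natr1.
have h : n.+2%:R * (ln n.+1%:R - ln n.+2%:R) <= -1 :> R.
  rewrite -ln_div ?posrE//.
  have -> : n.+1%:R / n.+2%:R = 1 + - n.+2%:R^-1 :> R.
    have -> : n.+1%:R = n.+2%:R - 1 :> R by rewrite e addrK.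
    by rewrite mulrBl mul1r divff// gt_eqF.
  rewrite mulrC -ler_pdivlMr// mulN1r; apply: le_ln1Dx.
  by rewrite ltrN2 invf_lt1// ltr1n.
rewrite e in h IHn *; move: IHn h; set a := ln _; set b := ln _; set c := ln _.
by move=> h1 h2; nra.
Qed.

Lemma ln_le_sqrt (x : R) : 0 < x -> ln x <= 2 * Num.sqrt x.
Proof.
move=> x0; have s0 : 0 < Num.sqrt x by rewrite sqrtr_gt0.
rewrite -{1}(sqr_sqrtr (ltW x0)) lnXn// mulr2n.
by have := ln_sublinear s0; lra.
Qed.

Variables (V : nat -> R).
Hypotheses (V_gt0 : \forall N \near \oo, 0 < V N)
  (V_inv : (V N)^-1 @[N --> \oo] --> (0 : R)).

Lemma cvg_truncn_div (x : R) : 0 <= x ->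
  (Num.truncn (V N * x))%:R / V N @[N --> \oo] --> x.
Proof.
move=> x0; apply: (@squeeze_cvgr _ _ _ _ (fun N => x - (V N)^-1) (fun=> x)).
- near=> N; have VN : 0 < V N by near: N.
  have /andP[h1 h2] : (Num.truncn (V N * x))%:R <= V N * x < (Num.truncn (V N * x)).+1%:R.
    by apply: truncn_itv; rewrite mulr_ge0// ltW.
  rewrite ler_pdivlMr// ler_pdivrMr// mulrBl mulVf ?gt_eqF// (mulrC x) h1 andbT.
  by rewrite lerBlDr natr1 ltW.
- by rewrite -[X in _ --> X](subr0 x); apply: cvgB => //; exact: cvg_cst.
- exact: cvg_cst.
Unshelve. all: by end_near. Qed.

Lemma atom_weight_near (x q c : R) (w : nat -> R) : 0 <= x -> 0 < q ->
  w N @[N --> \oo] --> q -> c < x * (1 - ln (x / q)) ->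
  \forall N \near \oo, let n := Num.truncn (V N * x) in
    c <= (n%:R * ln (V N * w N) - ln n`!%:R) / V N.
Proof.
rewrite le_eqVlt => /predU1P[<-|x0] q0 wq hc.
  near=> N => /=; rewrite mulr0 truncn0 fact0 ln1 mul0r subr0 mul0r.
  by move: hc; rewrite mul0r => /ltW.
pose y N : R := (Num.truncn (V N * x))%:R / V N.
have yx : y N @[N --> \oo] --> x by apply: cvg_truncn_div; exact: ltW.
(* Stirling's bound divided by the volume, written in the density y = n / V: the term 2 sqrt (y / V)
   is 2 sqrt n / V, which dominates ln n / V. This form has a limit by continuity alone. *)
pose M N := y N * (1 + ln (w N / y N)) - (V N)^-1 - 2 * Num.sqrt (y N * (V N)^-1).
have Mcvg : M N @[N --> \oo] --> x * (1 - ln (x / q)).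
  have -> : x * (1 - ln (x / q)) = x * (1 + ln (q / x)) - 0 - 2 * Num.sqrt (x * 0).
    rewrite mulr0 sqrtr0 mulr0 !subr0; congr (_ * (_ + _)).
    by rewrite -lnV ?posrE ?divr_gt0// invf_div.
  apply: cvgB; last first.
    apply: cvgM; first exact: cvg_cst.
    by apply: continuous_cvg; [exact: sqrt_continuous|exact: cvgM].
  apply: cvgB => //; apply: cvgM => //; apply: cvgD; first exact: cvg_cst.
  apply: continuous_cvg; first by apply: continuous_ln; rewrite divr_gt0.
  by apply: cvgM => //; apply: cvgV => //; rewrite gt_eqF.
have w0 : \forall N \near \oo, 0 < w N by apply: (cvgr_gt q).
have y0 : \forall N \near \oo, 0 < y N by apply: (cvgr_gt x).
have Mc : \forall N \near \oo, c < M N by apply: (cvgr_gt (x * (1 - ln (x / q)))).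
near=> N => /=; apply: (@le_trans _ _ (M N)); first by rewrite ltW//; near: N.
have VN : 0 < V N by near: N.
have wN : 0 < w N by near: N.
have yN : 0 < y N by near: N.
rewrite /M -/(y N); set n := Num.truncn _.
have yE : n%:R = y N * V N by rewrite /y divfK// gt_eqF.
have n0 : (0 < n)%N by rewrite -(ltr0n R) yE mulr_gt0.
have nR : 0 < n%:R :> R by rewrite ltr0n.
rewrite ler_pdivlMr//.
have h1 := ln_fact_le n0.
have h2 : ln n%:R <= 2 * Num.sqrt (y N * (V N)^-1) * V N.
  apply: le_trans (ln_le_sqrt nR) _; rewrite yE -mulrA ler_pM2l//.
  have -> : y N * V N = y N * (V N)^-1 * (V N) ^+ 2 by field; rewrite gt_eqF.
  by rewrite sqrtrM ?divr_ge0 ?(ltW yN) ?(ltW VN)// sqrtr_sqr (ger0_norm (ltW VN)).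
have h3 : ln (w N / y N) = ln (V N * w N) - ln n%:R.
  by rewrite -ln_div ?posrE ?mulr_gt0// yE; congr ln; field; rewrite !gt_eqF.
rewrite h3 !mulrBl mulrAC -yE mulVf ?gt_eqF//; lra.
Unshelve. all: by end_near. Qed.

End RealLemmas.

Lemma le_lne (R : realType) (x y : \bar R) : (0 <= x)%E -> (x <= y)%E -> (lne x <= lne y)%E.
Proof.
by move=> x0 xy; rewrite lee_lne// in_itv/= leey andbT// (le_trans x0).
Qed.

Section LowerBound.
Variables (R : realType) (beta : R) (V : nat -> R) (w : nat -> nat -> R) (q : nat -> R).
Hypotheses (beta0 : 0 < beta) (V_gt0 : \forall N \near \oo, 0 < V N)
  (V_inv : (V N)^-1 @[N --> \oo] --> (0 : R)) (q0 : forall k, 0 < q k)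
  (w0 : forall N k, 0 <= w N k) (wq : forall k, w N k @[N --> \oo] --> q k)
  (w_mass : forall N, mass (w N) \is a fin_num).
Variable X : forall N, cycle_counts (fun k => V N * w N k).

Let n (x : nat -> R) N k := Num.truncn (V N * x k).

(** The ideal factor exp(V qbar) cancels the probability exp(- S) of the empty configuration, which
    every atom carries. *)
Lemma partition_function_ge (H : (nat -> R) -> \bar R) (h : R) (x : nat -> R) K N :
  0 < V N -> (forall k, (K <= k)%N -> x k = 0) ->
  H (fun k => (n x N k)%:R / V N) = h%:E ->
  ((expR (- (V N * beta * h)) *
     \prod_(0 <= k < K) ((V N * w N k) ^+ n x N k / (n x N k)`!%:R))%:E <=
   expeR ((V N)%:E * mass (w N)) * partition_function (X N) (V N) beta H)%E.
Proof.
move=> VN xK hH.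
have m0 k : 0 <= V N * w N k by rewrite mulr_ge0// ltW.
pose E := [set u | forall k, cc_count (X N) k u = n x N k].
have mE : measurable E.
  rewrite (_ : E = \bigcap_k (cc_count (X N) k @^-1` [set n x N k])).
    by apply: bigcapT_measurable => k; exact: measurable_cc_preimage.
  by apply/seteqP; split=> u /= hu k; [move=> _; exact: hu|exact: hu].
set a := expR (- (V N * beta * h)).
have nK k : (K <= k)%N -> n x N k = 0%N by move=> /xK xk; rewrite /n xk mulr0 truncn0.
pose S := V N * fine (mass (w N)).
have hS M : \sum_(0 <= k < M) V N * w N k <= S.
  rewrite -mulr_sumr /S ler_pM2l// -lee_fin fineK// -sumEFin.
  by apply: nneseries_lim_ge => k _ _; rewrite lee_fin.
have PE := cc_configuration_ge (X N) m0 nK hS.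
have -> : ((V N)%:E * mass (w N) = S%:E)%E by rewrite EFinM fineK.
have hint : (a%:E * cc_prob (X N) E <= partition_function (X N) (V N) beta H)%E.
  rewrite -[X in (_ * cc_prob _ X)%E]setIT -integral_indic//.
  rewrite -ge0_integralZl_EFin ?expR_ge0//; last first.
    by apply/measurable_EFinP; exact: measurable_indic.
  apply: ge0_le_integralT => u; first by rewrite mule_ge0// lee_fin ?expR_ge0.
  rewrite indicE; have [uE|uE] := boolP (u \in E); last by rewrite mule0 expeR_ge0.
  rewrite mule1 (_ : (fun k => _) = (fun k => (n x N k)%:R / V N)); last first.
    by apply/funext => k; rewrite (set_mem uE k).
  by rewrite hH -EFinM -EFinN.
apply: le_trans (lee_wpmul2l _ hint); last exact: expeR_ge0.
apply: (@le_trans _ _ (expeR S%:E * (a%:E * (\prod_(0 <= k < K)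
   ((V N * w N k) ^+ n x N k / (n x N k)`!%:R) * expR (- S))%:E))%E).
  rewrite /= -!EFinM lee_fin [leRHS]mulrCA ler_pM2l ?expR_gt0// mulrCA -expRD addrN.
  by rewrite expR0 mulr1.
apply: lee_wpmul2l; first exact: expeR_ge0.
by apply: lee_wpmul2l; first by rewrite lee_fin expR_ge0.
Qed.

Lemma pressure_ge (H : (nat -> R) -> \bar R) (hN : nat -> R) (h c : R)
    (x : nat -> R) K :
  (forall k, 0 <= x k) -> (forall k, (K <= k)%N -> x k = 0) ->
  (\forall N \near \oo, H (fun k => (n x N k)%:R / V N) = (hN N)%:E) ->
  hN N @[N --> \oo] --> h ->
  c < beta^-1 * \sum_(0 <= k < K) x k * (1 - ln (x k / q k)) - h ->
  \forall N \near \oo, (c%:E <= (beta * V N)^-1%:E *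
    lne (expeR ((V N)%:E * mass (w N)) * partition_function (X N) (V N) beta H))%E.
Proof.
move=> x0 xK hH hh; set S := \sum_(0 <= k < K) _ => hc.
pose g := beta^-1 * S - h - c; have g0 : 0 < g by rewrite subr_gt0.
(* The margin [g] is halved: one half covers the error of the energy, the other the [K] errors [e]
   of the atoms. Using K + 1 keeps the quotient meaningful for K = 0. *)
pose e := beta * g / (2 * K.+1%:R).
have e0 : 0 < e by rewrite divr_gt0// mulr_gt0.
have atoms : \forall N \near \oo, forall k, (k < K)%N ->
    x k * (1 - ln (x k / q k)) - e <=
    ((n x N k)%:R * ln (V N * w N k) - ln (n x N k)`!%:R) / V N.
  apply: near_all_nat => k kK.
  have hk : x k * (1 - ln (x k / q k)) - e < x k * (1 - ln (x k / q k)).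
    by rewrite ltrBlDr ltrDl.
  exact: (atom_weight_near V_gt0 V_inv (x0 k) (q0 k) (@wq k) hk).
have wpos : \forall N \near \oo, forall k, (k < K)%N -> 0 < w N k.
  by apply: near_all_nat => k _; apply: (cvgr_gt (q k)) => //; exact: wq.
have hle : \forall N \near \oo, hN N < h + g / 2.
  by apply: (cvgr_lt h) => //; rewrite ltrDl divr_gt0.
near=> N.
have VN : 0 < V N by near: N.
have HN : H (fun k => (n x N k)%:R / V N) = (hN N)%:E by near: N.
have := partition_function_ge VN xK HN.
set A := expR _ * _; set Z := (expeR _ * _)%E => AZ.
have wN k : (k < K)%N -> 0 < w N k by move: k; near: N.
have atN k : (k < K)%N -> x k * (1 - ln (x k / q k)) - e <=
    ((n x N k)%:R * ln (V N * w N k) - ln (n x N k)`!%:R) / V N by move: k; near: N.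
have hN2 : hN N < h + g / 2 by near: N.
have prod_pos k : (k < K)%N -> 0 < (V N * w N k) ^+ n x N k / (n x N k)`!%:R.
  by move=> kK; rewrite divr_gt0 ?ltr0n ?fact_gt0// exprn_gt0// mulr_gt0// wN.
have lnA : ln A = - (V N * beta * hN N) +
    \sum_(0 <= k < K) ((n x N k)%:R * ln (V N * w N k) - ln (n x N k)`!%:R).
  have P0 : 0 < \prod_(0 <= k < K) ((V N * w N k) ^+ n x N k / (n x N k)`!%:R).
    by rewrite big_nat; apply: prodr_gt0 => k /andP[_ kK]; exact: prod_pos.
  rewrite /A lnM ?posrE ?expR_gt0// expRK; congr (_ + _).
  move: prod_pos wN; elim: (K) => [|K' IH] pp wp; first by rewrite !big_geq// ln1.
  rewrite !big_nat_recr//= lnM ?posrE; last 2 first.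
  - by rewrite big_nat; apply: prodr_gt0 => k /andP[_ kK]; apply: pp; rewrite ltnS ltnW.
  - exact: pp.
  rewrite IH; last 2 first.
  - by move=> k kK; apply: pp; rewrite ltnS ltnW.
  - by move=> k kK; apply: wp; rewrite ltnS ltnW.
  have wK := wp K' (ltnSn _).
  rewrite ln_div ?posrE ?ltr0n ?fact_gt0// ?exprn_gt0 ?mulr_gt0//.
  by rewrite lnXn ?mulr_gt0// mulr_natl.
have A0 : 0 < A.
  by rewrite mulr_gt0 ?expR_gt0// big_nat; apply: prodr_gt0 => k /andP[_]; exact: prod_pos.
apply: (@le_trans _ _ ((beta * V N)^-1%:E * lne A%:E)%E); last first.
  apply: lee_wpmul2l; first by rewrite lee_fin invr_ge0 mulr_ge0// ltW.
  by apply: le_lne => //; rewrite lee_fin ltW.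
rewrite lne_EFin// -EFinM lee_fin lnA.
rewrite mulrDr.
have -> : (beta * V N)^-1 * - (V N * beta * hN N) = - hN N.
  by field; rewrite !gt_eqF.
rewrite invfM -mulrA [X in beta^-1 * X]mulr_sumr.
have hsum : S - beta * g / 2 <= \sum_(0 <= k < K)
    (V N)^-1 * ((n x N k)%:R * ln (V N * w N k) - ln (n x N k)`!%:R).
  apply: (@le_trans _ _ (\sum_(0 <= k < K) (x k * (1 - ln (x k / q k)) - e))).
    have Ke : K%:R * e <= beta * g / 2.
      have -> : beta * g / 2 = K.+1%:R * e by rewrite /e; field; rewrite nat1r pnatr_eq0.
      by rewrite ler_pM2r// ler_nat.
    by rewrite sumrB lerD2l lerN2 sumr_const_nat subn0 -[_ *+ _]mulr_natl.
  by rewrite !big_nat; apply: ler_sum => k /andP[_ kK]; rewrite [leRHS]mulrC; exact: atN.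
have : beta^-1 * (S - beta * g / 2) <= beta^-1 * \sum_(0 <= k < K)
    (V N)^-1 * ((n x N k)%:R * ln (V N * w N k) - ln (n x N k)`!%:R).
  by rewrite ler_pM2l// invr_gt0.
have -> : beta^-1 * (S - beta * g / 2) = beta^-1 * S - g / 2 by field; rewrite gt_eqF.
by move: hN2; rewrite /g; lra.
Unshelve. all: by end_near. Qed.

End LowerBound.

(** * Convergence of the free series *)

Section Series.
Variable R : realType.
Implicit Types (f : nat -> R).

Lemma eseries_finsupp f (K : nat) : (forall k, (K <= k)%N -> f k = 0) ->
  (\sum_(0 <= k <oo) (f k)%:E = (\sum_(0 <= k < K) f k)%:E)%E.
Proof.
move=> fK; apply/cvg_lim => //; apply: cvg_near_cst; exists K => // n /= Kn.
rewrite sumEFin (@big_cat_nat _ _ _ K)//= [X in _ + X]big_nat [X in _ + X]big1 ?addr0//.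
by move=> k /andP[/fK].
Qed.

Lemma nneseries_partial_le f (S : R) : (forall k, 0 <= f k) ->
  (forall n, \sum_(0 <= k < n) f k <= S) ->
  (\sum_(0 <= k <oo) (f k)%:E <= S%:E)%E.
Proof.
move=> f0 fS; apply: lime_le.
  by apply: is_cvg_nneseries => k _ _; rewrite lee_fin.
by apply: nearW => n; rewrite sumEFin lee_fin.
Qed.

Lemma nneseries_partial_ge f n : (forall k, 0 <= f k) ->
  ((\sum_(0 <= k < n) f k)%:E <= \sum_(0 <= k <oo) (f k)%:E)%E.
Proof.
by move=> f0; rewrite -sumEFin; apply: nneseries_lim_ge => k _ _; rewrite lee_fin.
Qed.

Lemma nneseries_cvg f : (forall k, 0 <= f k) ->
  (\sum_(0 <= k < n) f k)%:E @[n --> \oo] --> (\sum_(0 <= k <oo) (f k)%:E)%E.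
Proof.
move=> f0; under eq_cvg do rewrite -sumEFin.
by apply: is_cvg_nneseries => k _ _; rewrite lee_fin.
Qed.

Lemma nneseries_partial_gt f (c : R) : (forall k, 0 <= f k) ->
  (c%:E < \sum_(0 <= k <oo) (f k)%:E)%E -> \forall n \near \oo, c < \sum_(0 <= k < n) f k.
Proof.
move=> f0 hc; have [n0 hn0] : exists n, c < \sum_(0 <= k < n) f k.
  apply: contrapT => /forallNP h; move: hc; apply/negP; rewrite -leNgt.
  by apply: nneseries_partial_le => // n; rewrite leNgt; apply/negP; exact: h.
exists n0 => // n /= n0n; apply: lt_le_trans hn0 _.
by rewrite [leRHS](@big_cat_nat _ _ _ n0)//= lerDl sumr_ge0.
Qed.

(** Integral comparison for the power -3/2 by telescoping: with s and t the roots of consecutive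
    integers, (t - s)(t + s) = 1 gives 1 / t^3 <= 2 / s - 2 / t. The power 3/2 is 1 + d/2 for d = 1,
    the slowest decay that occurs. *)
Lemma inv_three_halves_sum_le (n : nat) :
  \sum_(0 <= k < n.+1) (k.+1%:R * Num.sqrt k.+1%:R)^-1 <= 3 - 2 / Num.sqrt n.+1%:R :> R.
Proof.
elim: n => [|n IHn]; first by rewrite big_nat1 sqrtr1 !mul1r; lra.
rewrite big_nat_recr//=; apply: le_trans (lerD IHn (lexx _)) _.
set s := Num.sqrt n.+1%:R; set t := Num.sqrt n.+2%:R.
have s0 : 0 < s by rewrite sqrtr_gt0.
have t0 : 0 < t by rewrite sqrtr_gt0.
have t2 : n.+2%:R = t ^+ 2 :> R by rewrite sqr_sqrtr.
have st : t ^+ 2 = s ^+ 2 + 1 by rewrite !sqr_sqrtr// natr1.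
have lst : s <= t by rewrite ler_sqrt// ler_nat.
rewrite t2.
have h : (t ^+ 2 * t)^-1 <= 2 / s - 2 / t.
  have -> : 2 / s - 2 / t = 2 * (t - s) / (s * t) by field; rewrite !gt_eqF.
  rewrite ler_pdivlMr ?mulr_gt0// mulrC ler_pdivrMr ?mulr_gt0 ?exprn_gt0//.
  have hts : (t - s) * (t + s) = 1 by rewrite -subr_sqr st addrC addKr.
  have hd : 0 <= t - s by rewrite subr_ge0.
  have h1 : 1 <= 2 * t * (t - s) by nra.
  have h2 : s * t <= t * t by rewrite ler_pM2r.
  have -> : 2 * (t - s) * (t ^+ 2 * t) = t * t * (2 * t * (t - s)) by ring.
  by apply: le_trans h2 _; rewrite ler_peMr// mulr_ge0 ?(ltW t0).
lra.
Qed.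

Lemma inv_powR_partial_le (p : R) n : 3 / 2 <= p ->
  \sum_(0 <= k < n) (k.+1%:R `^ p)^-1 <= 3 :> R.
Proof.
move=> hp; apply: (@le_trans _ _ (\sum_(0 <= k < n) (k.+1%:R * Num.sqrt k.+1%:R)^-1)).
  apply: ler_sum => k _; rewrite lef_pV2 ?posrE ?powR_gt0 ?mulr_gt0 ?sqrtr_gt0//.
  rewrite -powR12_sqrt// -{1}(powRr1 (ler0n R k.+1)) -powRD ?pnatr_eq0 ?implybT//.
  by apply: ler_powR; [rewrite ler1n|lra].
case: n => [|n]; first by rewrite big_geq.
apply: le_trans (inv_three_halves_sum_le n) _.
by rewrite gerBl divr_ge0// sqrtr_ge0.
Qed.

Lemma dvg_inv_powR (p : R) : p <= 1 ->
  (\sum_(0 <= k <oo) ((k.+1%:R `^ p)^-1)%:E = +oo :> \bar R)%E.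
Proof.
move=> hp; apply/eqP; rewrite -leye_eq.
have <- : (\sum_(0 <= k <oo) (harmonic k)%:E = +oo :> \bar R)%E.
  have h0 k : 0 <= harmonic k :> R by rewrite invr_ge0.
  have := nneseries_cvg h0; case E : (\sum_(0 <= k <oo) _)%E => [r| |] //; last first.
    by have := @nneseries_partial_ge _ 0%N h0; rewrite E big_geq.
  move=> /fine_cvgP[_ hr]; exfalso; apply: (@dvg_harmonic R).
  by apply/cvg_ex; exists r.
apply: lee_nneseries => k _; first by rewrite lee_fin invr_ge0.
rewrite lee_fin lef_pV2 ?posrE ?powR_gt0//.
by rewrite -[leRHS](powRr1 (ler0n R k.+1)) ler_powR// ler1n.
Qed.

End Series.

Section FreeSeries.
Variables (R : realType) (d : nat) (beta : R).
Hypotheses (d0 : (0 < d)%N) (beta0 : 0 < beta).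

Let C := (4 * pi * beta) `^ (d%:R / 2) : R.

Let C0 : 0 < C. Proof. by rewrite powR_gt0// !mulr_gt0// pi_gt0. Qed.

Lemma q_free_mass_partial n : \sum_(0 <= k < n) q_free d beta 0 k <= 3 / C.
Proof.
apply: (@le_trans _ _ (\sum_(0 <= k < n) (k.+1%:R `^ (1 + d%:R / 2))^-1 / C)).
  by apply: ler_sum => k _; rewrite /q_free mulr0 mul0r expR0 div1r invfM mulrC.
rewrite -mulr_suml ler_pM2r ?invr_gt0//; apply: inv_powR_partial_le.
have : 1 <= d%:R :> R by rewrite ler1n.
lra.
Qed.

Lemma q_free_le mu k : mu <= 0 -> q_free d beta mu k <= q_free d beta 0 k.
Proof.
move=> mu0; rewrite !q_freeE// ler_pM2r ?divr_gt0 ?heat_diag_gt0 ?mulr_gt0//.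
rewrite ler_expR mulr0 mul0r mulr_le0_ge0//.
by rewrite mulr_ge0_le0// ltW.
Qed.

Lemma mass_q_free_fin mu : mu <= 0 -> mass (q_free d beta mu) \is a fin_num.
Proof.
move=> mu0; rewrite ge0_fin_numE; last first.
  by apply: nneseries_ge0 => k _ _; rewrite lee_fin ltW// q_free_gt0.
apply: (@le_lt_trans _ _ (3 / C)%:E); last exact: ltry.
apply: nneseries_partial_le => [k|n]; first by rewrite ltW// q_free_gt0.
by apply: le_trans (q_free_mass_partial n); apply: ler_sum => k _; exact: q_free_le.
Qed.

Lemma ideal_pressureE mu : ideal_pressure d beta mu =
  (beta^-1%:E * mass (q_free d beta mu))%E.
Proof.
rewrite /ideal_pressure invfM EFinM -muleA; congr (_ * _)%E.
rewrite -nneseriesZl; last by move=> k _; rewrite lee_fin divr_ge0 ?expR_ge0 ?powR_ge0.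
by apply: eq_eseriesr => k _; rewrite -EFinM /q_free invfM; congr EFin; ring.
Qed.

(** The factor k lowers the exponent from 1 + d/2 to d/2, and for d <= 2 the resulting series
    diverges, in agreement with the prescribed value +oo. *)
Lemma rho_cE : rho_c d beta = dens (q_free d beta 0).
Proof.
have -> : dens (q_free d beta 0) = ((C^-1)%:E * zeta (d%:R / 2))%E.
  rewrite /zeta -nneseriesZl; last by move=> k _; rewrite lee_fin invr_ge0 powR_ge0.
  apply: eq_eseriesr => k _; rewrite -EFinM /q_free mulr0 mul0r expR0; congr EFin.
  rewrite powRD ?pnatr_eq0 ?implybT// powRr1// -/C.
  have h : k.+1%:R `^ (d%:R / 2) != 0 :> R by rewrite gt_eqF// powR_gt0.
  by field; rewrite h nat1r pnatr_eq0 gt_eqF.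
rewrite /rho_c; case: ifPn => [_|]; first by rewrite powRN.
rewrite -leqNgt => d2; rewrite /zeta dvg_inv_powR ?gt0_muley// ?lte_fin ?invr_gt0//.
have : d%:R <= 2 :> R by rewrite ler_nat.
lra.
Qed.

End FreeSeries.

Section FiniteSupport.
Variable R : realType.
Implicit Types (x q : nat -> R).

(** The exponential growth rate, per unit volume, of a product of terms (V q)^n / n! with n close to
    V x. Its sign is opposite to that of the rate function, from which it also differs by the mass
    of [q]. *)
Definition entropy_upto q K x := \sum_(0 <= k < K) x k * (1 - ln (x k / q k)).
Definition mass_upto K x := \sum_(0 <= k < K) x k.
Definition dens_upto K x := \sum_(0 <= k < K) k.+1%:R * x k.
Definition sq_upto K x := \sum_(0 <= k < K) k.+1%:R ^+ 2 * x k ^+ 2.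

Lemma mass_finsupp K x : (forall k, (K <= k)%N -> x k = 0) -> mass x = (mass_upto K x)%:E.
Proof. by move=> xK; exact: eseries_finsupp. Qed.

Lemma dens_finsupp K x : (forall k, (K <= k)%N -> x k = 0) -> dens x = (dens_upto K x)%:E.
Proof. by move=> xK; apply: eseries_finsupp => k /xK ->; rewrite mulr0. Qed.

Lemma H_hyl_finsupp mu a b K x : (forall k, (K <= k)%N -> x k = 0) ->
  H_hyl mu a b x =
  (- mu * dens_upto K x + a / 2 * dens_upto K x ^+ 2 - b / 2 * sq_upto K x)%:E.
Proof.
move=> xK; rewrite /H_hyl (dens_finsupp xK) (@eseries_finsupp _ _ K)// => k /xK ->.
by rewrite expr0n mulr0.
Qed.

(** PMF is the case b = 0 of HYL, so the lower bounds of HYL serve for it, condensate included. *)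
Lemma H_pmfE mu a x : H_pmf mu a x = H_hyl mu a 0 x.
Proof. by rewrite /H_pmf /H_hyl; case: dens => // r; rewrite !mul0r subr0. Qed.

End FiniteSupport.

(** * Lower bounds for the CMF and HYL pressures, and the condensate *)

Section Thermodynamics.
Variables (R : realType) (d : nat) (beta : R).
Hypotheses (d0 : (0 < d)%N) (beta0 : 0 < beta).
Variables (bc : boundary) (gDir : nat -> R -> 'rV[R]_d -> 'rV[R]_d -> R).
Hypothesis hDir : bc = Dir -> forall (N : nat) (t : R), (0 < N)%N -> 0 < t ->
  dirichlet_density N t (gDir N t).

Local Notation V := (box_vol R d).
Local Notation q := (fun N mu => q_bc bc gDir N beta mu).
Local Notation q0 := (q_free d beta 0).

Lemma box_vol_gt0_near : \forall N \near \oo, 0 < V N.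
Proof. by exists 1%N => // N /= N0; exact: box_vol_gt0. Qed.

Lemma box_vol_inv_cvg : (V N)^-1 @[N --> \oo] --> (0 : R).
Proof.
rewrite (_ : (fun N => _) = (fun N => (2^-1 * N%:R^-1) ^+ d)); last first.
  by apply/funext => N; rewrite /box_vol -exprVn invfM.
have h : 2^-1 * N%:R^-1 @[N --> \oo] --> (0 : R).
  by rewrite -[X in _ --> X](mulr0 2^-1); apply: cvgM; [exact: cvg_cst|exact: cvg_invn].
by have := @cvg_exprn _ _ _ d h; rewrite expr0n gtn_eqF.
Qed.

Lemma q_bc_mu_ge0 N mu k : 0 <= q N mu k.
Proof. by rewrite /= q_bc_mu mulr_ge0 ?expR_ge0// q_bc_ge0. Qed.

Lemma q_bc_mu_cvg mu k : q N mu k @[N --> \oo] --> q_free d beta mu k.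
Proof.
under eq_cvg do rewrite /= q_bc_mu.
have -> : q_free d beta mu k = expR (beta * mu * k.+1%:R) * q0 k.
  by rewrite !q_freeE// mulr0 mul0r expR0 mul1r.
by apply: cvgM; [exact: cvg_cst|exact: q_bc_cvg].
Qed.

Lemma mass_q_bc_fin N mu : mu <= 0 -> mass (q N mu) \is a fin_num.
Proof.
move=> mu0; case: bc => /=; first exact: mass_q_free_fin.
- rewrite (@mass_finsupp _ N)// => k Nk.
  by rewrite /q_kernel ltnNge Nk.
- rewrite (@mass_finsupp _ N)// => k Nk.
  by rewrite /q_kernel ltnNge Nk.
Qed.

(** Changing the reference weights adds a term linear in the density; this is how [alpha] joins [mu]
    in the limits. *)
Lemma entropy_upto_mu mu K x : (forall k, 0 <= x k) ->
  entropy_upto (q_free d beta mu) K x = entropy_upto q0 K x + beta * mu * dens_upto K x.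
Proof.
move=> x0; rewrite /dens_upto mulr_sumr -big_split /=; apply: eq_bigr => k _.
have [->|xk] := eqVneq (x k) 0; first by rewrite !(mul0r, mulr0) addr0.
have xk0 : 0 < x k by rewrite lt_neqAle eq_sym xk x0.
rewrite (q_freeE _ beta0 mu) (q_freeE _ beta0 0) mulr0 mul0r expR0 mul1r.
set r := heat_diag _ _ / _; have r0 : 0 < r.
  by rewrite divr_gt0// heat_diag_gt0// mulr_gt0.
have -> : x k / (expR (beta * mu * k.+1%:R) * r) = x k / r / expR (beta * mu * k.+1%:R).
  by rewrite invfM mulrA mulrAC.
have -> : ln (x k / r / expR (beta * mu * k.+1%:R)) = ln (x k / r) - beta * mu * k.+1%:R.
  have xr0 : x k / r \in Num.pos by rewrite posrE divr_gt0.
  by rewrite [LHS](ln_div xr0) ?posrE ?expR_gt0// expRK.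
ring.
Qed.

Section Gas.
Variables (alpha : R).
Hypothesis alpha0 : alpha <= 0.
Variable X : forall N, cycle_counts (fun k => V N * q N alpha k).

Definition bc_pressure (H : (nat -> R) -> \bar R) N : \bar R :=
  ((beta * V N)^-1%:E *
   lne (expeR ((V N)%:E * mass (q N alpha)) * partition_function (X N) (V N) beta H))%E.

Let floor_cvg (x : nat -> R) k : (forall k, 0 <= x k) ->
  (Num.truncn (V N * x k))%:R / V N @[N --> \oo] --> x k.
Proof.
by move=> x0; apply: cvg_truncn_div => //; [exact: box_vol_gt0_near|exact: box_vol_inv_cvg].
Qed.

Lemma hyl_pressure_ge mu a b (c : R) x K :
  (forall k, 0 <= x k) -> (forall k, (K <= k)%N -> x k = 0) ->
  c < beta^-1 * entropy_upto q0 K x + (mu + alpha) * dens_upto K x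
      - a / 2 * dens_upto K x ^+ 2 + b / 2 * sq_upto K x ->
  \forall N \near \oo, (c%:E <= bc_pressure (H_hyl mu a b) N)%E.
Proof.
move=> x0 xK hc.
pose y N k : R := (Num.truncn (V N * x k))%:R / V N.
have yK N k : (K <= k)%N -> y N k = 0 by move=> /xK xk; rewrite /y xk mulr0 truncn0 mul0r.
have Dy : dens_upto K (y N) @[N --> \oo] --> dens_upto K x.
  by apply: cvg_sum_nat => k _; apply: cvgM; [exact: cvg_cst|exact: floor_cvg].
have Qy : sq_upto K (y N) @[N --> \oo] --> sq_upto K x.
  apply: cvg_sum_nat => k _; apply: cvgM; first exact: cvg_cst.
  by apply: cvg_exprn; exact: floor_cvg.
apply: (@pressure_ge _ beta V (fun N => q N alpha) (q_free d beta alpha) beta0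
  box_vol_gt0_near box_vol_inv_cvg _ _ _ _ X _
  (fun N => - mu * dens_upto K (y N) + a / 2 * dens_upto K (y N) ^+ 2 -
            b / 2 * sq_upto K (y N))
  (- mu * dens_upto K x + a / 2 * dens_upto K x ^+ 2 - b / 2 * sq_upto K x)
  c x K) => //.
- by move=> k; exact: q_free_gt0.
- by move=> N k; exact: q_bc_mu_ge0.
- by move=> k; exact: q_bc_mu_cvg.
- by move=> N; exact: mass_q_bc_fin.
- by apply: nearW => N; apply: (@H_hyl_finsupp _ mu a b K (y N)); exact: yK.
- apply: cvgB; last by apply: cvgM => //; exact: cvg_cst.
  apply: cvgD; first by apply: cvgM => //; exact: cvg_cst.
  by apply: cvgM; [exact: cvg_cst|exact: cvg_exprn].
- rewrite -/(entropy_upto (q_free d beta alpha) K x) entropy_upto_mu// mulrDr.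
  by rewrite !mulrA mulVf ?gt_eqF// mul1r; lra.
Qed.

Lemma cmf_pressure_ge a (c : R) x K :
  (forall k, 0 <= x k) -> (forall k, (K <= k)%N -> x k = 0) ->
  c < beta^-1 * entropy_upto (q_free d beta alpha) K x - a / 2 * mass_upto K x ^+ 2 ->
  \forall N \near \oo, (c%:E <= bc_pressure (H_cmf a) N)%E.
Proof.
move=> x0 xK hc.
pose y N k : R := (Num.truncn (V N * x k))%:R / V N.
have yK N k : (K <= k)%N -> y N k = 0 by move=> /xK xk; rewrite /y xk mulr0 truncn0 mul0r.
have My : mass_upto K (y N) @[N --> \oo] --> mass_upto K x.
  by apply: cvg_sum_nat => k _; exact: floor_cvg.
apply: (@pressure_ge _ beta V (fun N => q N alpha) (q_free d beta alpha) beta0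
  box_vol_gt0_near box_vol_inv_cvg _ _ _ _ X _
  (fun N => a / 2 * mass_upto K (y N) ^+ 2) (a / 2 * mass_upto K x ^+ 2) c x K) => //.
- by move=> k; exact: q_free_gt0.
- by move=> N k; exact: q_bc_mu_ge0.
- by move=> k; exact: q_bc_mu_cvg.
- by move=> N; exact: mass_q_bc_fin.
- apply: nearW => N; rewrite /H_cmf (@mass_finsupp _ K (y N)); last exact: yK.
  by rewrite -EFin_expe -EFinM.
- by apply: cvgM; [exact: cvg_cst|exact: cvg_exprn].
Qed.

(** The weight decays only polynomially in the length, so the logarithm grows like ln L, which is at
    most 2 sqrt L, and the number density c / L of the cycles beats it. *)
Lemma condensate_cost (c e : R) : 0 < c -> 0 < e ->
  \forall L \near \oo, - e <= c / L.+1%:R * (1 - ln (c / L.+1%:R / q0 L)).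
Proof.
move=> c0 e0.
pose A := `|ln ((4 * pi * beta) `^ (d%:R / 2) : R)| + `|ln c|.
have h : c / L.+1%:R * (A + 2 * (1 + d%:R / 2) * Num.sqrt L.+1%:R) @[L --> \oo] --> (0 : R).
  have i1 : L.+1%:R^-1 @[L --> \oo] --> (0 : R) by exact: cvg_harmonic.
  have i2 : Num.sqrt L.+1%:R^-1 @[L --> \oo] --> (0 : R).
    by rewrite -[X in _ --> X]sqrtr0; apply: continuous_cvg; [exact: sqrt_continuous|exact: i1].
  have -> : (fun L => c / L.+1%:R * (A + 2 * (1 + d%:R / 2) * Num.sqrt L.+1%:R)) =
      (fun L => c * A * L.+1%:R^-1 + c * (2 * (1 + d%:R / 2)) * Num.sqrt L.+1%:R^-1).
    apply/funext => L.
    have s0 : 0 < Num.sqrt L.+1%:R :> R by rewrite sqrtr_gt0.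
    have sE : L.+1%:R = Num.sqrt L.+1%:R ^+ 2 :> R by rewrite sqr_sqrtr.
    rewrite sqrtrV// {1 3}sE; field; exact: lt0r_neq0.
  have := cvgD (cvgM (cvg_cst (c * A)) i1) (cvgM (cvg_cst (c * (2 * (1 + d%:R / 2)))) i2).
  by rewrite !mulr0 addr0; apply.
move/cvgr0Pnorm_le: h => /(_ e e0); apply: filterS => L hL.
have L0 : 0 < L.+1%:R :> R by rewrite ltr0n.
have C0 : 0 < (4 * pi * beta) `^ (d%:R / 2) :> R by rewrite powR_gt0// !mulr_gt0// pi_gt0.
have LP : 0 < L.+1%:R `^ (1 + d%:R / 2) :> R by rewrite powR_gt0.
have -> : c / L.+1%:R / q0 L =
    c / L.+1%:R * ((4 * pi * beta) `^ (d%:R / 2) * L.+1%:R `^ (1 + d%:R / 2)).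
  by rewrite /q_free mulr0 mul0r expR0 div1r invrK.
rewrite lnM ?posrE ?mulr_gt0 ?divr_gt0// ln_div ?posrE// lnM ?posrE//.
rewrite [ln (L.+1%:R `^ _)]ln_powR.
have hs : ln L.+1%:R <= 2 * Num.sqrt L.+1%:R :> R by exact: ln_le_sqrt.
have l0 : 0 <= ln L.+1%:R :> R by rewrite ln_ge0// ler1n.
apply: (@le_trans _ _ (- (c / L.+1%:R * (A + 2 * (1 + d%:R / 2) * Num.sqrt L.+1%:R)))).
  by rewrite lerN2; apply: le_trans hL; exact: ler_norm.
rewrite -mulrN ler_pM2l ?divr_gt0//.
have h1 := ler_norm (ln ((4 * pi * beta) `^ (d%:R / 2))).
have h2 := ler_norm (ln c).
have h3 : (1 + d%:R / 2) * ln L.+1%:R <= (1 + d%:R / 2) * (2 * Num.sqrt L.+1%:R) :> R.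
  by apply: ler_wpM2l => //; rewrite addr_ge0// divr_ge0.
rewrite /A; lra.
Qed.

(** Putting the extra density into a single length makes its contribution to the sum of k^2 x_k^2
    equal to c^2, the largest value a density c allows. The length is taken beyond [K], so the block
    does not overlap the support of [x]. *)
Lemma hyl_pressure_ge_condensate mu a b (v c : R) x K :
  (forall k, 0 <= x k) -> (forall k, (K <= k)%N -> x k = 0) -> 0 <= c ->
  v < beta^-1 * entropy_upto q0 K x + (mu + alpha) * (dens_upto K x + c)
      - a / 2 * (dens_upto K x + c) ^+ 2 + b / 2 * (sq_upto K x + c ^+ 2) ->
  \forall N \near \oo, (v%:E <= bc_pressure (H_hyl mu a b) N)%E.
Proof.
move=> x0 xK; rewrite le_eqVlt => /predU1P[<-|c0].
  by rewrite !addr0 expr0n addr0; exact: hyl_pressure_ge.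
set W := (X in v < X) => hv.
have e0 : 0 < beta * (W - v) by rewrite mulr_gt0// subr_gt0.
have [L0 _ hL] := condensate_cost c0 (divr_gt0 e0 (ltr0n R 2)).
pose L := maxn L0 K.
have LK : (K <= L)%N by exact: leq_maxr.
have {}hL := hL L (leq_maxl _ _).
pose x' k := if k == L then c / L.+1%:R else x k.
have x'0 k : 0 <= x' k by rewrite /x'; case: ifP => // _; rewrite divr_ge0// ltW.
have x'K k : (L < k)%N -> x' k = 0.
  by move=> Lk; rewrite /x' gtn_eqF//; apply: xK; exact: ltnW (leq_ltn_trans LK Lk).
have split_sum (F : nat -> R -> R) : (forall k, F k 0 = 0) ->
    \sum_(0 <= k < L.+1) F k (x' k) = \sum_(0 <= k < K) F k (x k) + F L (c / L.+1%:R).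
  move=> F0; rewrite big_nat_recr//= {2}/x' eqxx; congr (_ + _).
  rewrite (@big_cat_nat _ _ _ K)//= [X in _ + X]big_nat [X in _ + X]big1 ?addr0.
    rewrite !big_nat; apply: eq_bigr => k /andP[_ kK].
    by rewrite /x' ltn_eqF// (leq_trans kK LK).
  by move=> k /andP[Kk kL]; rewrite /x' ltn_eqF// xK// F0.
have Ln : L.+1%:R != 0 :> R by rewrite pnatr_eq0.
have eE : entropy_upto q0 L.+1 x' = entropy_upto q0 K x +
    c / L.+1%:R * (1 - ln (c / L.+1%:R / q0 L)).
  by apply: (split_sum (fun k r => r * (1 - ln (r / q0 k)))) => k; rewrite mul0r.
have dE : dens_upto L.+1 x' = dens_upto K x + c.
  rewrite -[in RHS](mulfVK Ln c) [in RHS]mulrC.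
  by apply: (split_sum (fun k r => k.+1%:R * r)) => k; rewrite mulr0.
have sE : sq_upto L.+1 x' = sq_upto K x + c ^+ 2.
  rewrite -[in RHS](mulfVK Ln c) [_ * L.+1%:R]mulrC exprMn.
  by apply: (split_sum (fun k r => k.+1%:R ^+ 2 * r ^+ 2)) => k; rewrite expr0n mulr0.
apply: (@hyl_pressure_ge mu a b v x' L.+1) => //.
rewrite eE dE sE mulrDr.
have : - ((W - v) / 2) <= beta^-1 * (c / L.+1%:R * (1 - ln (c / L.+1%:R / q0 L))).
  by rewrite -ler_pdivrMl ?invr_gt0// invrK mulrN mulrA.
set T := beta^-1 * (c / _ * _) => hT; move: hv hT; rewrite {1}/W.
set E' := beta^-1 * _ => hv hT.
have : v < W + T by move: (hv); rewrite -/W; lra.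
by rewrite /W -/E'; lra.
Qed.

End Gas.
End Thermodynamics.

(** * Upper bounds *)

Section ExponentialMoments.
Variables (R : realType) (m : nat -> R) (X : cycle_counts m).
Hypothesis m0 : forall k, 0 <= m k.
Local Notation N := (cc_count X).

(** Over finitely many coordinates the factors exp(- m k) multiply to slightly more than exp(- S).
    For large [M] the excess is at most a factor exp(e), and e then tends to 0. *)
Lemma exp_mass_integral_le_sum (I : finType) (F : cc_space X -> \bar R)
    (f : I -> nat -> nat -> R) (a : I -> nat -> R) (C A : I -> R) (S : R) :
  (forall w, 0 <= F w)%E -> (forall i k n, 0 <= f i k n) -> (forall i, 0 <= C i) ->
  (forall i k, 0 <= a i k) ->
  (forall i k, \sum_(0 <= n <oo) (f i k n * poisson_weight (m k) n)%:E =
    (a i k * expR (- m k))%:E)%E ->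
  (forall w, \forall M \near \oo,
    (F w <= (\sum_i C i * \prod_(0 <= k < M) f i k (N k w))%:E)%E) ->
  mass m = S%:E -> (\forall M \near \oo, forall i, \prod_(0 <= k < M) a i k <= A i) ->
  (expeR S%:E * \int[cc_prob X]_(w in [set: _]) F w <= (\sum_i C i * A i)%:E)%E.
Proof.
move=> F0 f0 C0 a0 he hF hS hA; set CA := \sum_i C i * A i.
have A0 i : 0 <= A i.
  have [M0 _ hM0] := hA; apply: le_trans (hM0 M0 (leqnn _) i).
  exact: prodr_ge0.
have CA0 : 0 <= CA by apply: sumr_ge0 => i _; rewrite mulr_ge0.
have key e : 0 < e ->
    (\int[cc_prob X]_(w in [set: _]) F w <= (CA * expR (- S) * expR e)%:E)%E.
  move=> e0; apply: (integral_le_sum_prod m0 F0 f0 C0 he hF).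
  have := @nneseries_partial_gt R m (S - e) m0.
  rewrite -/(mass m) hS lte_fin gtrBl e0 => /(_ isT) hSe.
  near=> M.
  have hM : S - e < \sum_(0 <= k < M) m k by near: M.
  have hAM i : \prod_(0 <= k < M) a i k <= A i by move: i; near: M.
  rewrite /CA -mulrA mulr_suml; apply: ler_sum => i _.
  rewrite big_split /= -!mulrA ler_wpM2l//.
  apply: ler_pM; [exact: prodr_ge0| |exact: hAM|].
    by apply: prodr_ge0 => k _; exact: expR_ge0.
  rewrite -expR_sum sumrN -expRD ler_expR; lra.
apply/lee_addgt0Pr => e e0.
(* Chosen so that CA exp(e') <= CA + e; the summand 1 allows CA = 0. *)
pose e' := ln (1 + e / (CA + 1)).
have q0 : 0 < e / (CA + 1) by rewrite divr_gt0// ltr_wpDl.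
have e'0 : 0 < e' by rewrite ln_gt0// ltrDl.
apply: le_trans (lee_wpmul2l (expeR_ge0 _) (key _ e'0)) _.
rewrite /= -EFinM lee_fin /e' lnK ?posrE ?addr_gt0// expRN.
have -> : expR S * (CA / expR S * (1 + e / (CA + 1))) =
    CA * (1 + e / (CA + 1)) by field; rewrite !gt_eqF ?expR_gt0// ltr_wpDl.
rewrite mulrDr mulr1 lerD2l mulrCA ler_piMr ?(ltW e0)//.
by rewrite ler_pdivrMr ?ltr_wpDl// mul1r lerDl.
Unshelve. all: by end_near. Qed.

Lemma exp_mass_integral_le (F : cc_space X -> \bar R) (f : nat -> nat -> R)
    (a : nat -> R) (C A S : R) :
  (forall w, 0 <= F w)%E -> (forall k n, 0 <= f k n) -> 0 <= C -> (forall k, 0 <= a k) ->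
  (forall k,
    \sum_(0 <= n <oo) (f k n * poisson_weight (m k) n)%:E = (a k * expR (- m k))%:E)%E ->
  (forall w, \forall M \near \oo,
    (F w <= (C * \prod_(0 <= k < M) f k (N k w))%:E)%E) ->
  mass m = S%:E -> (forall M, \prod_(0 <= k < M) a k <= A) ->
  (expeR S%:E * \int[cc_prob X]_(w in [set: _]) F w <= (C * A)%:E)%E.
Proof.
move=> F0 f0 C0 a0 he hF hS hA.
rewrite (_ : C * A = \sum_(i : unit) C * A); last by rewrite big_const card_unit /= addr0.
apply: (@exp_mass_integral_le_sum _ F (fun=> f) (fun=> a) (fun=> C) (fun=> A)) => //.
- by move=> w; apply: filterS (hF w) => M; rewrite big_const card_unit /= addr0.
- by apply: nearW => M _.
Qed.

Lemma poisson_expR_weight (s : R) k :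
  (\sum_(0 <= n <oo) (expR (s * n%:R) * poisson_weight (m k) n)%:E =
   (expR (m k * expR s) * expR (- m k))%:E)%E.
Proof. by rewrite poisson_expR// -expRD; congr (expR _)%:E; ring. Qed.

End ExponentialMoments.

Section CountDensities.
Variables (R : realType) (n : nat -> nat) (V : R).
Hypothesis V0 : 0 < V.

Let x k : R := (n k)%:R / V.

(** Counts are integers: one cycle of length k + 1 already has particle density (k + 1) / V, so no
    cycle is longer than V D. On such configurations the truncated functionals are exact. *)
Lemma count_dens_finsupp (D : R) : dens x = D%:E ->
  exists K, forall k, (K <= k)%N -> n k = 0%N.
Proof.
move=> hD; exists (Num.truncn (V * D)).+1 => k hk.
have x0 j : 0 <= x j by rewrite divr_ge0// ltW.
have hk1 : k.+1%:R * x k <= D.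
  rewrite -lee_fin -hD.
  apply: le_trans (nneseries_partial_ge k.+1 _); last first.
    by move=> j; rewrite mulr_ge0.
  by rewrite lee_fin big_nat_recr//= lerDr sumr_ge0// => j _; rewrite mulr_ge0.
apply/eqP; rewrite -leqn0 leqNgt; apply/negP => nk0.
have VD0 : 0 <= V * D by rewrite mulr_ge0 ?(ltW V0)//; apply: le_trans hk1; rewrite mulr_ge0.
have /andP[_ h2] := truncn_itv VD0.
have h3 : k.+1%:R <= V * D.
  apply: (@le_trans _ _ (V * (k.+1%:R * x k))); last by rewrite ler_pM2l.
  by rewrite mulrCA /x (mulrC V) divfK ?gt_eqF// ler_peMr// ler1n.
have := lt_le_trans (le_lt_trans h3 h2) _; move/(_ k.+1%:R).
by rewrite ler_nat ltnS ltnW// ltxx => /(_ isT).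
Qed.

End CountDensities.

Section UpperBounds.
Variables (R : realType) (d : nat) (beta : R).
Hypotheses (d0 : (0 < d)%N) (beta0 : 0 < beta).
Variables (bc : boundary) (gDir : nat -> R -> 'rV[R]_d -> 'rV[R]_d -> R).
Hypothesis hDir : bc = Dir -> forall (N : nat) (t : R), (0 < N)%N -> 0 < t ->
  dirichlet_density N t (gDir N t).
Variables (alpha : R).
Hypothesis alpha0 : alpha <= 0.

Local Notation V := (box_vol R d).
Local Notation q := (fun N mu => q_bc bc gDir N beta mu).
Local Notation q0 := (q_free d beta 0).

Variable X : forall N, cycle_counts (fun k => V N * q N alpha k).

Lemma pressure_of_le N (Z : \bar R) (B : R) : (0 < N)%N -> (0 <= Z)%E ->
  (Z <= (expR B)%:E)%E ->
  ((beta * V N)^-1%:E * lne Z <= (B / (beta * V N))%:E)%E.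
Proof.
move=> N0 Z0 ZB; have v0 := box_vol_gt0 R d N0.
have -> : ((B / (beta * V N))%:E = (beta * V N)^-1%:E * B%:E)%E by rewrite -EFinM mulrC.
apply: lee_wpmul2l; first by rewrite lee_fin invr_ge0 mulr_ge0// ltW.
by rewrite -[leRHS]expeRK; exact: le_lne.
Qed.

Lemma q_bc_tilt_le (e mu s : R) N k :
  (forall k, q_bc bc gDir N beta 0 k <= (1 + e) * q0 k) ->
  q N mu k * expR (beta * s * k.+1%:R) <= (1 + e) * q_free d beta (mu + s) k.
Proof.
move=> hN; rewrite /= q_bc_mu.
have -> : q_free d beta (mu + s) k =
    expR (beta * mu * k.+1%:R) * expR (beta * s * k.+1%:R) * q0 k.
  rewrite !q_freeE// mulr0 mul0r expR0 mul1r -expRD; congr (expR _ * _); ring.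
by rewrite mulrAC [leRHS]mulrCA ler_pM2l ?mulr_gt0 ?expR_gt0.
Qed.

Lemma pressure_le_near (Z : nat -> \bar R) (P W c : R) : 0 <= W ->
  P + beta^-1 * W < c -> (forall N, 0 <= Z N)%E ->
  (forall e, 0 < e -> \forall N \near \oo,
    (Z N <= (expR (V N * beta * P + V N * ((1 + e) * W)))%:E)%E) ->
  \forall N \near \oo, ((beta * V N)^-1%:E * lne (Z N) <= c%:E)%E.
Proof.
move=> W0 hc Z0 hZ.
pose g := c - (P + beta^-1 * W).
have g0 : 0 < g by rewrite subr_gt0.
pose e := g * beta / (W + 1).
have e0 : 0 < e by rewrite divr_gt0 ?mulr_gt0// ltr_wpDl.
have {}hZ := hZ e e0.
near=> N.
have N0 : (0 < N)%N by near: N; exists 1%N.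
have v0 := box_vol_gt0 R d N0.
have Zle : (Z N <= (expR (V N * beta * P + V N * ((1 + e) * W)))%:E)%E by near: N.
apply: le_trans (pressure_of_le N0 (Z0 N) Zle) _; rewrite lee_fin.
have -> : (V N * beta * P + V N * ((1 + e) * W)) / (beta * V N) =
    P + beta^-1 * W + beta^-1 * (e * W) by field; rewrite !gt_eqF.
have : beta^-1 * (e * W) <= g.
  rewrite ler_pdivrMl// /e mulrAC ler_pdivrMr ?ltr_wpDl//.
  by rewrite (mulrC beta) ler_pM2l ?mulr_gt0// lerDl.
rewrite /g; lra.
Unshelve. all: by end_near. Qed.

Lemma partition_mul_ge0 H N : (0 <= expeR ((V N)%:E * mass (q N alpha)) *
  partition_function (X N) (V N) beta H)%E.
Proof.
by rewrite mule_ge0 ?expeR_ge0//; apply: integral_ge0 => w _; exact: expeR_ge0.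
Qed.

Lemma box_mass_q_bc N : ((V N)%:E * mass (q N alpha) = (V N * fine (mass (q N alpha)))%:E)%E.
Proof. by rewrite EFinM fineK//; exact: mass_q_bc_fin. Qed.

Lemma mass_box_q_bc N :
  mass (fun k => V N * q N alpha k) = (V N * fine (mass (q N alpha)))%:E.
Proof.
rewrite -box_mass_q_bc /mass; under eq_eseriesr do rewrite EFinM.
by rewrite nneseriesZl// => k _; rewrite lee_fin; exact: q_bc_mu_ge0.
Qed.

Lemma q_free_mass_partial_le mu n : mu <= 0 ->
  \sum_(0 <= k < n) q_free d beta mu k <= fine (mass (q_free d beta mu)).
Proof.
move=> mu0; rewrite -lee_fin fineK; last exact: mass_q_free_fin.
by apply: nneseries_partial_ge => k; rewrite ltW// q_free_gt0.
Qed.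

Lemma q_free_mass_ge0 mu : 0 <= fine (mass (q_free d beta mu)).
Proof.
by apply: fine_ge0; apply: nneseries_ge0 => k _ _; rewrite lee_fin ltW// q_free_gt0.
Qed.

(** The slope [s] stays free: it will be the self-consistent density below the critical point and
    (mu + alpha) / a above it. The constraint makes the tilted chemical potential nonpositive, hence
    the tilted mass finite. *)
Lemma pmf_pressure_le (mu a s c : R) : 0 <= a -> mu + alpha <= a * s ->
  a / 2 * s ^+ 2 + beta^-1 * fine (mass (q_free d beta (mu + alpha - a * s))) < c ->
  \forall N \near \oo, (bc_pressure X (H_pmf mu a) N <= c%:E)%E.
Proof.
move=> a0 has; set W := fine _ => hc.
have th0 : mu + alpha - a * s <= 0 by rewrite subr_le0.
apply: (@pressure_le_near _ (a / 2 * s ^+ 2) W c) => //.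
- exact: q_free_mass_ge0.
- by move=> N; exact: partition_mul_ge0.
move=> e e0.
have hq := q_bc_le_near beta0 hDir e0.
near=> N.
have N0 : (0 < N)%N by near: N; exists 1%N.
have v0 := box_vol_gt0 R d N0.
have qN k : q_bc bc gDir N beta 0 k <= (1 + e) * q0 k by move: k; near: N.
have m0 k : 0 <= V N * q N alpha k by rewrite mulr_ge0 ?(ltW v0)//; exact: q_bc_mu_ge0.
rewrite expRD box_mass_q_bc.
apply: (@exp_mass_integral_le _ _ (X N) m0 _
    (fun k n => expR (beta * (mu - a * s) * k.+1%:R * n%:R))
    (fun k => expR (V N * q N alpha k * expR (beta * (mu - a * s) * k.+1%:R)))).
  - by move=> w; exact: expeR_ge0.
  - by move=> k n; exact: expR_ge0.
  - exact: expR_ge0.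
  - by move=> k; exact: expR_ge0.
  - move=> k; exact: (poisson_expR_weight m0).
  - move=> w; rewrite /H_pmf; set x := (fun k => (cc_count (X N) k w)%:R / V N).
    case ED : (dens x) => [D| |]; last 2 first.
    + apply: nearW => M; rewrite gt0_muley ?lte_fin ?mulr_gt0//= lee_fin.
      by rewrite mulr_ge0 ?expR_ge0// prodr_ge0// => k _; rewrite expR_ge0.
    + apply: nearW => M; rewrite gt0_muley ?lte_fin ?mulr_gt0//= lee_fin.
      by rewrite mulr_ge0 ?expR_ge0// prodr_ge0// => k _; rewrite expR_ge0.
    have [K hK] := count_dens_finsupp v0 ED.
    exists K => // M /= KM; rewrite lee_fin -expR_sum -expRD ler_expR.
    have : dens x = (dens_upto M x)%:E.
      by apply: dens_finsupp => k Mk; rewrite /x hK ?mul0r// (leq_trans KM).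
    rewrite ED => -[DE].
    have -> : \sum_(0 <= k < M) beta * (mu - a * s) * k.+1%:R * (cc_count (X N) k w)%:R =
        V N * beta * (mu - a * s) * D.
      rewrite DE /dens_upto mulr_sumr; apply: eq_bigr => k _; rewrite /x.
      by field; rewrite gt_eqF.
    have -> : V N * beta * (a / 2 * s ^+ 2) + V N * beta * (mu - a * s) * D =
        - (V N * beta * (- mu * D + a / 2 * D ^+ 2)) + V N * beta * (a / 2) * (D - s) ^+ 2.
      by field.
    rewrite lerDl mulr_ge0 ?sqr_ge0//.
    by rewrite !mulr_ge0 ?(ltW v0) ?(ltW beta0) ?invr_ge0.
  - exact: mass_box_q_bc.
  - move=> M; rewrite -expR_sum ler_expR.
    apply: (@le_trans _ _ (\sum_(0 <= k < M) V N * ((1 + e) * q_free d beta (mu + alpha - a * s) k))).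
      apply: ler_sum => k _; rewrite -mulrA ler_pM2l//.
      have -> : mu + alpha - a * s = alpha + (mu - a * s) by ring.
      exact: q_bc_tilt_le.
    rewrite -!mulr_sumr ler_pM2l// ler_pM2l ?addr_gt0//.
    exact: q_free_mass_partial_le.
Unshelve. all: by end_near. Qed.

Lemma cmf_pressure_le (a t c : R) : 0 <= a -> 0 <= t ->
  a / 2 * t ^+ 2 +
    beta^-1 * (expR (- (beta * a * t)) * fine (mass (q_free d beta alpha))) < c ->
  \forall N \near \oo, (bc_pressure X (H_cmf a) N <= c%:E)%E.
Proof.
move=> a0 t0; set E := expR _; set W := fine _ => hc.
have W0 : 0 <= W by exact: q_free_mass_ge0.
apply: (@pressure_le_near _ (a / 2 * t ^+ 2) (E * W) c) => //.
- by rewrite mulr_ge0// expR_ge0.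
- by move=> N; exact: partition_mul_ge0.
move=> e e0.
have hq := q_bc_le_near beta0 hDir e0.
near=> N.
have N0 : (0 < N)%N by near: N; exists 1%N.
have v0 := box_vol_gt0 R d N0.
have qN k : q_bc bc gDir N beta 0 k <= (1 + e) * q0 k by move: k; near: N.
have m0 k : 0 <= V N * q N alpha k by rewrite mulr_ge0 ?(ltW v0)//; exact: q_bc_mu_ge0.
rewrite expRD box_mass_q_bc.
apply: (@exp_mass_integral_le _ _ (X N) m0 _
    (fun k n => expR (- (beta * a * t) * n%:R))
    (fun k => expR (V N * q N alpha k * E))).
- by move=> w; exact: expeR_ge0.
- by move=> k n; exact: expR_ge0.
- exact: expR_ge0.
- by move=> k; exact: expR_ge0.
- by move=> k; exact: (poisson_expR_weight m0).
- move=> w; rewrite /H_cmf; set x := (fun k => (cc_count (X N) k w)%:R / V N).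
  have x0 k : 0 <= x k by rewrite divr_ge0// ltW.
  apply: nearW => M; rewrite -expR_sum -mulr_sumr -expRD.
  have sE : \sum_(0 <= k < M) (cc_count (X N) k w)%:R = V N * mass_upto M x.
    rewrite /mass_upto mulr_sumr; apply: eq_bigr => k _; rewrite /x.
    by rewrite mulrC divfK// gt_eqF.
  rewrite sE; have hM := nneseries_partial_ge M x0; rewrite -/(mass x) in hM.
  move: hM; case: (mass x) => [r| |] hM.
  + rewrite -EFin_expe -!EFinM -EFinN /= lee_fin ler_expR.
    have hr : mass_upto M x <= r by rewrite -lee_fin.
    have h1 : 0 <= V N * beta * (a / 2) * (r - t) ^+ 2.
      rewrite mulr_ge0 ?sqr_ge0//.
      by rewrite !mulr_ge0 ?invr_ge0 ?(ltW v0) ?(ltW beta0).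
    (* The product over [M] coordinates sees only [mass_upto M x]; since a and t are nonnegative,
       replacing the full mass r by this smaller value in the linear term goes in the right
       direction. *)
    have h2 : 0 <= V N * beta * a * t * (r - mass_upto M x).
      by rewrite !mulr_ge0 ?subr_ge0 ?(ltW v0) ?(ltW beta0).
    nra.
  (* Infinite total mass: for a = 0 the energy is 0 * oo = 0 and both sides are 1; for a > 0 the
     weight vanishes. *)
  + move: a0; rewrite le_eqVlt => /predU1P[<-|a0].
      by rewrite !(mul0r, mul0e, mulr0, mule0, oppr0, oppe0, addr0) expeR0 expR0.
    rewrite expe2 mulyy gt0_muley ?lte_fin ?divr_gt0// gt0_muley ?lte_fin ?mulr_gt0//=.
  + by move: hM; rewrite leeNy_eq.
- exact: mass_box_q_bc.
- move=> M; rewrite -expR_sum ler_expR.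
  apply: (@le_trans _ _ (\sum_(0 <= k < M) V N * E * ((1 + e) * q_free d beta alpha k))).
    apply: ler_sum => k _; rewrite mulrAC ler_pM2l ?mulr_gt0 ?expR_gt0//.
    have := @q_bc_tilt_le e alpha 0 N k qN.
    by rewrite mulr0 mul0r expR0 mulr1 addr0.
  rewrite -!mulr_sumr -!mulrA ler_pM2l// mulrCA ler_pM2l ?addr_gt0//.
  by rewrite ler_pM2l ?expR_gt0//; exact: q_free_mass_partial_le.
Unshelve. all: by end_near. Qed.

End UpperBounds.

(** * The upper bound for HYL *)

Section HylBounds.
Variable R : realType.

Lemma fact_ge_exp (n : nat) : (n%:R / expR 1) ^+ n <= n`!%:R :> R.
Proof.
rewrite expr_div_n -expRM_natr mul1r ler_pdivrMr ?expR_gt0//.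
have h : n%:R ^+ n / n`!%:R <= expR n%:R :> R.
  case: n => [|n]; first by rewrite expr0 fact0 divr1 expR0.
  by apply: le_trans (expR_ge1Dxn n (ler0n R n.+1)); rewrite lerDr.
by rewrite mulrC -ler_pdivrMr ?ltr0n ?fact_gt0.
Qed.

(** The comparison of weights costs (1 + e)^n <= exp(e n), which is negligible because the counts it
    is applied to are at most proportional to the volume. *)
Lemma poisson_atom_le (V q q' e : R) (n : nat) : 0 < V -> 0 < q -> 0 <= e ->
  0 <= q' -> q' <= (1 + e) * q ->
  (V * q') ^+ n / n`!%:R <=
  expR (V * (n%:R / V * (1 - ln (n%:R / V / q))) + e * n%:R).
Proof.
move=> V0 q0 e0 q'0 qq'; case: n => [|n].
  by rewrite expr0 fact0 divr1 !mul0r !mulr0 addr0 expR0.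
have n0 : 0 < n.+1%:R :> R by rewrite ltr0n.
have e1 : 0 < 1 + e by rewrite ltr_pwDl.
apply: (@le_trans _ _ ((V * ((1 + e) * q)) ^+ n.+1 / (n.+1%:R / expR 1) ^+ n.+1)).
  apply: ler_pM; rewrite ?exprn_ge0 ?mulr_ge0 ?(ltW V0) ?invr_ge0//.
    by rewrite lerXn2r ?nnegrE ?mulr_ge0 ?(ltW V0) ?(ltW e1) ?(ltW q0)// ler_pM2l.
  rewrite lef_pV2 ?posrE ?ltr0n ?fact_gt0 ?exprn_gt0 ?divr_gt0 ?expR_gt0//.
  exact: fact_ge_exp.
rewrite -expr_div_n.
have -> : V * (n.+1%:R / V * (1 - ln (n.+1%:R / V / q))) + e * n.+1%:R =
    (1 - ln (n.+1%:R / V / q) + e) * n.+1%:R by field; rewrite gt_eqF.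
rewrite expRM_natr lerXn2r ?nnegrE ?expR_ge0//.
  by rewrite !divr_ge0 ?mulr_ge0 ?expR_ge0// ?(ltW V0) ?(ltW e1) ?(ltW q0).
rewrite !expRD expRN lnK ?posrE ?divr_gt0//.
have -> : V * ((1 + e) * q) / (n.+1%:R / expR 1) =
    expR 1 / (n.+1%:R / V / q) * (1 + e).
  by field; rewrite !gt_eqF ?expR_gt0.
by rewrite ler_pM2l ?mulr_gt0 ?expR_gt0 ?invr_gt0 ?divr_gt0 ?expR_gt0 ?invr_gt0// expR_ge1Dx.
Qed.

(* The excluded-volume gain of the long cycles is at most [b/2 D2^2], and the
   remaining concave quadratic in [D2] is completed to a square. *)
Lemma hyl_split_le (mu alpha a b D1 D2 Q1 Q2 : R) : 0 <= b -> b < a -> 0 <= D2 ->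
  Q2 <= D2 ^+ 2 ->
  mu * (D1 + D2) - a / 2 * (D1 + D2) ^+ 2 + b / 2 * (Q1 + Q2) <=
  mu * D1 - a / 2 * D1 ^+ 2 + b / 2 * Q1 +
  Num.max (mu + alpha - a * D1) 0 ^+ 2 / (2 * (a - b)) - alpha * D2.
Proof.
move=> b0 ba D20 QD; set P := Num.max _ _.
have P1 : mu + alpha - a * D1 <= P by rewrite le_max lexx.
have ab0 : 0 < a - b by rewrite subr_gt0.
have h1 : 0 <= (P - mu - alpha + a * D1) * D2 by rewrite mulr_ge0//; lra.
have h2 : 0 <= b / 2 * (D2 ^+ 2 - Q2) by rewrite mulr_ge0 ?divr_ge0// subr_ge0.
have h3 : 0 <= (P - (a - b) * D2) ^+ 2 / (2 * (a - b)).
  by rewrite divr_ge0 ?sqr_ge0// mulr_ge0// ltW.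
have h4 : (P - (a - b) * D2) ^+ 2 / (2 * (a - b)) =
    P ^+ 2 / (2 * (a - b)) - P * D2 + (a - b) / 2 * D2 ^+ 2.
  by field; rewrite gt_eqF.
rewrite h4 in h3; move: h1 h2 h3; set T := P ^+ 2 / _; lra.
Qed.

Lemma sum_sq_le (x : nat -> R) (K M : nat) : (forall k, 0 <= x k) ->
  \sum_(K <= k < M) x k ^+ 2 <= (\sum_(K <= k < M) x k) ^+ 2.
Proof.
move=> x0; have [MK|KM] := leqP M K; first by rewrite !big_geq// expr0n.
elim: M KM => // M IHM; rewrite ltnS => KM.
rewrite !big_nat_recr//=.
have h : \sum_(K <= k < M) x k ^+ 2 <= (\sum_(K <= k < M) x k) ^+ 2.
  move: KM; rewrite leq_eqVlt => /predU1P[<-|]; last exact: IHM.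
  by rewrite !big_geq// expr0n.
have s0 : 0 <= \sum_(K <= k < M) x k by apply: sumr_ge0.
by have := x0 M; nra.
Qed.

End HylBounds.

Section HylUpperBound.
Variables (R : realType) (d : nat) (beta : R).
Hypotheses (d0 : (0 < d)%N) (beta0 : 0 < beta).
Variables (bc : boundary) (gDir : nat -> R -> 'rV[R]_d -> 'rV[R]_d -> R).
Hypothesis hDir : bc = Dir -> forall (N : nat) (t : R), (0 < N)%N -> 0 < t ->
  dirichlet_density N t (gDir N t).
Variables (alpha : R).
Hypothesis alpha0 : alpha <= 0.

Local Notation V := (box_vol R d).
Local Notation q := (fun N mu => q_bc bc gDir N beta mu).
Local Notation q0 := (q_free d beta 0).

Variable X : forall N, cycle_counts (fun k => V N * q N alpha k).
Variables (mu a b u : R).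
Hypotheses (b0 : 0 <= b) (ba : b < a).

(** Up to the factor beta, this is the mass of [q0] minus the functional under the infimum,
    evaluated at [x] cut off at [K]; the last term is the gain of the optimal condensate. *)
Definition hyl_value K (x : nat -> R) : R :=
  beta^-1 * entropy_upto q0 K x + (mu + alpha) * dens_upto K x
  - a / 2 * dens_upto K x ^+ 2 + b / 2 * sq_upto K x
  + Num.max (mu + alpha - a * dens_upto K x) 0 ^+ 2 / (2 * (a - b)).

Hypothesis hu : forall K x, (forall k, 0 <= x k) -> hyl_value K x <= u.

Let W := fine (mass q0).
(** Above density [R0] the energy beats crude counting. There the ideal gas contributes at most
    exp(2 V W), the 2 bounding 1 + e, and B' is the level for which exp(beta V B') times this is
    exp(beta V u). [R0] makes the quadratic term with coefficient a - b > 0 exceed |mu| and |B'|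
    together. *)
Let B' := u - 2 * W / beta.
Let R0 := Num.max 1 (2 * (`|mu| + `|B'|) / (a - b)).

Let large_density D : R0 < D -> mu * D - (a - b) / 2 * D ^+ 2 <= B'.
Proof.
rewrite gt_max => /andP[D1 D2].
have ab0 : 0 < a - b by rewrite subr_gt0.
move: D2; rewrite ltr_pdivrMr// => D2.
have h1 := ler_norm mu; have h2 := ler_norm (- B'); rewrite normrN in h2.
have h3 : 0 <= `|B'| by [].
have h4 : 0 <= `|mu| by [].
nra.
Qed.

Section Volume.
Variables (N K : nat) (e T : R).
Hypotheses (N0 : (0 < N)%N) (e0 : 0 < e) (e1 : e <= 1)
  (hq : forall k, q_bc bc gDir N beta 0 k <= (1 + e) * q0 k)
  (hT : forall M, \sum_(K <= k < M) q0 k <= T).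

Let L := Num.truncn (R0 * V N).

Let v0 : 0 < V N. Proof. exact: box_vol_gt0. Qed.

Let conf (g : {ffun 'I_K -> 'I_L.+1}) (k : nat) : nat :=
  if insub k is Some i then g i else 0.

Let y g k : R := (conf g k)%:R / V N.

Let E g : R := mu * dens_upto K (y g) - a / 2 * dens_upto K (y g) ^+ 2 +
  b / 2 * sq_upto K (y g) +
  Num.max (mu + alpha - a * dens_upto K (y g)) 0 ^+ 2 / (2 * (a - b)).

(** [None] stands for all configurations of density above [R0]; [Some g] prescribes the counts of
    the [K] shortest lengths, each at most R0 V when the density is at most [R0]. *)
Let I := option {ffun 'I_K -> 'I_L.+1}.

(** On long cycles the tilt by - alpha reproduces the term - alpha D2 left by [hyl_split_le]. It
    brings their weights back to chemical potential 0, where the tail mass is still small. *)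
Let f (i : I) (k n : nat) : R :=
  if i is Some g then
    if (k < K)%N then (n == conf g k)%:R else expR (- (beta * alpha * k.+1%:R) * n%:R)
  else 1.

Let A_ (i : I) (k : nat) : R :=
  let m := V N * q N alpha k in
  if i is Some g then
    if (k < K)%N then m ^+ conf g k / (conf g k)`!%:R
    else expR (m * expR (- (beta * alpha * k.+1%:R)))
  else expR m.

Let C (i : I) : R :=
  if i is Some g then expR (beta * V N * E g) else expR (beta * V N * B').

Let m0 k : 0 <= V N * q N alpha k.
Proof. by rewrite mulr_ge0 ?(ltW v0)//; exact: q_bc_mu_ge0. Qed.

Let conf_le g k : (conf g k)%:R <= R0 * V N :> R.
Proof.
have RV : 0 <= R0 * V N by rewrite mulr_ge0 ?(ltW v0)// le_max ler01.
rewrite /conf; case: insubP => [i _ _|_]; last by rewrite mulr0n.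
apply: le_trans (_ : L%:R <= _); first by rewrite ler_nat -ltnS ltn_ord.
by have /andP[] := truncn_itv RV.
Qed.

Let f_sum i k : (\sum_(0 <= n <oo) (f i k n * poisson_weight (V N * q N alpha k) n)%:E =
  (A_ i k * expR (- (V N * q N alpha k)))%:E)%E.
Proof.
case: i => [g|] /=; last first.
  rewrite -expRD subrr expR0.
  have := poisson_expR 0 (m0 k); rewrite expR0 subrr mulr0 expR0 => <-.
  by apply: eq_eseriesr => n _; rewrite mul0r expR0.
by case: ifP => _; [rewrite poisson_indic|exact: (poisson_expR_weight m0)].
Qed.

Let f_bound w : \forall M \near \oo,
  (expeR (- ((V N * beta)%:E *
     H_hyl mu a b (fun k => (cc_count (X N) k w)%:R / V N)%R)) <=
   (\sum_i C i * \prod_(0 <= k < M) f i k (cc_count (X N) k w))%:E)%E.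
Proof.
set x := (fun k => (cc_count (X N) k w)%:R / V N).
have x0 k : 0 <= x k by rewrite divr_ge0// ltW.
have C0 i : 0 <= C i by case: i => [g|]; exact: expR_ge0.
have f0 i k n : 0 <= f i k n.
  by case: i => [g|] //=; case: ifP => _; rewrite ?expR_ge0.
have Cf0 i M : 0 <= C i * \prod_(0 <= k < M) f i k (cc_count (X N) k w).
  by rewrite mulr_ge0// prodr_ge0.
have triv : H_hyl mu a b x = +oo%E -> \forall M \near \oo,
   (expeR (- ((V N * beta)%:E * H_hyl mu a b x)) <=
   (\sum_i C i * \prod_(0 <= k < M) f i k (cc_count (X N) k w))%:E)%E.
  move=> ->; apply: nearW => M; rewrite gt0_muley ?lte_fin ?mulr_gt0//= lee_fin.
  exact: sumr_ge0.
case ED : (dens x) => [D| |]; [|by apply: triv; rewrite /H_hyl ED..].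
have [K1 hK1] := count_dens_finsupp v0 ED.
exists (maxn K K1) => // M /=; rewrite geq_max => /andP[KM K1M].
have xM k : (M <= k)%N -> x k = 0.
  by move=> Mk; rewrite /x hK1 ?mul0r// (leq_trans K1M).
have DM : D = dens_upto M x by have := dens_finsupp xM; rewrite ED => -[].
rewrite (H_hyl_finsupp _ _ _ xM) -DM -EFinM -EFinN /= lee_fin.
have dx0 k : 0 <= k.+1%:R * x k by rewrite mulr_ge0.
have sqM : sq_upto M x <= D ^+ 2.
  rewrite DM; apply: le_trans (sum_sq_le 0 M dx0).
  by apply: ler_sum => k _; rewrite [leRHS]exprMn.
have [DR|DR] := ltP R0 D.
  rewrite (bigD1 None)//= -[leLHS]addr0 lerD ?sumr_ge0//.
  rewrite big1 ?mulr1// ler_expR -mulrN (mulrC (V N)) ler_pM2l ?mulr_gt0//.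
  apply: le_trans (large_density DR).
  have : b / 2 * sq_upto M x <= b / 2 * D ^+ 2 by rewrite ler_wpM2l ?divr_ge0.
  lra.
have nL (k : 'I_K) : (cc_count (X N) k w < L.+1)%N.
  rewrite ltnS /L truncn_ge_nat; last by rewrite mulr_ge0 ?(ltW v0)// le_max ler01.
  rewrite -ler_pdivrMr//; apply: le_trans DR.
  apply: (@le_trans _ _ (k.+1%:R * x k)); first by apply: ler_peMl; [exact: x0|rewrite ler1n].
  rewrite DM /dens_upto; have kM : (k < M)%N by exact: leq_trans KM.
  rewrite (@big_cat_nat _ _ _ k.+1)//= big_nat_recr//=.
  by rewrite addrAC lerDr addr_ge0 ?sumr_ge0.
pose g : {ffun 'I_K -> 'I_L.+1} := [ffun k => Ordinal (nL k)].
have confE k : (k < K)%N -> conf g k = cc_count (X N) k w.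
  by move=> kK; rewrite /conf insubT/= ffunE.
have yE k : (k < K)%N -> y g k = x k by move=> kK; rewrite /y confE.
rewrite (bigD1 (Some g))//= -[leLHS]addr0 lerD ?sumr_ge0//.
have -> : \prod_(0 <= k < M) (if (k < K)%N then (cc_count (X N) k w == conf g k)%:R else
    expR (- (beta * alpha * k.+1%:R) * (cc_count (X N) k w)%:R)) =
    expR (beta * V N * (- alpha * \sum_(K <= k < M) k.+1%:R * x k)).
  rewrite (@big_cat_nat _ _ _ K)//= [X in X * _]big_nat big1 ?mul1r; last first.
    by move=> k /andP[_ kK]; rewrite kK confE// eqxx.
  rewrite !mulr_sumr expR_sum !big_nat; apply: eq_bigr => k /andP[Kk _].
  by rewrite ltnNge Kk /= /x; congr expR; field; rewrite gt_eqF.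
rewrite -expRD ler_expR -mulrDr -mulrN (mulrC (V N)) ler_pM2l ?mulr_gt0//.
set D2 := \sum_(K <= k < M) k.+1%:R * x k.
have D2_0 : 0 <= D2 by apply: sumr_ge0.
have dE : dens_upto K (y g) = dens_upto K x.
  by rewrite /dens_upto !big_nat; apply: eq_bigr => k /andP[_ kK]; rewrite yE.
have sE : sq_upto K (y g) = sq_upto K x.
  by rewrite /sq_upto !big_nat; apply: eq_bigr => k /andP[_ kK]; rewrite yE.
have DS : D = dens_upto K x + D2.
  by rewrite DM /dens_upto /D2 (@big_cat_nat _ _ _ K).
have QS : sq_upto M x = sq_upto K x + \sum_(K <= k < M) k.+1%:R ^+ 2 * x k ^+ 2.
  by rewrite /sq_upto (@big_cat_nat _ _ _ K).
have Q2 : \sum_(K <= k < M) k.+1%:R ^+ 2 * x k ^+ 2 <= D2 ^+ 2.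
  apply: le_trans (sum_sq_le K M dx0).
  by apply: ler_sum => k _; rewrite [leRHS]exprMn.
rewrite /E dE sE DS QS.
have := hyl_split_le mu alpha (dens_upto K x) (sq_upto K x) b0 ba D2_0 Q2.
lra.
Qed.

Let A_bound (i : I) : R :=
  if i is Some g then
    expR (V N * (entropy_upto (q_free d beta alpha) K (y g))
          + e * (K%:R * (R0 * V N)) + V N * ((1 + e) * T))
  else expR (V N * (2 * W)).

Let prod_A_le : \forall M \near \oo, forall i, \prod_(0 <= k < M) A_ i k <= A_bound i.
Proof.
exists K => // M /= KM [g|] /=; last first.
  rewrite -expR_sum ler_expR -mulr_sumr ler_pM2l//.
  apply: (@le_trans _ _ (\sum_(0 <= k < M) 2 * q0 k)); last first.
    by rewrite -mulr_sumr ler_pM2l// q_free_mass_partial_le.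
  apply: ler_sum => k _; apply: (@le_trans _ _ (q N 0 k)).
    rewrite /= q_bc_mu ler_piMl ?q_bc_ge0// expR_le1 mulr_le0_ge0//.
    by rewrite mulr_ge0_le0// ltW.
  apply: le_trans (hq k) _; rewrite ler_pM2r ?q_free_gt0//.
  by rewrite -[2]/(1 + 1) lerD2l.
rewrite (@big_cat_nat _ _ _ K)//= expRD; apply: ler_pM.
- rewrite big_nat; apply: prodr_ge0 => k /andP[_ kK]; rewrite kK.
  by rewrite divr_ge0// exprn_ge0.
- rewrite big_nat; apply: prodr_ge0 => k /andP[Kk _].
  by rewrite ltnNge Kk expR_ge0.
- have hK : e * (K%:R * (R0 * V N)) >= \sum_(0 <= k < K) e * (conf g k)%:R.
    rewrite -mulr_sumr ler_pM2l// (le_trans (_ : _ <= \sum_(0 <= k < K) R0 * V N))//.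
      by apply: ler_sum.
    by rewrite sumr_const_nat subn0 [leRHS]mulr_natl.
  apply: (@le_trans _ _ (expR (V N * entropy_upto (q_free d beta alpha) K (y g) +
      \sum_(0 <= k < K) e * (conf g k)%:R))); last by rewrite ler_expR lerD2l.
  rewrite /entropy_upto mulr_sumr -big_split /= expR_sum !big_nat.
  apply: ler_prod => k /andP[_ kK]; rewrite kK divr_ge0 ?exprn_ge0//=.
  apply: poisson_atom_le => //; [exact: q_free_gt0|exact: ltW|exact: q_bc_mu_ge0|].
  have := @q_bc_tilt_le _ _ _ beta0 bc gDir e alpha 0 N k hq.
  by rewrite mulr0 mul0r expR0 mulr1 addr0.
rewrite !big_nat (eq_bigr (fun k => expR (V N * q N alpha k *
    expR (- (beta * alpha * k.+1%:R))))); last first.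
  by move=> k /andP[Kk _]; rewrite ltnNge Kk.
rewrite -!big_nat -expR_sum ler_expR.
apply: (@le_trans _ _ (\sum_(K <= k < M) V N * ((1 + e) * q0 k))); last first.
  by rewrite -!mulr_sumr ler_pM2l// ler_pM2l ?addr_gt0.
apply: ler_sum => k _; rewrite -mulrA ler_pM2l//.
have := @q_bc_tilt_le _ _ _ beta0 bc gDir e alpha (- alpha) N k hq.
by rewrite subrr mulrN mulNr.
Qed.

Lemma hyl_partition_le :
  (expeR ((V N)%:E * mass (q N alpha)) *
   partition_function (X N) (V N) beta (H_hyl mu a b) <=
   (2 * (R0 * V N + 1) ^+ K *
    expR (V N * (beta * u + e * (K%:R * R0) + (1 + e) * T)))%:E)%E.
Proof.
rewrite box_mass_q_bc//.
apply: le_trans (@exp_mass_integral_le_sum _ _ (X N) m0 I _ f A_ C A_bound _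
  _ _ _ _ f_sum f_bound _ prod_A_le) _.
- by move=> w; exact: expeR_ge0.
- by case=> [g|] k n //=; case: ifP => _; rewrite ?expR_ge0.
- by case=> [g|]; exact: expR_ge0.
- case=> [g|] k /=; last exact: expR_ge0.
  by case: ifP => _; [rewrite divr_ge0// exprn_ge0|exact: expR_ge0].
- exact: mass_box_q_bc.
rewrite lee_fin; set Eb := expR (V N * _).
have R0_gt0 : 0 < R0 by rewrite lt_max ltr01.
have T0 : 0 <= T by apply: le_trans (hT K); rewrite big_geq.
have slack : 0 <= e * (K%:R * R0) + (1 + e) * T.
  by rewrite addr_ge0// mulr_ge0 ?addr_ge0 ?(ltW e0)// mulr_ge0// ltW.
have term i : C i * A_bound i <= Eb.
  case: i => [g|] /=; rewrite -expRD ler_expR; last first.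
    have -> : beta * V N * B' + V N * (2 * W) = V N * (beta * u).
      by rewrite /B'; field; rewrite gt_eqF.
    by rewrite ler_pM2l// -addrA lerDl.
  have y0 k : 0 <= y g k by rewrite divr_ge0// ltW.
  rewrite entropy_upto_mu//.
  have hv := hu K y0.
  have hE : beta * E g + (entropy_upto q0 K (y g) + beta * alpha * dens_upto K (y g)) =
      beta * hyl_value K (y g).
    by rewrite /E /hyl_value; set P2 := _ / (2 * (a - b)); field; rewrite gt_eqF.
  have : beta * hyl_value K (y g) <= beta * u by rewrite ler_pM2l.
  rewrite -hE => h.
  have -> : beta * V N * E g + (V N * (entropy_upto q0 K (y g) + beta * alpha * dens_upto K (y g)) +
      e * (K%:R * (R0 * V N)) + V N * ((1 + e) * T)) =
      V N * (beta * E g + (entropy_upto q0 K (y g) + beta * alpha * dens_upto K (y g))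
        + e * (K%:R * R0) + (1 + e) * T) by ring.
  by rewrite ler_pM2l// !lerD2r.
apply: (@le_trans _ _ (\sum_(i : I) Eb)); first by apply: ler_sum.
rewrite sumr_const -[_ *+ _]mulr_natl ler_pM2r ?expR_gt0//.
rewrite [#|_|](_ : _ = (L.+1 ^ K).+1)%N; last by rewrite card_option card_ffun !card_ord.
rewrite -natr1 natrX.
have RV : 0 <= R0 * V N by rewrite mulr_ge0 ?(ltW v0) ?(ltW R0_gt0).
have LR : L.+1%:R <= R0 * V N + 1.
  by rewrite -natr1 lerD2r; have /andP[] := truncn_itv RV.
have h1 : L.+1%:R ^+ K <= (R0 * V N + 1) ^+ K.
  by rewrite lerXn2r ?nnegrE ?addr_ge0.
have h2 : 1 <= (R0 * V N + 1) ^+ K by rewrite exprn_ege1// lerDr.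
lra.
Qed.

End Volume.

Lemma hyl_pressure_le (c : R) : u < c ->
  \forall N \near \oo, (bc_pressure X (H_hyl mu a b) N <= c%:E)%E.
Proof.
move=> uc; pose g := beta * (c - u).
have g0 : 0 < g by rewrite mulr_gt0// subr_gt0.
(* The margin [g] is spent in quarters: the tail beyond [K], where 1 + e <= 2 doubles g / 8; the
   error [e] on the [K] short lengths; and the number of configurations. [K] is fixed before [e],
   and both before N. *)
have [K hK] : exists K, forall M, \sum_(K <= k < M) q0 k <= g / 8.
  have h : ((W - g / 8)%:E < mass q0)%E.
    rewrite -[ltRHS]fineK ?mass_q_free_fin// lte_fin ltrBlDr ltrDl divr_gt0//.
  have [K _ /(_ K (leqnn _)) hK] := nneseries_partial_gt (fun k => ltW (q_free_gt0 d beta0 0 k)) h.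
  exists K => M; have [MK|KM] := leqP M K; first by rewrite big_geq// divr_ge0// ltW.
  have := q_free_mass_partial_le d0 beta0 M (lexx 0).
  by rewrite (@big_cat_nat _ _ _ K)//= 1?ltnW// -/W; lra.
have R0_gt0 : 0 < R0 by rewrite lt_max ltr01.
pose e := Num.min 1 (g / 4 / (K%:R * R0 + 1)).
have KR0 : 0 < K%:R * R0 + 1 by rewrite ltr_wpDl// mulr_ge0// ltW.
have e0 : 0 < e by rewrite lt_min ltr01 !divr_gt0.
have e1 : e <= 1 by rewrite ge_min lexx.
have eK : e * (K%:R * R0) <= g / 4.
  have : e * (K%:R * R0 + 1) <= g / 4 by rewrite -ler_pdivlMr// ge_min lexx orbT.
  lra.
have hq := q_bc_le_near beta0 hDir e0.
have v0 := box_vol_gt0_near R d.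
(* Equals (2 + 2 K sqrt (R0 V + 1)) / V, a bound per volume for the logarithm of the polynomial
   prefactor, using ln Y <= 2 sqrt Y. It is written in powers of 1 / V so that its limit is
   immediate. *)
pose G N := 2 * (V N)^-1 + K%:R * 2 * Num.sqrt (R0 * (V N)^-1 + (V N)^-1 ^+ 2).
have hlim : G N @[N --> \oo] --> (0 : R).
  have i1 := @box_vol_inv_cvg R d d0.
  have i2 : Num.sqrt (R0 * (V N)^-1 + (V N)^-1 ^+ 2) @[N --> \oo] --> (0 : R).
    rewrite -[X in _ --> X]sqrtr0; apply: continuous_cvg; first exact: sqrt_continuous.
    have := cvgD (cvgM (cvg_cst R0) i1) (@cvg_exprn _ _ _ 2 i1).
    by rewrite mulr0 expr0n addr0; apply.
  have := cvgD (cvgM (cvg_cst (2 : R)) i1) (cvgM (cvg_cst (K%:R * 2 : R)) i2).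
  by rewrite !mulr0 addr0; apply.
move/cvgr0Pnorm_le : hlim => /(_ (g / 4)); rewrite divr_gt0// => /(_ isT) hlim.
near=> N.
have N0 : (0 < N)%N by near: N; exists 1%N.
have qN k : q_bc bc gDir N beta 0 k <= (1 + e) * q0 k by move: k; near: N.
have vN : 0 < V N by near: N.
have hl : `|(2 + K%:R * (2 * Num.sqrt (R0 * V N + 1))) / V N| <= g / 4.
  rewrite (_ : _ / V N = G N); first by near: N.
  rewrite /G (_ : R0 * (V N)^-1 + _ = (R0 * V N + 1) * (V N)^-1 ^+ 2); last first.
    by field; rewrite gt_eqF.
  rewrite [in RHS]sqrtrM ?addr_ge0 ?mulr_ge0 ?(ltW R0_gt0) ?(ltW vN)//.
  by rewrite sqrtr_sqr ger0_norm ?invr_ge0 ?(ltW vN)//; ring.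
have Zle := hyl_partition_le N0 e0 e1 qN hK.
set Y := R0 * V N + 1 in Zle hl.
have Y0 : 0 < Y by rewrite ltr_wpDl// mulr_ge0// ltW.
set ex := V N * _ in Zle.
have pe : 2 * Y ^+ K * expR ex <= expR (2 + K%:R * (2 * Num.sqrt Y) + ex).
  rewrite expRD ler_pM2r ?expR_gt0// expRD; apply: ler_pM.
  - by [].
  - by rewrite exprn_ge0// ltW.
  - by apply: le_trans (expR_ge1Dx 2); lra.
  - rewrite mulrC expRM_natr lerXn2r ?nnegrE ?expR_ge0 ?(ltW Y0)//.
    by rewrite -[leLHS]lnK ?posrE// ler_expR ln_le_sqrt.
have Z' : (expeR ((V N)%:E * mass (q N alpha)) *
   partition_function (X N) (V N) beta (H_hyl mu a b) <=
   (expR (2 + K%:R * (2 * Num.sqrt Y) + ex))%:E)%E.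
  by apply: le_trans Zle _; rewrite lee_fin.
have Z0 := partition_mul_ge0 X (H_hyl mu a b) N.
apply: le_trans (pressure_of_le d beta0 N0 Z0 Z') _.
rewrite lee_fin ler_pdivrMr ?mulr_gt0//.
move: hl; rewrite ger0_norm; last first.
  by rewrite divr_ge0 ?(ltW vN)// addr_ge0// mulr_ge0// mulr_ge0// sqrtr_ge0.
rewrite ler_pdivrMr// => hl.
have : ex <= V N * (beta * u + g / 4 + g / 4).
  rewrite ler_pM2l// lerD// ?lerD2l//.
  have : (1 + e) * (g / 8) <= 2 * (g / 8).
    by rewrite ler_pM2r ?divr_gt0// -[2]/(1 + 1) lerD2l.
  lra.
set S2 := 2 + _ in hl *; have -> : c * (beta * V N) = V N * (beta * u + g) by rewrite /g; ring.
have : V N * (beta * u + g) = V N * (beta * u + g / 4 + g / 4) + g / 2 * V N by field.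
have : 0 <= g / 4 * V N by rewrite mulr_ge0 ?divr_ge0// ltW.
lra.
Unshelve. all: by end_near. Qed.
End HylUpperBound.

(** * The self-consistent density *)

Section DeltaStar.
Variables (R : realType) (d : nat) (beta : R).
Hypotheses (d0 : (0 < d)%N) (beta0 : 0 < beta).
Local Notation q0 := (q_free d beta 0).

Variables (m a : R).

Let term (r : R) k : R :=
  k.+1%:R * q0 k * expR (beta * k.+1%:R * Num.min (m - a * r) 0).

Let G (r : R) : \bar R := (\sum_(0 <= k <oo) (term r k)%:E)%E.

Let term_ge0 r k : 0 <= term r k.
Proof.
rewrite mulr_ge0 ?expR_ge0// mulr_ge0//.
by rewrite ltW// q_free_gt0.
Qed.

Lemma delta_star_eqE r : delta_star_eq d beta m a r%:E = (r%:E = G r).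
Proof.
rewrite /delta_star_eq /G; congr (_ = _); apply: eq_eseriesr => k _.
by rewrite -EFinM -EFinB -EFin_min -EFinM.
Qed.

Lemma delta_star_eq_low r : 0 <= m - a * r ->
  delta_star_eq d beta m a r%:E = (r%:E = dens q0).
Proof.
move=> h; rewrite delta_star_eqE /G; congr (_ = _); apply: eq_eseriesr => k _.
by rewrite /term min_r// mulr0 expR0 mulr1.
Qed.

Lemma delta_star_eq_high r : m - a * r <= 0 ->
  delta_star_eq d beta m a r%:E = (r%:E = dens (q_free d beta (m - a * r))).
Proof.
move=> h; rewrite delta_star_eqE /G; congr (_ = _); apply: eq_eseriesr => k _.
rewrite /term min_l//.
rewrite (q_freeE _ beta0 (m - a * r)) (q_freeE _ beta0 0) mulr0 mul0r expR0 mul1r.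
by congr EFin; rewrite -mulrA; congr (_ * _); rewrite mulrC; congr (expR _ * _); ring.
Qed.

Hypothesis a0 : 0 < a.

Let term_le r1 r2 k : r1 <= r2 -> term r2 k <= term r1 k.
Proof.
move=> r12; apply: ler_wpM2l; first by rewrite mulr_ge0// ltW// q_free_gt0.
rewrite ler_expR; apply: ler_wpM2l; first by rewrite mulr_ge0// ltW.
rewrite le_min !ge_min lexx orbT andbT.
by rewrite lerD2l lerN2 ler_pM2l// r12.
Qed.

Let G_le r1 r2 : r1 <= r2 -> (G r2 <= G r1)%E.
Proof.
move=> r12; apply: lee_nneseries => k _; first by rewrite lee_fin.
by rewrite lee_fin term_le.
Qed.

(* [x exp (- c x) <= 1 / c] turns the weight [k] into summability. *)
Let term_dom (g r : R) k : 0 < g -> m - a * r <= - g -> term r k <= (beta * g)^-1 * q0 k.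
Proof.
move=> g0 h.
have bg : 0 < beta * g by rewrite mulr_gt0.
have k0 : 0 < k.+1%:R :> R by rewrite ltr0n.
rewrite /term mulrAC ler_pM2r ?q_free_gt0//.
apply: (@le_trans _ _ (k.+1%:R * expR (- (beta * g * k.+1%:R)))).
  apply: ler_wpM2l => //; rewrite ler_expR.
  have -> : - (beta * g * k.+1%:R) = beta * k.+1%:R * (- g) by ring.
  by rewrite ler_pM2l ?mulr_gt0// ge_min h.
rewrite expRN ler_pdivrMr ?expR_gt0// ler_pdivlMl// .
by apply: le_trans (expR_ge1Dx _); rewrite lerDr.
Qed.

Let Q0 := fine (mass q0).

Let G_fin (g r : R) : 0 < g -> m - a * r <= - g -> (G r <= ((beta * g)^-1 * Q0)%:E)%E.
Proof.
move=> g0 h; apply: nneseries_partial_le => // n.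
apply: (@le_trans _ _ (\sum_(0 <= k < n) (beta * g)^-1 * q0 k)).
  by apply: ler_sum => k _; exact: term_dom.
by rewrite -mulr_sumr ler_pM2l ?invr_gt0 ?mulr_gt0// q_free_mass_partial_le.
Qed.

Let G_upto K r := \sum_(0 <= k < K) term r k.

Let continuous_term k : continuous (term ^~ k).
Proof.
have h r : {for r, continuous ((fun r => m - a * r) \min cst 0)}.
  apply: continuous_min; last exact: cvg_cst.
  by apply: cvgB; [exact: cvg_cst|apply: cvgM; [exact: cvg_cst|exact: cvg_id]].
move=> r; rewrite /continuous_at /term; apply: cvgM; first exact: cvg_cst.
apply: continuous_cvg; first exact: continuous_expR.
by apply: cvgM; [exact: cvg_cst|exact: h].
Qed.

Let continuous_G_upto K : continuous (G_upto K).
Proof.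
move=> r; rewrite /continuous_at /G_upto; elim: K => [|K IHK].
  by under eq_cvg do rewrite big_geq//; rewrite big_geq//; exact: cvg_cst.
under eq_cvg do rewrite big_nat_recr//=.
by rewrite big_nat_recr//=; apply: cvgD => //; exact: continuous_term.
Qed.

Let S : set R := [set r | 0 <= r /\ (r%:E <= G r)%E].

Let S0 : S 0.
Proof. by split=> //; apply: nneseries_ge0 => k _ _; rewrite lee_fin. Qed.

Let S_ub : has_ubound S.
Proof.
(* Beyond (m + a) / a the exponent is below - a, and [G_fin] with g = a bounds [G] by the other
   constant, so r <= G r fails. *)
pose B := Num.max ((m + a) / a) ((beta * a)^-1 * Q0 + 1).
exists B => r [r0 hr]; rewrite leNgt; apply/negP; rewrite gt_max => /andP[h1 h2].
have := G_fin (r := r) a0 _; rewrite ltr_pdivrMr// in h1.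
have hm : m - a * r <= - a by lra.
move=> /(_ hm) /(le_trans hr); rewrite lee_fin; lra.
Qed.

(** [G] is nonincreasing but may take the value +oo, so the fixed point is obtained as the supremum
    s of the points with r <= G r. The partial sums are continuous, which gives G s <= s: otherwise
    a point beyond s would qualify. Conversely, if m - a s >= 0 then [G] is constant on the left of
    s; if m - a s < 0 the series converges uniformly near s. *)
Lemma delta_star_exists : exists r : R, delta_star_eq d beta m a r%:E.
Proof.
have hS : has_sup S by split; [exists 0|exact: S_ub].
exists (sup S); rewrite delta_star_eqE; set s := sup S.
have s0 : 0 <= s by exact: (ub_le_sup S_ub S0).
have le_s r : S r -> r <= s by move=> Sr; exact: (ub_le_sup S_ub Sr).
apply/eqP; rewrite eq_le; apply/andP; split; last first.
  apply: nneseries_partial_le => // K; rewrite leNgt; apply/negP => hK.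
  have : \forall r \near s, r < G_upto K r.
    have hc : {for s, continuous (fun r => G_upto K r - r)}.
      by apply: continuousB; [exact: continuous_G_upto|exact: cvg_id].
    have h0 : 0 < G_upto K s - s by rewrite subr_gt0.
    have hn : \forall r \near s, 0 < G_upto K r - r by exact: (cvgr_gt _ hc _ h0).
    by near=> r; rewrite -subr_gt0; near: r.
  move=> /nbhs_ballP[e /= e0 he].
  have hr : s + e / 2 < G_upto K (s + e / 2).
    apply: he; rewrite /ball /= opprD addNKr normrN ger0_norm ?divr_ge0 ?(ltW e0)//.
    by rewrite ltr_pdivrMr// ltr_pMr// ltr1n.
  have : S (s + e / 2).
    split; first by rewrite addr_ge0// divr_ge0// ltW.
    apply: le_trans (nneseries_partial_ge K (term_ge0 _)).
    by rewrite lee_fin ltW.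
  by move=> /le_s; rewrite gerDl leNgt divr_gt0.
have [ms|ms] := leP 0 (m - a * s).
  have GE r : r <= s -> G r = G s.
    move=> rs; apply: eq_eseriesr => k _; rewrite /term !min_r//.
    by apply: le_trans ms _; rewrite lerD2l lerN2 ler_pM2l.
  case EG : (G s) => [v| |]; last 2 first.
  - by rewrite leey.
  - have : (0 <= G s)%E by apply: nneseries_ge0 => k _ _; rewrite lee_fin.
    by rewrite EG.
  rewrite lee_fin; apply: ge_sup; first by exists 0.
  by move=> r Sr; have [_] := Sr; rewrite GE ?le_s// EG lee_fin.
rewrite leNgt; apply/negP => hlt.
pose g := - (m - a * s) / 2.
have g0 : 0 < g by rewrite divr_gt0// oppr_gt0.
have Gs0 : (0 <= G s)%E by apply: nneseries_ge0 => k _ _; rewrite lee_fin.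
have Gfin : G s \is a fin_num by rewrite ge0_fin_numE// (lt_trans hlt)// ltry.
pose v := fine (G s).
have vE : G s = v%:E by rewrite fineK.
have vs : v < s by rewrite -lte_fin -vE.
(* A point r of [S] close to s satisfies r > s - e, while G r < v + 2 e: one e from the continuity
   of the partial sum, one from the tail. As s - v = 4 e, this contradicts r <= G r. *)
pose e := (s - v) / 4.
have e0 : 0 < e by rewrite divr_gt0// subr_gt0.
have bg : 0 < beta * g by rewrite mulr_gt0.
have [K hK] : exists K, forall M, \sum_(K <= k < M) q0 k <= beta * g * e.
  have h : ((Q0 - beta * g * e)%:E < mass q0)%E.
    by rewrite -[ltRHS]fineK ?mass_q_free_fin// lte_fin ltrBlDr ltrDl mulr_gt0.
  have [K _ /(_ K (leqnn _)) hK] := nneseries_partial_gt (fun k => ltW (q_free_gt0 d beta0 0 k)) h.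
  exists K => M; have [MK|KM] := leqP M K; first by rewrite big_geq// ltW// mulr_gt0.
  have := q_free_mass_partial_le d0 beta0 M (lexx 0).
  by rewrite (@big_cat_nat _ _ _ K)//= 1?ltnW// -/Q0; lra.
have GK r : m - a * r <= - g -> (G r <= (G_upto K r + e)%:E)%E.
  move=> hr; apply: nneseries_partial_le => // M.
  have [MK|KM] := leqP M K.
    rewrite /G_upto (@big_cat_nat _ _ _ M 0 K)//= -addrA lerDl addr_ge0 ?(ltW e0)//.
    by rewrite sumr_ge0.
  rewrite (@big_cat_nat _ _ _ K)//= 1?ltnW// lerD2l.
  apply: (@le_trans _ _ (\sum_(K <= k < M) (beta * g)^-1 * q0 k)).
    by apply: ler_sum => k _; exact: term_dom.
  by rewrite -mulr_sumr ler_pdivrMl.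
have hcK : \forall r \near s, G_upto K r < v + e.
  apply: (cvgr_lt _ (@continuous_G_upto K s)).
  apply: le_lt_trans (_ : v < _); last by rewrite ltrDl.
  by rewrite -lee_fin -vE; exact: nneseries_partial_ge.
have [e1 /= e10 he1] := (nbhs_ballP _ _).1 hcK.
pose e2 := Num.min (Num.min e1 e) (g / a).
have e20 : 0 < e2 by rewrite !lt_min e10 e0 divr_gt0.
have [r Sr hr] := sup_adherent e20 hS; rewrite -/s in hr.
have rs := le_s _ Sr.
have h1 : e2 <= e1 by rewrite !ge_min lexx.
have h2 : e2 <= e by rewrite !ge_min lexx orbT.
have h3 : a * e2 <= g by rewrite -ler_pdivlMl// mulrC !ge_min lexx !orbT.
have hm : m - a * r <= - g.
  have : a * (s - r) <= a * e2 by rewrite ler_pM2l//; lra.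
  by rewrite /g in h3 *; lra.
have hGr : G_upto K r < v + e.
  by apply: he1; rewrite /ball /= ger0_norm ?subr_ge0//; lra.
have [_ /le_trans/(_ (GK r hm))] := Sr; rewrite lee_fin /e in hGr h2 *; lra.
Unshelve. all: by end_near. Qed.

(** The infinite values drop out: the series is nonnegative, and for a > 0 the value +oo would make
    every exponent -oo and the sum 0. Two finite solutions are compared by monotonicity of [G]. *)
Lemma delta_star_unique (x y : \bar R) :
  delta_star_eq d beta m a x -> delta_star_eq d beta m a y -> x = y.
Proof.
have notNy : ~ delta_star_eq d beta m a -oo%E.
  rewrite /delta_star_eq => h.
  suff : (0 <= -oo :> \bar R)%E by [].
  rewrite [leRHS]h; apply: nneseries_ge0 => k _ _.
  by rewrite mule_ge0 ?expeR_ge0// lee_fin mulr_ge0// ltW// q_free_gt0.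
have noty : ~ delta_star_eq d beta m a +oo%E.
  rewrite /delta_star_eq eseries0// => k _ _.
  by rewrite gt0_muley ?lte_fin//= min_l ?leNye// gt0_muleNy ?lte_fin ?mulr_gt0//= mule0.
case: x => [r| |] // hr; case: y => [s| |] // hs.
wlog rs : r s hr hs / r <= s.
  by move=> h; have [/h|/ltW/h h'] := leP r s; [apply|symmetry; apply: h'].
rewrite delta_star_eqE in hr; rewrite delta_star_eqE in hs.
congr EFin; apply/eqP; rewrite eq_le rs /=.
by have := G_le rs; rewrite -hr -hs lee_fin.
Qed.

End DeltaStar.

(** * Limits of the pressures *)

Section Pressures.
Variables (R : realType) (d : nat) (beta : R).
Hypotheses (d0 : (0 < d)%N) (beta0 : 0 < beta).
Variables (bc : boundary) (gDir : nat -> R -> 'rV[R]_d -> 'rV[R]_d -> R).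
Hypothesis hDir : bc = Dir -> forall (N : nat) (t : R), (0 < N)%N -> 0 < t ->
  dirichlet_density N t (gDir N t).

Local Notation V := (box_vol R d).
Local Notation q := (fun N mu => q_bc bc gDir N beta mu).
Local Notation q0 := (q_free d beta 0).

Lemma q_free_cvg mu : mu <= 0 ->
  mass_upto K (q_free d beta mu) @[K --> \oo] --> fine (mass (q_free d beta mu)).
Proof.
move=> mu0.
have := nneseries_cvg (fun k => ltW (q_free_gt0 d beta0 mu k)).
by rewrite -/(mass _) -[mass _]fineK ?mass_q_free_fin// => /fine_cvg.
Qed.

Lemma mass_q_bc_cvg mu : mu <= 0 ->
  mass (q N mu) @[N --> \oo] --> mass (q_free d beta mu).
Proof.
move=> mu0; have qN0 N k := q_bc_mu_ge0 beta0 hDir N mu k.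
apply: cvge_between => c hc.
  have [n _ /(_ n (leqnn _)) hn] :=
    nneseries_partial_gt (fun k => ltW (q_free_gt0 d beta0 mu k)) hc.
  have h : mass_upto n (q N mu) @[N --> \oo] --> mass_upto n (q_free d beta mu).
    by apply: cvg_sum_nat => k _; exact: q_bc_mu_cvg.
  have : \forall N \near \oo, c < mass_upto n (q N mu) by exact: (cvgr_gt _ h _ hn).
  apply: filterS => N hN; apply: (@le_trans _ _ (mass_upto n (q N mu))%:E).
    by rewrite lee_fin ltW.
  exact: nneseries_partial_ge.
pose Q := fine (mass (q_free d beta mu)).
have Q0 : 0 <= Q by rewrite fine_ge0// nneseries_ge0// => k _ _; rewrite lee_fin ltW// q_free_gt0.
have QE : mass (q_free d beta mu) = Q%:E by rewrite fineK// mass_q_free_fin.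
have Qc : 0 < c - Q by rewrite subr_gt0 -lte_fin -QE.
have e0 : 0 < (c - Q) / (Q + 1) by rewrite divr_gt0// ltr_wpDl.
have := q_bc_le_near beta0 hDir e0; apply: filterS => N hN.
apply: (nneseries_partial_le (qN0 N)) => n.
apply: (@le_trans _ _ ((1 + (c - Q) / (Q + 1)) * mass_upto n (q_free d beta mu))).
  rewrite /mass_upto mulr_sumr; apply: ler_sum => k _.
  rewrite /= q_bc_mu (q_freeE _ beta0 mu) mulrCA ler_pM2l ?expR_gt0//.
  by apply: le_trans (hN k) _; rewrite q_freeE// mulr0 mul0r expR0 mul1r.
apply: (@le_trans _ _ ((1 + (c - Q) / (Q + 1)) * Q)).
  by rewrite ler_pM2l ?addr_gt0// q_free_mass_partial_le.
rewrite mulrDl mul1r -lerBrDl mulrAC ler_pdivrMr ?ltr_wpDl//.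
by rewrite ler_pM2l// lerDl.
Qed.

Lemma ideal_pressure_cvg mu : mu <= 0 ->
  ((beta * V N)^-1%:E * lne (expeR ((V N)%:E * mass (q N mu))))%E @[N --> \oo]
    --> ideal_pressure d beta mu.
Proof.
move=> mu0; rewrite ideal_pressureE//.
have : (beta^-1%:E * mass (q N mu))%E @[N --> \oo] --> (beta^-1%:E * mass (q_free d beta mu))%E.
  by apply: cvgeZl => //; exact: mass_q_bc_cvg.
apply: cvg_trans; apply: near_eq_cvg; apply: filterS (box_vol_gt0_near R d) => N vN.
by rewrite expeRK muleA -EFinM invfM -mulrA mulVf ?mulr1// gt_eqF.
Qed.

Section Gas.
Variables (alpha : R).
Hypothesis alpha0 : alpha <= 0.
Variable X : forall N, cycle_counts (fun k => V N * q N alpha k).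

Lemma entropy_upto_tilt (w : R) K (x y : nat -> R) :
  (forall k, 0 < y k) -> (forall k, x k = expR (- w) * y k) ->
  entropy_upto y K x = (1 + w) * mass_upto K x.
Proof.
move=> y0 xE; rewrite /mass_upto mulr_sumr; apply: eq_bigr => k _.
by rewrite {2}xE mulfK ?gt_eqF// expRK opprK mulrC.
Qed.

Definition cut (K : nat) (x : nat -> R) k : R := if (k < K)%N then x k else 0.

Lemma cut_ge0 K x : (forall k, 0 <= x k) -> forall k, 0 <= cut K x k.
Proof. by move=> x0 k; rewrite /cut; case: ifP. Qed.

Lemma cut_out K x k : (K <= k)%N -> cut K x k = 0.
Proof. by rewrite /cut ltnNge => ->. Qed.

Lemma sum_cut (F : nat -> R -> R) K x :
  \sum_(0 <= k < K) F k (cut K x k) = \sum_(0 <= k < K) F k (x k).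
Proof. by rewrite !big_nat; apply: eq_bigr => k /andP[_ kK]; rewrite /cut kK. Qed.

(** [F] is the optimal total cycle density and w = a beta F its self-consistency equation,
    equivalent to w exp(w) = a beta Q. The upper bound is tilted at t = F, the lower one uses the
    densities exp(- w) q_k. Keeping w and [F] as parameters includes a = 0, with w = 0 and F = Q. *)
Lemma cmf_pressure_cvg a (w Q F : R) : 0 <= a ->
  Q = fine (mass (q_free d beta alpha)) -> F = expR (- w) * Q -> a * beta * F = w ->
  bc_pressure X (H_cmf a) N @[N --> \oo] --> (a / 2 * F ^+ 2 + beta^-1 * F)%:E.
Proof.
move=> a0 QE FE wE.
have F0 : 0 <= F by rewrite FE mulr_ge0 ?expR_ge0// QE q_free_mass_ge0.
apply: cvge_between => c; rewrite lte_fin => hc; last first.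
  apply: (@cmf_pressure_le _ _ _ d0 beta0 _ _ hDir _ alpha0 X a F) => //.
  by rewrite -QE [beta * a]mulrC wE -FE.
pose x k := expR (- w) * q_free d beta alpha k.
have x0 k : 0 <= x k by rewrite mulr_ge0 ?expR_ge0// ltW// q_free_gt0.
have h : beta^-1 * ((1 + w) * mass_upto K x) - a / 2 * mass_upto K x ^+ 2 @[K --> \oo]
    --> a / 2 * F ^+ 2 + beta^-1 * F.
  have hx : mass_upto K x @[K --> \oo] --> F.
    rewrite /mass_upto; under eq_cvg do rewrite -mulr_sumr.
    by rewrite FE QE; apply: cvgM; [exact: cvg_cst|exact: q_free_cvg].
  have -> : a / 2 * F ^+ 2 + beta^-1 * F = beta^-1 * ((1 + w) * F) - a / 2 * F ^+ 2.
    by rewrite -wE; field; rewrite gt_eqF.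
  apply: cvgB; last by apply: cvgM; [exact: cvg_cst|exact: (@cvg_exprn _ _ _ 2)].
  apply: cvgM; first exact: cvg_cst.
  by apply: cvgM; first exact: cvg_cst.
have [K _ /(_ K (leqnn _)) hK] : \forall K \near \oo,
    c < beta^-1 * ((1 + w) * mass_upto K x) - a / 2 * mass_upto K x ^+ 2.
  exact: (cvgr_gt _ h _ hc).
apply: (@cmf_pressure_ge _ _ _ d0 beta0 _ _ hDir _ alpha0 X a c (cut K x) K).
- exact: cut_ge0.
- by move=> k; exact: cut_out.
rewrite /mass_upto (sum_cut (fun _ r => r)) /entropy_upto.
rewrite (sum_cut (fun k r => r * (1 - ln (r / q_free d beta alpha k)))).
rewrite -/(entropy_upto (q_free d beta alpha) K x) (@entropy_upto_tilt w)// => k.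
exact: q_free_gt0.
Qed.

End Gas.
End Pressures.

(** For z >= 0 the root is bracketed by [0, z] because z exp(z) >= z; its existence rules out the
    default value of [xget]. *)
Lemma lambertW0P (R : realType) (z : R) : 0 <= z ->
  lambertW0 z * expR (lambertW0 z) = z.
Proof.
move=> z0.
have [w] : exists2 w : R, w \in `[0, z] & w * expR w = z.
  apply: (@IVT _ (fun w => w * expR w)) => //.
    apply: continuous_subspaceT => w; apply: cvgM; first exact: cvg_id.
    exact: continuous_expR.
  rewrite !mul0r; rewrite minEle maxEle mulr_ge0 ?expR_ge0// z0 /=.
  by rewrite ler_peMr// -[leLHS]expR0 ler_expR.
rewrite in_itv /= => /andP[w0 _] wE.
rewrite /lambertW0; case: xgetP => [_ -> []//|/(_ w)]; case; split=> //.
by apply: le_trans w0; rewrite oppr_le0.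
Qed.

(** * The PMF limit below and above the critical density *)

Section PmfPressure.
Variables (R : realType) (d : nat) (beta : R).
Hypotheses (d0 : (0 < d)%N) (beta0 : 0 < beta).
Variables (bc : boundary) (gDir : nat -> R -> 'rV[R]_d -> 'rV[R]_d -> R).
Hypothesis hDir : bc = Dir -> forall (N : nat) (t : R), (0 < N)%N -> 0 < t ->
  dirichlet_density N t (gDir N t).

Local Notation V := (box_vol R d).
Local Notation q := (fun N mu => q_bc bc gDir N beta mu).
Local Notation q0 := (q_free d beta 0).

Variables (alpha : R).
Hypothesis alpha0 : alpha <= 0.
Variable X : forall N, cycle_counts (fun k => V N * q N alpha k).

Lemma entropy_upto_free (nu : R) K :
  entropy_upto q0 K (q_free d beta nu) =
  mass_upto K (q_free d beta nu) - beta * nu * dens_upto K (q_free d beta nu).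
Proof.
rewrite /mass_upto /dens_upto mulr_sumr -sumrB; apply: eq_bigr => k _.
have -> : ln (q_free d beta nu k / q0 k) = beta * nu * k.+1%:R.
  rewrite (q_freeE _ beta0 nu) (q_freeE _ beta0 0) mulr0 mul0r expR0 mul1r mulfK ?expRK//.
  by rewrite gt_eqF// divr_gt0// heat_diag_gt0// mulr_gt0.
ring.
Qed.

Lemma pmf_pressure_ge_free (mu a s v c : R) K : mu + alpha - a * s <= 0 -> 0 <= c ->
  v < beta^-1 * mass_upto K (q_free d beta (mu + alpha - a * s)) + a / 2 * s ^+ 2
      - a / 2 * (dens_upto K (q_free d beta (mu + alpha - a * s)) + c - s) ^+ 2
      + (mu + alpha - a * s) * c ->
  \forall N \near \oo, (v%:E <= bc_pressure X (H_pmf mu a) N)%E.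
Proof.
set nu := mu + alpha - a * s => nu0 c0 hv.
have x0 k : 0 <= q_free d beta nu k by rewrite ltW// q_free_gt0.
have -> : H_pmf mu a = H_hyl mu a 0 by apply/funext => x; exact: H_pmfE.
apply: (@hyl_pressure_ge_condensate _ _ _ d0 beta0 _ _ hDir _ alpha0 X mu a 0 v c
  (cut K (q_free d beta nu)) K) => //.
- exact: cut_ge0.
- by move=> k; exact: cut_out.
rewrite /entropy_upto (sum_cut (fun k r => r * (1 - ln (r / q0 k)))).
rewrite /dens_upto (sum_cut (fun k r => k.+1%:R * r)).
rewrite -/(entropy_upto q0 K _) entropy_upto_free -/(dens_upto K _).
move: hv; set D := dens_upto _ _; set M := mass_upto _ _ => hv; apply: lt_le_trans hv _.
have -> : mu + alpha = nu + a * s by rewrite /nu subrK.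
by rewrite le_eqVlt; apply/orP; left; apply/eqP; field; rewrite gt_eqF.
Qed.

(** The trial state is the ideal gas at the tilted chemical potential, cut at K, plus a condensate
    c. Expanding about [s], it misses the upper bound by the square of its density defect and by the
    cost of c; the hypothesis asks that these two be small together. *)
Lemma pmf_pressure_cvg (mu a s : R) : 0 <= a -> mu + alpha - a * s <= 0 ->
  (forall e, 0 < e -> \forall K \near \oo, exists2 c, 0 <= c &
     a / 2 * (dens_upto K (q_free d beta (mu + alpha - a * s)) + c - s) ^+ 2
     - (mu + alpha - a * s) * c <= e) ->
  bc_pressure X (H_pmf mu a) N @[N --> \oo] -->
  (a / 2 * s ^+ 2 + beta^-1 * fine (mass (q_free d beta (mu + alpha - a * s))))%:E.
Proof.
move=> a0 nu0 hs; apply: cvge_between => v; rewrite lte_fin; last first.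
  by apply: pmf_pressure_le => //; rewrite -subr_le0.
set T := _ + _ => hv; pose e := (T - v) / 2.
have e0 : 0 < e by rewrite divr_gt0// subr_gt0.
have h1 : \forall K \near \oo,
    T - e < a / 2 * s ^+ 2 + beta^-1 * mass_upto K (q_free d beta (mu + alpha - a * s)).
  apply: (cvgr_gt T); last by rewrite ltrBlDr ltrDl.
  apply: cvgD; first exact: cvg_cst.
  by apply: cvgM; [exact: cvg_cst|exact: q_free_cvg].
have [K _ /(_ K (leqnn _))[hT [c c0 hc]]] := filterI h1 (hs e e0).
apply: (@pmf_pressure_ge_free mu a s v c K) => //.
by rewrite /e in hT hc; lra.
Qed.

Lemma dens_q_free_cvg (nu r : R) : r%:E = dens (q_free d beta nu) ->
  dens_upto K (q_free d beta nu) @[K --> \oo] --> r.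
Proof.
move=> rE; have h k : 0 <= k.+1%:R * q_free d beta nu k.
  by rewrite mulr_ge0// ltW// q_free_gt0.
by have := nneseries_cvg h; rewrite -/(dens _) -rE => /fine_cvg.
Qed.

(** No condensate is required: the truncated density itself tends to [s]. The density equation is
    assumed only for a > 0, since for a = 0 the square disappears and the density at chemical
    potential 0 may be infinite. *)
Lemma pmf_pressure_cvg_subcritical (mu a s : R) : 0 <= a -> mu + alpha - a * s <= 0 ->
  (0 < a -> s%:E = dens (q_free d beta (mu + alpha - a * s))) ->
  bc_pressure X (H_pmf mu a) N @[N --> \oo] -->
  (a / 2 * s ^+ 2 + beta^-1 * fine (mass (q_free d beta (mu + alpha - a * s))))%:E.
Proof.
move=> a0 nu0 hs; apply: pmf_pressure_cvg => // e e0.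
have [a_eq0|a_gt0] := leP a 0.
  have -> : a = 0 by apply/eqP; rewrite eq_le a_eq0.
  by near=> K; exists 0 => //; rewrite !mul0r mulr0 subr0 ltW.
have h : a / 2 * (dens_upto K (q_free d beta (mu + alpha - a * s)) - s) ^+ 2
    @[K --> \oo] --> 0.
  have -> : 0 = a / 2 * (s - s) ^+ 2 by rewrite subrr expr0n mulr0.
  apply: cvgM; first exact: cvg_cst.
  apply: (@cvg_exprn _ _ _ 2); apply: cvgB; last exact: cvg_cst.
  by apply: dens_q_free_cvg; exact: hs.
have : \forall K \near \oo,
    a / 2 * (dens_upto K (q_free d beta (mu + alpha - a * s)) - s) ^+ 2 < e.
  exact: (cvgr_lt _ h).
by apply: filterS => K /ltW hK; exists 0 => //; rewrite addr0 mulr0 subr0.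
Unshelve. all: by end_near. Qed.

Lemma pmf_pressure_cvg_supercritical (mu a s : R) : 0 <= a -> mu + alpha = a * s ->
  (0 < a -> (dens q0 <= s%:E)%E) ->
  bc_pressure X (H_pmf mu a) N @[N --> \oo] -->
  (a / 2 * s ^+ 2 + beta^-1 * fine (mass q0))%:E.
Proof.
move=> a0 mas hs.
have nuE : mu + alpha - a * s = 0 by rewrite mas subrr.
rewrite -nuE; apply: pmf_pressure_cvg => //; first by rewrite nuE.
move=> e e0; have [a_eq0|a_gt0] := leP a 0.
  have -> : a = 0 by apply/eqP; rewrite eq_le a_eq0.
  by near=> K; exists 0 => //; rewrite !mul0r mulr0 subr0 ltW.
(* The condensate takes up the excess over the critical density together with the density beyond K,
   so the square vanishes for every K; at chemical potential 0 it costs nothing. *)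
near=> K; exists (s - dens_upto K q0).
  rewrite subr_ge0 -lee_fin; apply: le_trans (hs a_gt0).
  by apply: nneseries_partial_ge => k; rewrite mulr_ge0// ltW// q_free_gt0.
by rewrite nuE [_ + (s - _)]addrC subrK subrr expr0n mulr0 mul0r subrr ltW.
Unshelve. all: by end_near. Qed.

Lemma pmf_pressure_dvg (mu : R) : 0 < mu + alpha ->
  bc_pressure X (H_pmf mu 0) N @[N --> \oo] --> (+oo : \bar R)%E.
Proof.
move=> m0; apply: cvge_between => v hv; last by rewrite ltNge leey in hv.
have -> : H_pmf mu 0 = H_hyl mu 0 0 by apply/funext => x; exact: H_pmfE.
(* A pure condensate: without repulsion its gain (mu + alpha) c, here |v| + 1, is unbounded. *)
apply: (@hyl_pressure_ge_condensate _ _ _ d0 beta0 _ _ hDir _ alpha0 X mu 0 0 v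
  ((`|v| + 1) / (mu + alpha)) (fun=> 0) 0%N) => //.
  by rewrite divr_ge0 ?(ltW m0)// addr_ge0.
rewrite /entropy_upto /dens_upto !big_geq// !mul0r mulr0 !add0r subr0 addr0.
rewrite mulrC divfK ?gt_eqF//; apply: le_lt_trans (ler_norm v) _.
by rewrite ltrDl.
Qed.

(** Otherwise the minimum in the equation is 0, so r is the critical density and m > a r contradicts
    the assumption. Below criticality the negative part in the exponent can thus be omitted. *)
Lemma delta_star_subcritical (m a r : R) : 0 < a -> delta_star_eq d beta m a r%:E ->
  (m%:E <= a%:E * rho_c d beta)%E -> m - a * r <= 0.
Proof.
move=> a0 hr; rewrite rho_cE// => hm; rewrite leNgt; apply/negP => hlt.
move: hr; rewrite delta_star_eq_low// ?ltW// => rE.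
by move: hm; rewrite -rE -EFinM lee_fin; lra.
Qed.

End PmfPressure.

(** * The HYL variational problem: from l1 to finitely supported sequences *)

Section HylPressure.
Variables (R : realType) (d : nat) (beta : R).
Hypotheses (d0 : (0 < d)%N) (beta0 : 0 < beta).
Local Notation q0 := (q_free d beta 0).
Let Q0 := fine (mass q0).

(** Adding q_k makes every summand nonnegative, by 1 + t <= exp(t), so that I becomes a nonnegative
    series with partial sums converging in [0, +oo]. *)
Let rate (x : nat -> R) k := x k * (ln (x k / q0 k) - 1) + q0 k.

Lemma rate_ge0 x k : 0 <= x k -> 0 <= rate x k.
Proof.
rewrite le_eqVlt => /predU1P[xk|xk]; first by rewrite /rate -xk mul0r add0r ltW// q_free_gt0.
rewrite /rate; have := q_free_gt0 d beta0 0 k; move: (q0 k) => c c0.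
have pos : x k / c \in Num.pos by rewrite posrE divr_gt0.
have := expR_ge1Dx (- ln (x k / c)).
by rewrite expRN (lnK pos) invf_div ler_pdivlMr//; lra.
Qed.

Lemma entropy_upto_rate K x :
  entropy_upto q0 K x = mass_upto K q0 - \sum_(0 <= k < K) rate x k.
Proof.
rewrite -sumrB; apply: eq_bigr => k _; rewrite /rate; ring.
Qed.

Lemma rate_IE x : l1_pos x -> rate_I d beta x = (\sum_(0 <= k <oo) (rate x k)%:E)%E.
Proof.
move=> xl; have [_ x0] := xl; rewrite /rate_I asboolT//.
set h := (\sum_(0 <= k <oo) (rate x k)%:E)%E.
have hq : (mass q0 \is a fin_num) by rewrite mass_q_free_fin.
have -> : (\sum_(0 <= k <oo) (x k * (ln (x k / q0 k) - 1))%:E = h - mass q0)%E.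
  apply/cvg_lim => //.
  have hdef : (h +? - mass q0)%E by rewrite fin_num_adde_defl// fin_numN.
  have hcvg : ((\sum_(0 <= k < n) rate x k)%:E - (mass_upto n q0)%:E)%E @[n --> \oo]
      --> (h - mass q0)%E.
    apply: (cvgeB hdef); apply: nneseries_cvg => k; first exact: rate_ge0.
    by rewrite ltW// q_free_gt0.
  rewrite (_ : (fun n => _) = (fun n => ((\sum_(0 <= k < n) rate x k)%:E -
    (mass_upto n q0)%:E)%E))//; apply/funext => n.
  rewrite sumEFin -EFinB; congr EFin; rewrite -sumrB; apply: eq_bigr => k _.
  by rewrite /rate addrK.
by rewrite subeK.
Qed.

Variables (m a b : R).
Let J x : \bar R := (rate_I d beta x + beta%:E * H_hyl_lsc m a b x)%E.
Let val K x := beta^-1 * entropy_upto q0 K x + m * dens_upto K x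
  - a / 2 * dens_upto K x ^+ 2 + b / 2 * sq_upto K x
  + Num.max (m - a * dens_upto K x) 0 ^+ 2 / (2 * (a - b)).

Lemma free_energy_finsupp K x : (forall k, 0 <= x k) ->
  (forall k, (K <= k)%N -> x k = 0) ->
  J x = (Q0 - beta * val K x)%:E.
Proof.
move=> x0 xK.
have xl : l1_pos x.
  split=> //; rewrite /l1 (@eseries_finsupp _ _ K) ?ltry// => k /xK ->.
  by rewrite normr0.
rewrite /J /rate_I asboolT// /H_hyl_lsc (H_hyl_finsupp _ _ _ xK) (dens_finsupp xK) /=.
rewrite (@eseries_finsupp _ _ K); last by move=> k /xK ->; rewrite mul0r.
rewrite -[mass q0]fineK ?mass_q_free_fin// -/Q0 -EFinB -EFinM -!EFinD; congr EFin.
have -> : \sum_(0 <= k < K) x k * (ln (x k / q0 k) - 1) = - entropy_upto q0 K x.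
  by rewrite -sumrN; apply: eq_bigr => k _; ring.
rewrite /val; set P := _ / (2 * (a - b)).
by field; rewrite gt_eqF.
Qed.

Lemma free_energy_cut K x : (forall k, 0 <= x k) ->
  J (cut K x) = (Q0 - beta * val K x)%:E.
Proof.
move=> x0; rewrite (@free_energy_finsupp K); last 2 first.
- exact: cut_ge0.
- by move=> k; exact: cut_out.
rewrite /val /entropy_upto (sum_cut (fun k r => r * (1 - ln (r / q0 k)))).
rewrite /dens_upto (sum_cut (fun k r => k.+1%:R * r)).
by rewrite /sq_upto (sum_cut (fun k r => k.+1%:R ^+ 2 * r ^+ 2)).
Qed.

Lemma dens_ge0 (x : nat -> R) : (forall k, 0 <= x k) -> (0 <= dens x)%E.
Proof. by move=> x0; apply: nneseries_ge0 => k _ _; rewrite lee_fin mulr_ge0. Qed.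

Lemma sq_upto_cvg x (r : R) : (forall k, 0 <= x k) -> dens x = r%:E ->
  sq_upto K x @[K --> \oo] --> fine (\sum_(0 <= k <oo) (k.+1%:R ^+ 2 * x k ^+ 2)%:E)%E.
Proof.
move=> x0 Dx; have h k : 0 <= k.+1%:R ^+ 2 * x k ^+ 2 by rewrite mulr_ge0// sqr_ge0.
have kx0 k : 0 <= k.+1%:R * x k by rewrite mulr_ge0.
have hle : (\sum_(0 <= k <oo) (k.+1%:R ^+ 2 * x k ^+ 2)%:E <= (r ^+ 2)%:E)%E.
  apply: nneseries_partial_le => // K.
  under eq_bigr do rewrite -exprMn.
  apply: le_trans (sum_sq_le 0 K kx0) _.
  have D0 : 0 <= \sum_(0 <= k < K) k.+1%:R * x k by exact: sumr_ge0.
  have D1 : \sum_(0 <= k < K) k.+1%:R * x k <= r.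
    by rewrite -lee_fin -Dx; exact: nneseries_partial_ge.
  by rewrite lerXn2r ?nnegrE// (le_trans D0).
have fin : (\sum_(0 <= k <oo) (k.+1%:R ^+ 2 * x k ^+ 2)%:E)%E \is a fin_num.
  rewrite ge0_fin_numE ?(le_lt_trans hle) ?ltry//.
  by apply: nneseries_ge0 => k _ _; rewrite lee_fin.
by have := nneseries_cvg h; rewrite -[X in _ --> X](fineK fin) => /fine_cvg.
Qed.

(** A value of the functional below a real number forces [x] to be nonnegative with finite rate and
    finite density. Every part of the functional then converges along the truncations, the sum of
    squares being bounded by the square of the density. *)
Lemma free_energy_approx x (v : R) : l1 x -> (J x < (Q0 - beta * v)%:E)%E ->
  exists K, (forall k, 0 <= x k) /\ v < val K x.
Proof.
move=> x1; rewrite /J /H_hyl_lsc.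
have HNy : H_hyl m a b x != -oo%E by rewrite /H_hyl; case: dens.
have [xl|xl] := pselect (l1_pos x); last first.
  rewrite /rate_I asboolF// addye//.
  by case: H_hyl HNy => [r| |]//= _; rewrite addye ?gt0_muley.
have [_ x0] := xl; have D0 := dens_ge0 x0.
have r0 : (0 <= rate_I d beta x)%E.
  by rewrite rate_IE//; apply: nneseries_ge0 => k _ _; rewrite lee_fin rate_ge0.
rewrite /H_hyl; case Dx : (dens x) D0 => [D| |]// _; last first.
  rewrite addye// gt0_muley// addey//.
  by case: rate_I r0.
rewrite -EFinB -EFinM; case Ex : (rate_I d beta x) r0 => [e| |]// _.
rewrite -EFinD lte_fin /=; set Q := fine _; set P := _ / (2 * (a - b)) => hv.
have hD : dens_upto K x @[K --> \oo] --> D.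
  have h k : 0 <= k.+1%:R * x k by rewrite mulr_ge0.
  by have := nneseries_cvg h; rewrite -/(dens x) Dx => /fine_cvg.
have hQ : sq_upto K x @[K --> \oo] --> Q by exact: (sq_upto_cvg x0 Dx).
have hE : entropy_upto q0 K x @[K --> \oo] --> Q0 - e.
  under eq_cvg do rewrite entropy_upto_rate.
  apply: cvgB; first exact: q_free_cvg.
  have := nneseries_cvg (fun k => rate_ge0 (x0 k)).
  by rewrite -rate_IE// Ex => /fine_cvg.
have hP : Num.max (m - a * dens_upto K x) 0 @[K --> \oo] --> Num.max (m - a * D) 0.
  have hc : {for D, continuous ((fun r : R => m - a * r) \max cst 0)}.
    apply: continuous_max; last exact: cvg_cst.
    by apply: cvgB; [exact: cvg_cst|apply: cvgM; [exact: cvg_cst|exact: cvg_id]].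
  exact: (continuous_cvg _ hc hD).
have hval : val K x @[K --> \oo] -->
    beta^-1 * (Q0 - e) + m * D - a / 2 * D ^+ 2 + b / 2 * Q + P.
  apply: cvgD; last first.
    by apply: cvgM; [exact: (@cvg_exprn _ _ _ 2)|exact: cvg_cst].
  apply: cvgD; last by apply: cvgM => //; exact: cvg_cst.
  apply: cvgB; last by apply: cvgM; [exact: cvg_cst|exact: (@cvg_exprn _ _ _ 2)].
  apply: cvgD; last by apply: cvgM => //; exact: cvg_cst.
  by apply: cvgM => //; exact: cvg_cst.
have [K _ /(_ K (leqnn _)) hK] : \forall K \near \oo, v < val K x.
  apply: (cvgr_gt _ hval); rewrite -(ltr_pM2l beta0).
  have -> : beta * (beta^-1 * (Q0 - e) + m * D - a / 2 * D ^+ 2 + b / 2 * Q + P) =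
     Q0 - (e + beta * (- m * D + a / 2 * D ^+ 2 - b / 2 * Q - P)).
    by field; rewrite gt_eqF.
  lra.
by exists K.
Qed.

End HylPressure.

Section HylLimit.
Variables (R : realType) (d : nat) (beta : R).
Hypotheses (d0 : (0 < d)%N) (beta0 : 0 < beta).
Variables (bc : boundary) (gDir : nat -> R -> 'rV[R]_d -> 'rV[R]_d -> R).
Hypothesis hDir : bc = Dir -> forall (N : nat) (t : R), (0 < N)%N -> 0 < t ->
  dirichlet_density N t (gDir N t).
Local Notation V := (box_vol R d).
Local Notation q := (fun N mu => q_bc bc gDir N beta mu).
Local Notation q0 := (q_free d beta 0).
Variables (alpha : R).
Hypothesis alpha0 : alpha <= 0.
Variable X : forall N, cycle_counts (fun k => V N * q N alpha k).

(* The optimal condensate density is [(mu + alpha - a D)_+ / (a - b)]. *)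
Lemma hyl_pressure_ge_value (mu a b v : R) K x : b < a -> (forall k, 0 <= x k) ->
  v < hyl_value d beta alpha mu a b K x ->
  \forall N \near \oo, (v%:E <= bc_pressure X (H_hyl mu a b) N)%E.
Proof.
move=> ba x0; rewrite /hyl_value; set D := dens_upto K x; set P := Num.max _ _ => hv.
have ab0 : 0 < a - b by rewrite subr_gt0.
have P0 : 0 <= P by rewrite le_max lexx orbT.
apply: (@hyl_pressure_ge_condensate _ _ _ d0 beta0 _ _ hDir _ alpha0 X mu a b v
  (P / (a - b)) (cut K x) K) => //.
- exact: cut_ge0.
- by move=> k; exact: cut_out.
- by rewrite divr_ge0// ltW.
rewrite /entropy_upto (sum_cut (fun k r => r * (1 - ln (r / q0 k)))).
rewrite /dens_upto (sum_cut (fun k r => k.+1%:R * r)).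
rewrite /sq_upto (sum_cut (fun k r => k.+1%:R ^+ 2 * r ^+ 2)).
rewrite -/(entropy_upto q0 K x) -/(dens_upto K x) -/(sq_upto K x) -/D.
apply: lt_le_trans hv _; rewrite le_eqVlt; apply/orP; left; apply/eqP.
have PP : P * (mu + alpha - a * D) = P ^+ 2.
  rewrite /P; have [h|h] := leP (mu + alpha - a * D) 0; first by rewrite mul0r expr0n.
  by rewrite expr2.
set E := beta^-1 * _; set L := LHS.
have -> : L = L + (P * (mu + alpha - a * D) - P ^+ 2) / (a - b).
  by rewrite PP subrr mul0r addr0.
by rewrite /L; field; rewrite gt_eqF.
Qed.

Lemma hyl_pressure_cvg (mu a b : R) : 0 <= b -> b < a ->
  bc_pressure X (H_hyl mu a b) N @[N --> \oo] -->
  (ideal_pressure d beta 0%R - beta^-1%:E *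
    ereal_inf [set rate_I d beta x + beta%:E * H_hyl_lsc (mu + alpha) a b x |
               x in [set x : nat -> R | l1 x]])%E.
Proof.
move=> b0 ba; rewrite ideal_pressureE// -[mass _]fineK ?mass_q_free_fin//.
set Q0 := fine _; set I := ereal_inf _; rewrite -EFinM.
apply: cvge_between => c hc.
  have IQ : (I < (Q0 - beta * c)%:E)%E.
    move: hc; case: I => [i| |]; last by rewrite ltNyr.
    - rewrite -EFinM -EFinB !lte_fin -(ltr_pM2l beta0) mulrBr !mulrA divff ?gt_eqF//.
      by rewrite !mul1r; lra.
    - by rewrite gt0_muley ?lte_fin ?invr_gt0//= ltNge leNye.
  have [_ [x x1 <-]] := ereal_inf_lt IQ.
  move=> /(free_energy_approx d0 beta0 x1)[K [x0 hK]].
  exact: (@hyl_pressure_ge_value mu a b c K x).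
have Ile K x : (forall k, 0 <= x k) ->
    (I <= (Q0 - beta * hyl_value d beta alpha mu a b K x)%:E)%E.
  move=> x0; apply: ereal_inf_lbound; exists (cut K x) => /=.
    rewrite /l1 (@eseries_finsupp _ _ K) ?ltry// => k Kk.
    by rewrite cut_out// normr0.
  exact: free_energy_cut.
(* The zero sequence excludes I = +oo; for I = -oo the claimed limit is +oo and no real c lies above
   it. *)
have := Ile 0%N (fun=> 0) (fun=> lexx 0).
case EI : I hc => [i| |] // hc _; last first.
  by move: hc; rewrite gt0_muleNy ?lte_fin ?invr_gt0//= ltNge leey.
move: hc; rewrite -EFinM -EFinB lte_fin => hc.
apply: (@hyl_pressure_le _ _ _ d0 beta0 _ _ hDir _ alpha0 X mu a b
  (beta^-1 * Q0 - beta^-1 * i)) => // K x x0.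
have := Ile K x x0; rewrite EI lee_fin -mulrBr ler_pdivlMl//; lra.
Qed.

End HylLimit.

(** For a = 0 the right-hand side of the equation does not depend on the unknown, as 0 times any
    extended real is 0; its value is the only solution, possibly +oo. *)
Lemma mul0_delta_star (R : realType) (d : nat) (beta m : R) : exists delta,
  unique (delta_star_eq d beta m 0) delta.
Proof.
exists (\sum_(0 <= k <oo) (k.+1%:R * q_free d beta 0 k)%:E *
  expeR ((beta * k.+1%:R)%:E * Order.min (m%:E - 0) 0))%E.
rewrite /delta_star_eq /unique; split; last move=> y ->;
  by apply: eq_eseriesr => k _; rewrite mul0e.
Qed.

Theorem theorem2p8 (R : realType) (d : nat) (beta : R) (bc : boundary)
    (gDir : nat -> R -> 'rV[R]_d -> 'rV[R]_d -> R) :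
  (0 < d)%N -> 0 < beta ->
  (bc = Dir -> forall (N : nat) (t : R), (0 < N)%N -> 0 < t ->
     dirichlet_density N t (gDir N t)) ->
  let V := box_vol R d in
  let q := fun (N : nat) (mu : R) => q_bc bc gDir N beta mu in
  (* (1 / (beta |Lambda_N|)) log Z *)
  let pressure := fun (N : nat) (Z : \bar R) =>
    ((beta * V N)^-1%:E * lne Z)%E in
  (* partition function e^(|Lambda_N| qbar) of the ideal gas *)
  let Zideal := fun (N : nat) (mu : R) =>
    expeR ((V N)%:E * mass (q N mu))%E in
  [/\ (* (i) *)
      forall mu : R, mu <= 0 ->
        pressure N (Zideal N mu) @[N --> \oo] --> ideal_pressure d beta mu,

      (* (ii) *)
      forall (mu a : R), mu <= 0 -> 0 <= a ->
        forall X : (forall N : nat, cycle_counts (fun k => V N * q N mu k)),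
        pressure N (Zideal N mu *
            partition_function (X N) (V N) beta (H_cmf a))%E
          @[N --> \oo] --> cmf_pressure d beta mu a,

      (* (iii) *)
      forall (mu alpha a : R), alpha <= 0 -> 0 <= a ->
        exists delta : \bar R,
        unique (delta_star_eq d beta (mu + alpha) a) delta /\
        forall X : (forall N : nat, cycle_counts (fun k => V N * q N alpha k)),
        let p_pmf := fun N : nat => pressure N (Zideal N alpha *
            partition_function (X N) (V N) beta (H_pmf mu a))%E in
        (((mu + alpha)%:E <= a%:E * rho_c d beta)%E ->
           p_pmf N @[N --> \oo] -->
             ((a / 2)%:E * delta ^+ 2 +
              beta^-1%:E * \sum_(0 <= k <oo) (q_free d beta 0 k)%:E *
                expeR ((beta * k.+1%:R)%:E *
                       ((mu + alpha)%:E - a%:E * delta)))%E) /\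
        ((a%:E * rho_c d beta <= (mu + alpha)%:E)%E ->
           p_pmf N @[N --> \oo] -->
             (((mu + alpha) ^+ 2)%:E / (2 * a)%:E +
              beta^-1%:E * mass (q_free d beta 0%R))%E) &

      (* (iv) *)
      forall (mu alpha a b : R), alpha <= 0 -> 0 <= b -> b < a ->
        forall X : (forall N : nat, cycle_counts (fun k => V N * q N alpha k)),
        pressure N (Zideal N alpha *
            partition_function (X N) (V N) beta (H_hyl mu a b))%E
          @[N --> \oo] -->
          (ideal_pressure d beta 0%R -
           beta^-1%:E *
             ereal_inf [set rate_I d beta x +
                            beta%:E * H_hyl_lsc (mu + alpha) a b x |
                        x in [set x : nat -> R | l1 x]])%E].
Proof.
move=> d0 beta0 hDir V q pressure Zideal.
have free_mass m r : m - r <= 0 ->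
    (\sum_(0 <= k <oo) (q_free d beta 0 k)%:E *
       expeR ((beta * k.+1%:R)%:E * (m - r)%:E) = (fine (mass (q_free d beta (m - r))))%:E)%E.
  move=> h; rewrite fineK ?mass_q_free_fin//; apply: eq_eseriesr => k _.
  rewrite -[((beta * _)%:E * _)%E]EFinM /= -?EFinM (q_freeE _ beta0 (m - r)) (q_freeE _ beta0 0).
  rewrite mulr0 mul0r expR0 mul1r mulrC; congr (expR _ * _)%:E; ring.
split.
- move=> mu mu0; exact: ideal_pressure_cvg.
- move=> mu a mu0 a0 X; rewrite /cmf_pressure.
  have QE : mass (q_free d beta mu) = (fine (mass (q_free d beta mu)))%:E.
    by rewrite fineK// mass_q_free_fin.
  set Q := fine _ in QE *.
  case: ifPn => [/eqP aE|aN].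
    have h := @cmf_pressure_cvg _ _ _ d0 beta0 _ _ hDir _ mu0 X a 0 Q Q a0 erefl.
    rewrite QE -EFinM; move: h; rewrite aE !mul0r add0r; apply=> //.
    by rewrite oppr0 expR0 mul1r.
  have a_gt0 : 0 < a by rewrite lt_neqAle eq_sym aN.
  have Q0 : 0 <= Q by exact: q_free_mass_ge0.
  have aQ0 : 0 <= a * beta * Q by rewrite !mulr_ge0// ltW.
  have wE := lambertW0P aQ0; set w := lambertW0 _ in wE *.
  have abN : a * beta != 0 by rewrite gt_eqF// mulr_gt0.
  have FE : expR (- w) * Q = w / (a * beta).
    apply: (mulIf abN); rewrite mulfVK// -mulrA [Q * _]mulrC -wE expRN mulrC mulfK//.
    by rewrite gt_eqF// expR_gt0.
  have h := @cmf_pressure_cvg _ _ _ d0 beta0 _ _ hDir _ mu0 X a w Q (w / (a * beta)) a0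
    erefl (esym FE).
  have -> : (a * beta ^+ 2)^-1 * w * (1 + w / 2) =
      a / 2 * (w / (a * beta)) ^+ 2 + beta^-1 * (w / (a * beta)).
    by field; rewrite (gt_eqF a_gt0) (gt_eqF beta0).
  by apply: h; rewrite mulrC mulfVK.
- move=> mu alpha a alpha0; rewrite le_eqVlt => /predU1P[<-|a0].
    have [delta hdelta] := mul0_delta_star d beta (mu + alpha).
    exists delta; split=> // X.
    (* For a = 0 both thresholds are 0, even when the critical density is infinite. The inverse of 0
       is +oo here, so (mu + alpha)^2 / (2 a) is +oo when mu + alpha > 0, where the pressure
       diverges, and 0 * oo = 0 when mu + alpha = 0. *)
    rewrite !mul0e mul0r mul0e sube0 add0e mulr0 inve0.
    have sub : mu + alpha <= 0 -> bc_pressure X (H_pmf mu 0) N @[N --> \oo] -->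
        (beta^-1 * fine (mass (q_free d beta (mu + alpha))))%:E.
      move=> m0.
      have := @pmf_pressure_cvg_subcritical _ _ _ d0 beta0 _ _ hDir _ alpha0 X mu 0 0 (lexx 0).
      by rewrite !mul0r subr0 add0r ltxx; apply.
    split; rewrite lee_fin => m0.
      have := sub m0; rewrite EFinM.
      by rewrite -{1}(subr0 (mu + alpha)) -free_mass subr0.
    have [m_eq0|m_gt0] := leP (mu + alpha) 0.
      have mE : mu + alpha = 0 by apply/eqP; rewrite eq_le m0 m_eq0.
      have := sub m_eq0; rewrite mE expr0n mul0e add0e EFinM fineK//.
      exact: mass_q_free_fin.
    rewrite gt0_muley ?lte_fin ?exprn_gt0// -[mass _]fineK ?mass_q_free_fin//.
    rewrite -EFinM addye//; exact: pmf_pressure_dvg.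
  have [r hr] := delta_star_exists d0 beta0 (mu + alpha) a0.
  exists r%:E; split.
    by split=> // y hy; exact: (delta_star_unique beta0 a0 hr hy).
  move=> X; split=> hm.
    have nu0 := delta_star_subcritical beta0 a0 hr hm.
    rewrite -EFin_expe -EFinM -EFinM -EFinB free_mass// -EFinM -EFinD.
    apply: (@pmf_pressure_cvg_subcritical _ _ _ d0 beta0 _ _ hDir _ alpha0 X mu a r) => //.
      exact: ltW.
    by move=> _; rewrite -delta_star_eq_high.
  have aN : a != 0 by rewrite gt_eqF.
  have := @pmf_pressure_cvg_supercritical _ _ _ d0 beta0 _ _ hDir _ alpha0 X mu a
    ((mu + alpha) / a) (ltW a0).
  rewrite EFinD EFinM [in X in _ --> (_ + X)%E]EFinM fineK ?mass_q_free_fin//.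
  have -> : (((mu + alpha) ^+ 2)%R%:E / (2 * a)%R%:E =
      (a / 2)%R%:E * (((mu + alpha) / a) ^+ 2)%R%:E)%E.
    by rewrite inver mulf_eq0 (negbTE aN) orbF pnatr_eq0 -!EFinM; congr EFin; field.
  apply; first by rewrite mulrC divfK.
  move=> _; move: hm; rewrite rho_cE//.
  case: (dens _) => [D| |]; last by rewrite leNye.
    by rewrite -EFinM !lee_fin ler_pdivlMr// mulrC.
  by rewrite gt0_muley.
- move=> mu alpha a b alpha0 b0 ba X.
  exact: (@hyl_pressure_cvg _ _ _ d0 beta0 _ _ hDir _ alpha0 X mu a b b0 ba).
Qed.
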